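(* Let $(X,\sigma)$ be a holomorphic Poisson manifold and $D\subset X$ a simple normal crossings divisor satisfying the standing hypotheses listed in the context, and let $p\in D\cap X^\circ$. Work in an SNC coordinate polydisc $U\ni p$, $U\subset X^\circ$, with coordinates $(z_1,\dots,z_n)$ centered at $p$ and $D\cap U=\{z_1\cdots z_r=0\}$, and put $X_i=\sigma^\#(dz_i/z_i)$ for $1\le i\le r$. Let $\nabla^{\mathrm{Pois}}$ be a logarithmic Poisson connection on a holomorphic vector bundle $E$ of rank $e$, and let $\Theta$ be its matrix in a holomorphic frame of $E$ over $U$. Assume that: (1) $\nabla^{\mathrm{Pois}}$ is Poisson-flat; (2) $\Theta$ has fixed Euler--Poisson principal part $\Theta_0=\sum_{i=1}^r A_i^\circ X_i$, where $A_1^\circ,\dots,A_r^\circ\in \mathrm{Mat}_{e\times e}(\mathbb C)$ are pairwise commuting constant matrices; (3) $\Theta_0$ is effectively Poisson--Poincaré--Dulac non-resonant at $p$, including the Poincaré lower bound. Then, after shrinking $U$ around $p$, there exists a holomorphic gauge $H\in \mathrm{GL}_e(\mathcal O_U)$ such that $$\widetilde\Theta=(\delta H)H^{-1}+H\Theta H^{-1}=\sum_{i=1}^r\widetilde A_i\,\sigma^\#\Big(\frac{dz_i}{z_i}\Big),$$ where the matrices $\widetilde A_i\in \mathrm{Mat}_{e\times e}(\mathbb C)$ are constant and pairwise commuting. (The normal form is written relative to the chosen generators $X_i$; if these satisfy relations, the residue tuple is understood in the effective quotient $\mathfrak t_{\sigma,p}$.)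
   Context: **Poisson setting.** $X$ is a complex manifold of dimension $n$, $\sigma\in H^0(X,\wedge^2T_X)$ satisfies $[\sigma,\sigma]=0$ (Schouten bracket), $\{f,g\}_\sigma=\sigma(df,dg)$, and $\sigma^\#(\alpha)=\sigma(\alpha,\cdot)$. $X^\circ\subset X$ is the largest open subset on which $\sigma^\#$ has locally constant rank. **Standing hypotheses.** (i) $D=\bigcup_i D_i\subset X$ is a simple normal crossings (SNC) divisor with smooth irreducible components. (ii) If $2m$ is the generic rank of $\sigma^\#$, then $\{x: \operatorname{rank}\sigma_x<2m\}$ has complex codimension at least $2$. (iii) Each $D_i$ is a Poisson hypersurface: $\{\mathcal I_{D_i},\mathcal O_X\}_\sigma\subset\mathcal I_{D_i}$. **Logarithmic objects.** $T_X(-\log D)$ is the sheaf of holomorphic vector fields tangent to $D$; $\Omega^1_X(\log D)$ is its dual, generated in an SNC chart by $dz_1/z_1,\dots,dz_r/z_r,dz_{r+1},\dots,dz_n$. By (iii), $\sigma^\#$ maps $\Omega^1_X(\log D)$ into $T_X(-\log D)$. Put $\mathcal F_\sigma^{\log}:=\operatorname{Im}(\sigma^\#:\Omega^1_X(\log D)\to T_X(-\log D))$. In particular $X_i=\sigma^\#(dz_i/z_i)$ is a holomorphic section of $\mathcal F_\sigma^{\log}$. **The differential $\delta$.** On functions $\delta(f)=\sigma^\#(df)$; on vector fields $\delta(v)=[\sigma,v]=-L_v\sigma$. It is applied entrywise to matrices. **Connections.** A logarithmic Poisson connection on $E$ is a $\mathbb C$-linear sheaf map $\nabla^{\mathrm{Pois}}:\mathcal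 O_X(E)\to\mathcal F_\sigma^{\log}\otimes\mathcal O_X(E)$ with $\nabla^{\mathrm{Pois}}(fs)=\delta(f)\otimes s+f\nabla^{\mathrm{Pois}}(s)$. In a holomorphic frame $e=(e_1,\dots,e_e)$ (viewed as a column) it is given by a matrix $\Theta$ with entries in $\mathcal F_\sigma^{\log}$ via $\nabla^{\mathrm{Pois}}(e)=\Theta\cdot e$. It is Poisson-flat if $\delta\Theta+\Theta\wedge\Theta=0$, where $(\Theta\wedge\Theta)_{ab}=\sum_c\Theta_{ac}\wedge\Theta_{cb}$. Under a change of frame $\widetilde e=He$ the matrix becomes $(\delta H)H^{-1}+H\Theta H^{-1}$. **Fixed Euler--Poisson principal part.** Let $I_D=(z_1,\dots,z_r)\subset\mathcal O_U$. $\Theta$ has fixed Euler--Poisson principal part $\Theta_0=\sum_i A_i^\circ X_i$ if $\Theta=\Theta_0+V$ with $V$ residue-free and positive in boundary order, i.e. $V\in I_D\cdot\mathrm{Mat}_{e\times e}(\mathcal F_\sigma^{\log}(U))$ and the component of $V$ in each generator $X_i$ has vanishing residue along $D_i$: one can write $V=\sum_{i\le r}B_iX_i+\sum_{j>r}B_j\,\sigma^\#(dz_j)$ with holomorphic matrix coefficients and $B_i|_{z_i=0}=0$ for $1\le i\le r$. **Effective quotient.** Let $\mathfrak k_{\sigma,p}=\{(c_1,\dots,c_r)\in\mathbb C^r:\ \sum_i c_iX_i\equiv0 \pmod{I_D\mathcal F_\sigma^{\log}}\}$ (near $p$), $\mathfrak t_{\sigma,p}=\mathbb C^r/\mathfrak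 k_{\sigma,p}$, and write $[\mu]_\sigma\in\mathfrak t_{\sigma,p}$ for the class of $\mu\in\mathbb C^r$. **Effective non-resonance.** Let $\mathbb C^e=\bigoplus_{\kappa\in\mathcal I}E_\kappa$ be the joint generalized eigenspace decomposition of the commuting tuple $(A_1^\circ,\dots,A_r^\circ)$, so $A_i^\circ|_{E_\kappa}=\lambda_{i,\kappa}\mathrm{Id}+N_{i,\kappa}$ with $N_{i,\kappa}$ nilpotent. Put $\lambda_\kappa=(\lambda_{1,\kappa},\dots,\lambda_{r,\kappa})$ and $\bar\lambda_\kappa=[\lambda_\kappa]_\sigma$. $\Theta_0$ is effectively Poisson--Poincaré--Dulac non-resonant at $p$ if $[\alpha]_\sigma+\bar\lambda_\kappa-\bar\lambda_{\kappa'}\ne0$ in $\mathfrak t_{\sigma,p}$ for all $\kappa\ne\kappa'$ and all non-zero $\alpha\in\mathbb Z_{\ge0}^r$. Poincaré lower bound: for a norm on $\mathfrak t_{\sigma,p}$ there is $c>0$ with $\|[\alpha]_\sigma+\bar\lambda_\kappa-\bar\lambda_{\kappa'}\|\ge c$ for all such $\kappa\neq\kappa'$ and $\alpha$. *)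

(* Defs.v *)
From HB Require Import structures.
From mathcomp Require Import all_boot all_order all_algebra.
From mathcomp Require Import all_classical all_reals all_analysis.
From mathcomp Require Import complex.
Set Implicit Arguments.
Unset Strict Implicit.
Unset Printing Implicit Defensive.
Import Order.TTheory GRing.Theory Num.Theory.
Import numFieldNormedType.Exports.
Local Open Scope classical_set_scope.
Local Open Scope ring_scope.

(* R[i] viewed through its numFieldType structure, which is what gives it (and
   the spaces 'rV[C]_n) the norm and topology of MathComp-Analysis.  Hence
   [differentiable] below is Frechet differentiability over C. *)
Definition cplx (R : realType) : numFieldType := complex R.

Section Manifolds.
Variables (R : realType) (n : nat).
Local Notation C := (cplx R).

(* [cmap] and [cinv] are total functions; only the values of [cmap] on [cdom]
   and of [cinv] on [cmap @` cdom] are meaningful. *)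
Record chart (X : topologicalType) := Chart {
  cdom : set X;
  cmap : X -> 'rV[C]_n;
  cinv : 'rV[C]_n -> X;
  cdom_open : open cdom;
  codom_open : open (cmap @` cdom);
  cmapK : forall x, cdom x -> cinv (cmap x) = x;
  cmap_continuous : forall x, cdom x -> {for x, continuous cmap};
  cinv_continuous :
    forall z, (cmap @` cdom) z -> {for z, continuous cinv} }.

Definition holo_transition (X : topologicalType) (phi psi : chart X) : Prop :=
  forall x, cdom phi x -> cdom psi x ->
    differentiable (cmap psi \o cinv phi) (cmap phi x).

(* The atlas is the maximal one. *)
Record complexManifold := ComplexManifold {
  mfd_space :> topologicalType;
  mfd_hausdorff : hausdorff_space mfd_space;
  mfd_second_countable : @second_countable mfd_space;
  atlas : set (chart mfd_space);
  atlas_cover : forall x : mfd_space, exists2 phi, atlas phi & cdom phi x;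
  atlas_compatible :
    forall phi psi, atlas phi -> atlas psi -> holo_transition phi psi;
  atlas_maximal : forall phi,
    (forall psi, atlas psi -> holo_transition phi psi /\ holo_transition psi phi) ->
    atlas phi }.

Variable X : complexManifold.
Implicit Types (phi psi : chart X) (W : set X) (x y : X).

Definition holo_on W (f : X -> C) : Prop :=
  forall phi x, atlas phi -> W x -> cdom phi x ->
    differentiable (f \o cinv phi : 'rV[C]_n -> C) (cmap phi x).

Definition zc phi (i : 'I_n) : X -> C := fun x => cmap phi x ord0 i.

Definition partial phi (i : 'I_n) (f : X -> C) : X -> C := fun x =>
  'D_(delta_mx ord0 i) (f \o cinv phi : 'rV[C]_n -> C) (cmap phi x).

Definition jac phi psi x : 'M[C]_n :=
  \matrix_(i, k) partial phi i (zc psi k) x.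

(* Tensor fields are given by their components in every chart of the atlas, as
   functions on X; the values outside the chart domain are irrelevant. *)
Definition vfield := chart X -> X -> 'rV[C]_n.
Definition covfield := chart X -> X -> 'rV[C]_n.
Definition bivfield := chart X -> X -> 'M[C]_n.

Definition eq_vfield W (v w : vfield) : Prop :=
  forall phi x, atlas phi -> W x -> cdom phi x -> v phi x = w phi x.

Definition holo_vfield W (v : vfield) : Prop :=
  (forall phi i, atlas phi ->
     holo_on (W `&` cdom phi) (fun x => v phi x ord0 i)) /\
  (forall phi psi x, atlas phi -> atlas psi -> W x -> cdom phi x -> cdom psi x ->
     v psi x = v phi x *m jac phi psi x).

Definition dfun (f : X -> C) : covfield :=
  fun phi x => \row_i partial phi i f x.

Definition dlog (f : X -> C) : covfield :=
  fun phi x => (f x)^-1 *: dfun f phi x.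

(* An entry sigma phi x i j is sigma(dz_i, dz_j) in the chart phi. *)
Definition holo_bivfield (sigma : bivfield) : Prop :=
  [/\ forall phi x, atlas phi -> cdom phi x ->
        (sigma phi x)^T = - sigma phi x,
      forall phi i j, atlas phi ->
        holo_on (cdom phi) (fun x => sigma phi x i j)
    & forall phi psi x, atlas phi -> atlas psi -> cdom phi x -> cdom psi x ->
        sigma psi x = (jac phi psi x)^T *m sigma phi x *m jac phi psi x].

(* Components of the trivector field [sigma, sigma]. *)
Definition schouten_self (sigma : bivfield) phi x (i j k : 'I_n) : C :=
  2%:R * \sum_l
    (sigma phi x l i * partial phi l (fun y => sigma phi y j k) x
     + sigma phi x l j * partial phi l (fun y => sigma phi y k i) x
     + sigma phi x l k * partial phi l (fun y => sigma phi y i j) x).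

Definition holo_poisson (sigma : bivfield) : Prop :=
  holo_bivfield sigma /\
  (forall phi x i j k, atlas phi -> cdom phi x ->
     schouten_self sigma phi x i j k = 0).

(* sigma^#(alpha) = sigma(alpha, .) *)
Definition sharp (sigma : bivfield) (alpha : covfield) : vfield :=
  fun phi x => alpha phi x *m sigma phi x.

Definition delta0 (sigma : bivfield) (f : X -> C) : vfield :=
  sharp sigma (dfun f).

(* {f, g} in the chart phi *)
Definition bracket (sigma : bivfield) phi (f g : X -> C) : X -> C := fun x =>
  \sum_i \sum_j sigma phi x i j * partial phi i f x * partial phi j g x.

Definition lie_bivfield (v : vfield) (sigma : bivfield) : bivfield :=
  fun phi x => \matrix_(i, j) \sum_k
    (v phi x ord0 k * partial phi k (fun y => sigma phi y i j) x
     - sigma phi x k j * partial phi k (fun y => v phi y ord0 i) x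
     - sigma phi x i k * partial phi k (fun y => v phi y ord0 j) x).

(* delta(v) = [sigma, v] = - L_v sigma *)
Definition delta1 (sigma : bivfield) (v : vfield) : bivfield :=
  fun phi x => - lie_bivfield v sigma phi x.

Definition vwedge (u v : vfield) : bivfield := fun phi x =>
  \matrix_(i, j) (u phi x ord0 i * v phi x ord0 j - u phi x ord0 j * v phi x ord0 i).

Definition has_rank (sigma : bivfield) x (k : nat) : Prop :=
  exists2 phi, atlas phi & cdom phi x /\ \rank (sigma phi x) = k.

(* X°; this set is open by construction. *)
Definition locally_constant_rank (sigma : bivfield) : set X :=
  [set x | exists k, \forall y \near x, has_rank sigma y k].

Definition generic_rank (sigma : bivfield) (k : nat) : Prop :=
  dense (interior [set x | has_rank sigma x k]).

Definition degeneracy_locus (sigma : bivfield) (k : nat) : set X :=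
  [set x | exists2 l, (l < k)%N & has_rank sigma x l].

(* x is a point of Z at which Z is a complex submanifold of dimension d. *)
Definition regular_point (Z : set X) (d : nat) x : Prop :=
  Z x /\ (d <= n)%N /\
  exists phi, [/\ atlas phi, cdom phi x &
    forall y, cdom phi y ->
      (Z y <-> forall i : 'I_n, (d <= i)%N -> zc phi i y = 0)].

(* The dimension of an analytic set is the maximal dimension of its regular
   points. *)
Definition codim_ge2 (Z : set X) : Prop :=
  forall d x, regular_point Z d x -> (d + 2 <= n)%N.

(* phi is a chart of the atlas with D = {z_1 ... z_r = 0} on its domain. *)
Definition snc_chart (D : set X) (r : nat) phi : Prop :=
  [/\ atlas phi, (r <= n)%N &
    forall x, cdom phi x ->
      (D x <-> \prod_(k < n | (k < r)%N) zc phi k x = 0)].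

(* A connected closed submanifold is irreducible. *)
Definition snc_divisor (I : Type) (Di : I -> set X) : Prop :=
  [/\ forall i, [/\ Di i !=set0, closed (Di i), connected (Di i) &
        forall x, Di i x -> exists2 d, d.+1 = n & regular_point (Di i) d x],
      injective Di
    & forall x, exists r phi,
        [/\ snc_chart (\bigcup_i Di i) r phi, cdom phi x & cmap phi x = 0]].

Definition poisson_hypersurface (sigma : bivfield) (Z : set X) : Prop :=
  forall W (f g : X -> C), open W -> holo_on W f -> holo_on W g ->
    (forall x, W x -> Z x -> f x = 0) ->
    forall phi x, atlas phi -> W x -> cdom phi x -> Z x ->
      bracket sigma phi f g x = 0.

Definition standing_hypotheses (sigma : bivfield) (I : Type) (Di : I -> set X) :=
  [/\ snc_divisor Di,
      exists2 m, generic_rank sigma m.*2 &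
        codim_ge2 (degeneracy_locus sigma m.*2)
    & forall i, poisson_hypersurface sigma (Di i)].

Definition log_generator phi (r : nat) (k : 'I_n) : covfield :=
  if (k < r)%N then dlog (zc phi k) else dfun (zc phi k).

(* Sections of Omega^1_X(log D) over W, as forms on the complement of D. *)
Definition log_form (D : set X) W (eta : covfield) : Prop :=
  forall x, W x -> exists phi r W' (a : 'I_n -> X -> C),
    [/\ snc_chart D r phi,
        [/\ open W', W' x & W' `<=` W `&` cdom phi],
        forall k, holo_on W' (a k)
      & forall psi y, atlas psi -> W' y -> cdom psi y -> ~ D y ->
          eta psi y = \sum_k a k y *: log_generator phi r k psi y].

(* v is the holomorphic vector field sigma^#(eta) for a form eta with poles
   along D: equality off D determines v, as D is nowhere dense. *)
Definition is_log_sharp (sigma : bivfield) (D : set X) W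
    (eta : covfield) (v : vfield) : Prop :=
  holo_vfield W v /\ eq_vfield (W `\` D) v (sharp sigma eta).

(* Sections over W of the image sheaf of sigma^# on Omega^1_X(log D). *)
Definition Flog (sigma : bivfield) (D : set X) W (v : vfield) : Prop :=
  holo_vfield W v /\
  forall x, W x -> exists W' eta,
    [/\ open W', W' x, W' `<=` W, log_form D W' eta &
        is_log_sharp sigma D W' eta v].

Definition cpolydisc (rho : 'I_n -> C) : set 'rV[C]_n :=
  [set z | forall i, `|z ord0 i| < rho i].

Section Bundles.
Variable e : nat.

(* A holomorphic vector bundle of rank e: its fibres, and its local
   holomorphic frames over open sets. *)
Record holoBundle := HoloBundle {
  fiber : X -> lmodType C;
  local_frame : set X -> ('I_e -> forall x, fiber x) -> Prop;
  local_frame_open : forall W fr, local_frame W fr -> open W;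
  local_frame_basis : forall W fr, local_frame W fr ->
    forall x, W x -> forall v : fiber x,
      exists! c : 'rV[C]_e, v = \sum_j c ord0 j *: fr j x;
  local_frame_cover : forall x, exists W fr, local_frame W fr /\ W x;
  local_frame_compatible : forall W fr W' fr',
    local_frame W fr -> local_frame W' fr' ->
    exists g : X -> 'M[C]_e,
      (forall a b, holo_on (W `&` W') (fun x => g x a b)) /\
      (forall x, W x -> W' x -> forall a, fr' a x = \sum_b g x a b *: fr b x) }.

Variable E : holoBundle.

Definition bsection := forall x, fiber E x.

Definition holo_section W (s : bsection) : Prop :=
  forall W' fr, @local_frame E W' fr ->
    exists c : X -> 'rV[C]_e,
      (forall j, holo_on (W `&` W') (fun x => c x ord0 j)) /\
      (forall x, W x -> W' x -> s x = \sum_j c x ord0 j *: fr j x).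

Definition holo_frame W (fr : 'I_e -> bsection) : Prop :=
  (forall a, holo_section W (fr a)) /\
  (forall x, W x -> forall v : fiber E x,
     exists! c : 'rV[C]_e, v = \sum_j c ord0 j *: fr j x).

(* Sections of T_X (x) E: t phi i is the E-valued component along d/dz_i in the
   chart phi. *)
Definition te_section := chart X -> 'I_n -> bsection.

Definition te_tensor (v : vfield) (s : bsection) : te_section :=
  fun phi i x => v phi x ord0 i *: s x.

Definition eq_te W (t t' : te_section) : Prop :=
  forall phi i x, atlas phi -> W x -> cdom phi x -> t phi i x = t' phi i x.

Variables (sigma : bivfield) (D : set X).

(* Sections of F (x) O(E), a subsheaf of T_X (x) E since O(E) is locally free. *)
Definition FE_section W (t : te_section) : Prop :=
  forall x, W x -> exists W' (N : nat) (u : 'I_N -> vfield) (s : 'I_N -> bsection),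
    [/\ open W', W' x, W' `<=` W,
        forall k, Flog sigma D W' (u k) /\ holo_section W' (s k)
      & eq_te W' t (fun phi i y => \sum_k te_tensor (u k) (s k) phi i y)].

Record logPoissonConnection := LogPoissonConnection {
  conn : set X -> bsection -> te_section;
  conn_FE : forall W s, open W -> holo_section W s -> FE_section W (conn W s);
  (* sheaf map: compatibility with restriction (and with equality over W') *)
  conn_restrict : forall W W' s s', open W -> open W' -> W' `<=` W ->
    holo_section W s -> holo_section W' s' -> (forall x, W' x -> s x = s' x) ->
    eq_te W' (conn W' s') (conn W s);
  conn_linear : forall W (a : C) s s', open W ->
    holo_section W s -> holo_section W s' ->
    eq_te W (conn W (fun x => a *: s x + s' x))
      (fun phi i x => a *: conn W s phi i x + conn W s' phi i x);
  conn_leibniz : forall W (f : X -> C) s, open W ->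
    holo_on W f -> holo_section W s ->
    eq_te W (conn W (fun x => f x *: s x))
      (fun phi i x => te_tensor (delta0 sigma f) s phi i x + f x *: conn W s phi i x) }.

Definition vfmatrix := 'I_e -> 'I_e -> vfield.

(* nabla(e) = Theta . e for the frame e viewed as a column *)
Definition connection_matrix (nabla : logPoissonConnection) W
    (fr : 'I_e -> bsection) (Theta : vfmatrix) : Prop :=
  (forall a b, Flog sigma D W (Theta a b)) /\
  (forall a, eq_te W (conn nabla W (fr a))
     (fun phi i x => \sum_b te_tensor (Theta a b) (fr b) phi i x)).

End Bundles.

Definition poisson_flat (e : nat) (sigma : bivfield) W (Theta : vfmatrix e) : Prop :=
  forall a b phi x, atlas phi -> W x -> cdom phi x ->
    delta1 sigma (Theta a b) phi x
    + \sum_c vwedge (Theta a c) (Theta c b) phi x = 0.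

(* (delta H) H^-1 + H Theta H^-1 *)
Definition gauge (e : nat) (sigma : bivfield) (H : X -> 'M[C]_e)
    (Theta : vfmatrix e) : vfmatrix e := fun a b phi x =>
  \sum_c invmx (H x) c b *: delta0 sigma (fun y => H y a c) phi x
  + \sum_c \sum_d (H x a c * invmx (H x) d b) *: Theta c d phi x.

Section NormalForm.
Variables (sigma : bivfield) (D : set X) (phi : chart X) (r : nat).
Variable hr : (r <= n)%N.
Variable Xg : 'I_r -> vfield.

Local Notation wd := (widen_ord hr).

Definition euler_poisson (e : nat) (A : 'I_r -> 'M[C]_e) : vfmatrix e :=
  fun a b psi x => \sum_i A i a b *: Xg i psi x.

Definition fixed_principal_part (e : nat) (A : 'I_r -> 'M[C]_e)
    (Theta : vfmatrix e) : Prop :=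
  exists V : vfmatrix e,
    [/\ forall a b, eq_vfield (cdom phi) (Theta a b)
          (fun psi x => euler_poisson A a b psi x + V a b psi x),
        exists w : 'I_r -> vfmatrix e,
          (forall i a b, Flog sigma D (cdom phi) (w i a b)) /\
          (forall a b, eq_vfield (cdom phi) (V a b)
             (fun psi x => \sum_i zc phi (wd i) x *: w i a b psi x))
      & exists B : 'I_n -> X -> 'M[C]_e,
          [/\ forall k a b, holo_on (cdom phi) (fun x => B k x a b),
              forall i x, cdom phi x -> zc phi (wd i) x = 0 -> B (wd i) x = 0
            & forall a b, eq_vfield (cdom phi) (V a b)
                (fun psi x =>
                   \sum_i B (wd i) x a b *: Xg i psi x
                   + \sum_(j < n | (r <= j)%N)
                       B j x a b *: sharp sigma (dfun (zc phi j)) psi x)]].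

(* The subspace k_{sigma,p} of C^r. *)
Definition keff (p : X) : set 'rV[C]_r :=
  [set c | exists W (w : 'I_r -> vfield),
     [/\ open W, W p, W `<=` cdom phi, forall i, Flog sigma D W (w i) &
         eq_vfield W (fun psi x => \sum_i c ord0 i *: Xg i psi x)
           (fun psi x => \sum_i zc phi (wd i) x *: w i psi x)]].

(* The class [mu]_sigma in C^r / k_{sigma,p}, as a coset. *)
Definition eff_class (p : X) (mu : 'rV[C]_r) : set 'rV[C]_r :=
  [set nu | keff p (nu - mu)].

(* Norms on C^r / k_{sigma,p}; as usual for the field C, real numbers are
   complex numbers comparable with 0. *)
Definition eff_norm (p : X) (N : set 'rV[C]_r -> C) : Prop :=
  [/\ forall mu, 0 <= N (eff_class p mu),
      forall mu, N (eff_class p mu) = 0 -> eff_class p mu = eff_class p 0,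
      forall (a : C) mu, N (eff_class p (a *: mu)) = `|a| * N (eff_class p mu)
    & forall mu nu, N (eff_class p (mu + nu))
                    <= N (eff_class p mu) + N (eff_class p nu)].

Definition joint_gen_eigenspace (e : nat) (A : 'I_r -> 'M[C]_e)
    (lam : 'rV[C]_r) : set 'cV[C]_e :=
  [set v | forall i, exists k, (A i - (lam ord0 i)%:M) ^+ k *m v = 0].

(* The weights lambda_kappa; distinct blocks kappa have distinct weights, so the
   weights serve as the index set of the decomposition. *)
Definition joint_weight (e : nat) (A : 'I_r -> 'M[C]_e) : set 'rV[C]_r :=
  [set lam | exists2 v, joint_gen_eigenspace A lam v & v != 0].

Definition nat_row (alpha : 'I_r -> nat) : 'rV[C]_r := \row_i (alpha i)%:R.

Definition eff_nonresonant (e : nat) (p : X) (A : 'I_r -> 'M[C]_e) : Prop :=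
  forall lam lam' (alpha : 'I_r -> nat),
    joint_weight A lam -> joint_weight A lam' -> lam != lam' ->
    (exists i, alpha i != 0%N) ->
    eff_class p (nat_row alpha + lam - lam') <> eff_class p 0.

Definition poincare_lower_bound (e : nat) (p : X) (A : 'I_r -> 'M[C]_e) : Prop :=
  exists N (c : C), [/\ eff_norm p N, 0 < c &
    forall lam lam' (alpha : 'I_r -> nat),
      joint_weight A lam -> joint_weight A lam' -> lam != lam' ->
      (exists i, alpha i != 0%N) ->
      c <= N (eff_class p (nat_row alpha + lam - lam'))].

End NormalForm.

End Manifolds.

(* Main.v *)
(* On X° the Poisson structure is regular near p, and Theta, being sigma^# of a
   logarithmic form off D, has its components in the row space of sigma; by
   density and constant rank this persists on D.  Hence X_i and Theta are tangent
   to the symplectic foliation, Poisson flatness is flatness along its leaves,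
   and Theta can be gauged to 0 near p, so that the zero matrices are a normal
   form.  Commuting fields v_1, ..., v_k spanning the foliation with
   v_j(z_{g(m)}) = delta_{jm} lift to commuting operators P_j = v_j + . psi_j, and
   the Lie series F |-> sum_m (-z_{g(j)})^m / m! P_j^m F telescopes under P_j and
   commutes with the other P_i; composing these series on F = 1 yields a
   simultaneous solution.  Convergence is a repeated Cauchy estimate.  That
   estimate is derived for merely differentiable functions from Goursat's
   bisection applied to trapezoidal sums (which vanish on affine functions), so
   that no integral is involved. *)

Require Import Defs.
From HB Require Import structures.
From mathcomp Require Import all_boot all_order all_algebra.
From mathcomp Require Import all_classical all_reals all_analysis.
From mathcomp Require Import complex.
From mathcomp Require Import ring lra zify.
Set Implicit Arguments.
Unset Strict Implicit.
Unset Printing Implicit Defensive.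
Import Order.TTheory GRing.Theory Num.Theory.
Import numFieldNormedType.Exports.
Local Open Scope classical_set_scope.
Local Open Scope ring_scope.

(** * Norms as real numbers, differentiability in epsilon-delta form *)

(** Why the residues can disappear: sigma^#(dz_i) = z_i X_i vanishes on z_i = 0, so in the regular
    locus this hypersurface is a union of leaves and z_i is locally a unit times a Casimir. Hence
    X_i = delta(log of that unit) is exact along the leaves and carries no invariant residue. The
    proof does not choose such adapted coordinates. Inverting a maximal minor of sigma gives fields
    whose coefficients are rational in sigma, and the coordinates z_{g(m)} that belong to the
    columns of the minor serve as leaf coordinates; neither Darboux coordinates nor a straightening
    of the foliation enters. The analytic obstacle is that holomorphy means Frechet
    differentiability at each point, while the operators P_j are iterated without bound and their
    commutation requires symmetric second partials. Smoothness therefore has to be proved before any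
    series is formed. Inequalities suffice for this: the sum of 1/w around a square is only bounded
    below, never evaluated, and derivatives are reached as locally uniform limits of difference
    quotients. *)

Section RealNorm.
Variable R : realType.
Local Notation C := (cplx R).
(** The norm over [C] takes values in [C]; its real part moves all estimates into an ordered field,
    where linear arithmetic applies. *)
Definition nr (V : normedModType C) (x : V) : R := complex.Re `|x|.

Lemma nrE (V : normedModType C) (x : V) : `|x| = (nr x)%:C%C.
Proof.
rewrite /nr. have : (0 : C) <= `|x| by rewrite normr_ge0.
by case: (`|x|) => a b; rewrite lecE /= => /andP[/eqP -> _].
Qed.

Lemma nr_ge0 (V : normedModType C) (x : V) : 0 <= nr x.
Proof. by rewrite -(@lecR R) -nrE normr_ge0. Qed.

Lemma nrD (V : normedModType C) (x y : V) : nr (x + y) <= nr x + nr y.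
Proof. by rewrite -(@lecR R) rmorphD /= -!nrE ler_normD. Qed.
Lemma nrN (V : normedModType C) (x : V) : nr (- x) = nr x.
Proof. by rewrite /nr normrN. Qed.
Lemma nr0 (V : normedModType C) : nr (0 : V) = 0.
Proof. by rewrite /nr normr0. Qed.
Lemma nrZ (V : normedModType C) (a : C) (x : V) : nr (a *: x) = nr a * nr x.
Proof. by apply: (@complexI R); rewrite rmorphM /= -!nrE normrZ. Qed.
Lemma nrM (a b : C) : nr (a * b) = nr a * nr b.
Proof. by apply: (@complexI R); rewrite rmorphM /= -!nrE normrM. Qed.
Lemma nr_eq0 (V : normedModType C) (x : V) : nr x = 0 -> x = 0.
Proof. by move=> h; apply/normr0_eq0; rewrite nrE h. Qed.
Lemma nrV (a : C) : nr a^-1 = (nr a)^-1.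
Proof. by apply: (@complexI R); rewrite fmorphV /= -!nrE normfV. Qed.
Lemma nr_real (a : R) : nr (a%:C%C : C) = `|a|.
Proof. rewrite /nr normc_def /= expr0n addr0 sqrtr_sqr //. Qed.

Lemma nr_nbhs (V : normedModType C) (a : V) (P : set V) :
  nbhs a P <-> exists d : R, 0 < d /\ forall x, nr (x - a) < d -> P x.
Proof.
split.
  move/nbhs_normP => [e /= e0 h]; exists (complex.Re e).
  have ee : e = (complex.Re e)%:C%C.
    by move: e0; clear h; case: e => x y; rewrite ltcE /= => /andP[/eqP -> _].
  split; first by rewrite -(@ltcR R) -ee.
  by move=> x hx; apply: h; rewrite /ball_ /= distrC nrE ee ltcR.
move=> [d [d0 h]]; apply/nbhs_normP; exists (d%:C%C : C); first by rewrite /= ltcR.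
by move=> x; rewrite /ball_ /= distrC nrE ltcR => /h.
Qed.

Lemma nr_continuous (V W : normedModType C) (f : V -> W) a :
  {for a, continuous f} <-> (forall e : R, 0 < e -> exists d : R, 0 < d /\
    forall x, nr (x - a) < d -> nr (f x - f a) < e).
Proof.
split.
  move=> fc e e0.
  have : nbhs (f a) [set y | nr (y - f a) < e] by apply/nr_nbhs; exists e.
  by move=> /fc /= /nr_nbhs.
move=> h P /= /nr_nbhs [e [e0 eP]].
have [d [d0 hd]] := h e e0.
by apply/nr_nbhs; exists d; split=> // x /hd /eP.
Qed.

Lemma littleo_nrP (V W : normedModType C) (f : V -> W) :
  (forall e : C, 0 < e -> \forall x \near (0 : V), `|f x| <= e * `|x|) <->
  (forall e : R, 0 < e -> exists d : R, 0 < d /\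
    forall w, nr w < d -> nr (f w) <= e * nr w).
Proof.
split.
  move=> h e e0.
  have /h : (0 : C) < e%:C%C by rewrite ltcR.
  move=> /nr_nbhs [d [d0 hd]]; exists d; split=> // w hw.
  have := hd w; rewrite subr0 => /(_ hw).
  by rewrite !nrE -rmorphM /= lecR.
move=> h e e0.
have ee : e = (complex.Re e)%:C%C.
  by move: e0; case: e => x y; rewrite ltcE /= => /andP[/eqP -> _].
have e1 : 0 < complex.Re e by rewrite -(@ltcR R) -ee.
have [d [d0 hd]] := h _ e1.
apply/nr_nbhs; exists d; split=> // w; rewrite subr0 => /hd hw.
by rewrite ee !nrE -rmorphM /= lecR.
Qed.

Lemma diff_eps (V W : normedModType C) (f : V -> W) a : differentiable f a ->
  forall e : R, 0 < e -> exists d : R, 0 < d /\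
    forall w, nr w < d -> nr (f (a + w) - f a - 'D_w f a) <= e * nr w.
Proof.
move=> df; have /diff_locally /eqaddoP /littleo_nrP h := df.
move=> e /h [d [d0 hd]]; exists d; split=> // w /hd.
by rewrite deriveE // !fctE /= opprD addrA [w + a]addrC.
Qed.

(** A linear map on an arbitrary normed space may be discontinuous; the bound [K] excludes this, so
    that [diff_unique] identifies [L] with the differential. *)
Lemma diff_intro (V W : normedModType C) (f : V -> W) a (L : {linear V -> W}) (K : R) :
  (forall w, nr (L w) <= K * nr w) ->
  (forall e : R, 0 < e -> exists d : R, 0 < d /\
    forall w, nr w < d -> nr (f (a + w) - f a - L w) <= e * nr w) ->
  differentiable f a /\ forall w, 'D_w f a = L w.
Proof.
move=> LK h.
have Lc : continuous L.
  move=> x; apply/nr_continuous => e e0.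
  have K1 : 0 < `|K| + 1 by rewrite ltr_wpDl.
  exists (e / (`|K| + 1)); split; first by rewrite divr_gt0.
  move=> y; rewrite ltr_pdivlMr // -linearB /= => hy.
  apply: le_lt_trans (LK _) _; apply: le_lt_trans hy.
  rewrite mulrC ler_wpM2l ?nr_ge0 //; have := ler_norm K; lra.
have hL : f \o shift a = cst (f a) + L +o_ 0 id.
  apply/eqaddoP/littleo_nrP => e /h [d [d0 hd]]; exists d; split=> // w /hd.
  by rewrite !fctE /= opprD addrA [w + a]addrC.
have dE := diff_unique Lc hL.
have df : differentiable f a.
  apply/diff_locallyP; split.
    by rewrite dE.
  by rewrite dE.
by split=> // w; rewrite deriveE // dE.
Qed.

Lemma deriveDv (V W : normedModType C) (f : V -> W) a u v : differentiable f a ->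
  'D_(u + v) f a = 'D_u f a + 'D_v f a.
Proof. by move=> df; rewrite !deriveE // linearD. Qed.
Lemma deriveZv (V W : normedModType C) (f : V -> W) a (c : C) v : differentiable f a ->
  'D_(c *: v) f a = c *: 'D_v f a.
Proof. by move=> df; rewrite !deriveE // linearZ. Qed.

End RealNorm.

(** * Trapezoidal sums along squares *)

Section TrapezoidalSums.
Variable R : realType.
Local Notation C := (cplx R).
Local Notation ii := (Complex 0 1 : C).

Lemma nested_intervals (x s : nat -> R) : (forall k, 0 <= s k) ->
  (forall k, x k <= x k.+1) -> (forall k, x k.+1 + s k.+1 <= x k + s k) ->
  exists a, forall k, x k <= a <= x k + s k.
Proof.
move=> s0 xi xs.
have mx m k : (m <= k)%N -> x m <= x k.
  by move=> /subnK <-; elim: (k - m)%N => // q ih; rewrite addSn (le_trans ih).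
have ms m k : (m <= k)%N -> x k + s k <= x m + s m.
  by move=> /subnK <-; elim: (k - m)%N => // q ih; rewrite addSn (le_trans (xs _)).
have ub m k : x k <= x m + s m.
  have [km|mk] := leqP k m; first by rewrite (le_trans (mx _ _ km)) // lerDl.
  by rewrite (le_trans _ (ms _ _ (ltnW mk))) // lerDl.
have hs : has_sup (range x).
  split; first by exists (x 0%N), 0%N.
  by exists (x 0%N + s 0%N) => _ [k _ <-].
exists (sup (range x)) => k; apply/andP; split.
  by apply: sup_upper_bound => //; exists k.
by apply: ge_sup; [exists (x 0%N), 0%N|move=> _ [m _ <-]].
Qed.

(** Trapezoidal rule with [N] steps for the integral of [g] along the segment from [a] to
    [a + N h]. *)
Definition trap (N : nat) (g : C -> C) (a h : C) : C :=
  \sum_(i < N) (g (a + i%:R * h) + g (a + i.+1%:R * h)) / 2%:R * h.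

Lemma trapD N g a h M : trap (N + M) g a h = trap N g a h + trap M g (a + N%:R * h) h.
Proof.
rewrite /trap big_split_ord /=; congr (_ + _); apply: eq_bigr => i _.
by rewrite -!addrA -!mulrDl -!natrD addnS.
Qed.

Lemma trap_affine N (al be a h : C) :
  trap N (fun w => al + be * w) a h =
  N%:R * h * (al + be * a) + be * h ^+ 2 * N%:R ^+ 2 / 2%:R.
Proof.
have two : (2%:R : C) != 0 by rewrite pnatr_eq0.
rewrite /trap; elim: N => [|N ih]; first by rewrite big_ord0 !mul0r expr0n /= mulr0 mul0r addr0.
by rewrite big_ord_recr /= ih -natr1; field.
Qed.

Lemma trap_fD N (f g : C -> C) a h :
  trap N (fun w => f w + g w) a h = trap N f a h + trap N g a h.
Proof. by rewrite /trap -!big_split /=; apply: eq_bigr => i _; ring. Qed.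

Lemma trapZ N (c : C) (g : C -> C) a h :
  trap N (fun w => c * g w) a h = c * trap N g a h.
Proof. by rewrite /trap mulr_sumr; apply: eq_bigr => i _; ring. Qed.

Lemma nr_sum (V : normedModType C) (I : finType) (P : pred I) (F : I -> V) :
  nr (\sum_(i | P i) F i) <= \sum_(i | P i) nr (F i).
Proof.
elim/big_ind2 : _ => //; first by rewrite nr0.
by move=> x1 x2 y1 y2 h1 h2; rewrite (le_trans (nrD _ _)) // lerD.
Qed.

Lemma trap_bound N g a h (M : R) :
  (forall i, (i <= N)%N -> nr (g (a + i%:R * h)) <= M) ->
  nr (trap N g a h) <= N%:R * nr h * M.
Proof.
move=> hM; apply: le_trans (nr_sum _ _) _.
have -> : N%:R * nr h * M = \sum_(i < N) (nr h * M).
  by rewrite sumr_const card_ord -mulrA mulr_natl.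
apply: ler_sum => i _; rewrite !nrM mulrC ler_wpM2l ?nr_ge0 //.
rewrite nrV (_ : nr (2%:R : C) = 2); last first.
  have -> : (2%:R : C) = (2%:R : R)%:C%C by rewrite rmorph_nat.
  by rewrite nr_real ger0_norm.
have := nrD (g (a + i%:R * h)) (g (a + i.+1%:R * h)).
have := hM _ (ltnW (ltn_ord i)); have := hM _ (ltn_ord i); lra.
Qed.

(** Counterclockwise around the square with corner [c] and side [N h]: bottom, right, then top and
    left with reversed sign. *)
Definition square_sum N g (c h : C) : C :=
  trap N g c h + trap N g (c + N%:R * h) (ii * h)
  - trap N g (c + N%:R * (ii * h)) h - trap N g c (ii * h).

(** All nine squares use the step [h] of the large one, so the sums along inner edges cancel
    exactly. Thirds replace the usual halves because the centre of the square is then interior to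
    one of the pieces, as is needed around a pole. *)
Lemma square_sum_split N g c h :
  square_sum (N + N + N) g c h = \sum_(p < 3) \sum_(q < 3)
    square_sum N g (c + p%:R * (N%:R * h) + q%:R * (N%:R * (ii * h))) h.
Proof.
(* [A p q] and [B p q] are the sums along the horizontal and the vertical edge that start at the
   grid point (p, q). *)
pose A p q := trap N g (c + p%:R * (N%:R * h) + q%:R * (N%:R * (ii * h))) h.
pose B p q := trap N g (c + p%:R * (N%:R * h) + q%:R * (N%:R * (ii * h))) (ii * h).
have -> : \sum_(p < 3) \sum_(q < 3)
    square_sum N g (c + p%:R * (N%:R * h) + q%:R * (N%:R * (ii * h))) h =
   \sum_(p < 3) \sum_(q < 3) (A p q + B p.+1 q - A p q.+1 - B p q).
  apply: eq_bigr => p _; apply: eq_bigr => q _.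
  rewrite /square_sum; congr (_ + _ - _ - _); rewrite /A /B.
    by congr (trap _ _ _ _); rewrite -natr1; ring.
  by congr (trap _ _ _ _); rewrite -natr1; ring.
rewrite !big_ord_recl !big_ord0 /= /bump /=.
rewrite /square_sum !trapD.
have a0 q x : x = c + q%:R * (N%:R * (ii * h)) -> trap N g x h = A 0%N q.
  by move=> ->; rewrite /A mul0r addr0.
have a1 q x : x = c + q%:R * (N%:R * (ii * h)) + N%:R * h -> trap N g x h = A 1%N q.
  by move=> ->; rewrite /A; congr (trap _ _ _ _); ring.
have a2 q x : x = c + q%:R * (N%:R * (ii * h)) + (N + N)%N%:R * h -> trap N g x h = A 2%N q.
  by move=> ->; rewrite /A; congr (trap _ _ _ _); rewrite natrD; ring.
have b0 p x : x = c + p%:R * (N%:R * h) -> trap N g x (ii * h) = B p 0%N.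
  by move=> ->; rewrite /B mul0r addr0.
have b1 p x : x = c + p%:R * (N%:R * h) + N%:R * (ii * h) -> trap N g x (ii * h) = B p 1%N.
  by move=> ->; rewrite /B; congr (trap _ _ _ _); ring.
have b2 p x : x = c + p%:R * (N%:R * h) + (N + N)%N%:R * (ii * h) -> trap N g x (ii * h) = B p 2%N.
  by move=> ->; rewrite /B; congr (trap _ _ _ _); rewrite natrD; ring.
rewrite (a0 0%N) ?mul0r ?addr0 // (a1 0%N) ?mul0r ?addr0 // (a2 0%N) ?mul0r ?addr0 //.
rewrite (b0 3%N); last by rewrite !natrD; ring.
rewrite (b1 3%N); last by rewrite !natrD; ring.
rewrite (b2 3%N); last by rewrite !natrD; ring.
rewrite (a0 3%N); last by rewrite !natrD; ring.
rewrite (a1 3%N); last by rewrite !natrD; ring.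
rewrite (a2 3%N); last by rewrite !natrD; ring.
rewrite (b0 0%N) ?mul0r ?addr0 // (b1 0%N) ?mul0r ?addr0 // (b2 0%N) ?mul0r ?addr0 //.
ring.
Qed.

Lemma square_sum_affine N al be c h : square_sum N (fun w => al + be * w) c h = 0.
Proof.
have i2 : ii ^+ 2 = -1 by apply: sqr_i.
have two : (2%:R : C) != 0 by rewrite pnatr_eq0.
by rewrite /square_sum !trap_affine [(ii * h) ^+ 2]exprMn i2; field.
Qed.

Lemma square_sumD N f g c h :
  square_sum N (fun w => f w + g w) c h = square_sum N f c h + square_sum N g c h.
Proof. by rewrite /square_sum !trap_fD; ring. Qed.

Lemma square_sumZ N k g c h :
  square_sum N (fun w => k * g w) c h = k * square_sum N g c h.
Proof. by rewrite /square_sum !trapZ; ring. Qed.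
End TrapezoidalSums.

(** * Goursat's lemma for trapezoidal sums *)

Section Goursat.
Variable R : realType.
Local Notation C := (cplx R).
Local Notation ii := (Complex 0 1 : C).

Lemma natC (k : nat) : (k%:R : C) = (k%:R : R)%:C%C.
Proof. by rewrite rmorph_nat. Qed.

Lemma realCM (a b : R) : (a * b)%:C%C = a%:C%C * b%:C%C :> C.
Proof. by rewrite rmorphM. Qed.

Lemma nr_nat (k : nat) : nr (k%:R : C) = k%:R.
Proof.
by rewrite natC nr_real ger0_norm.
Qed.

Lemma nr_ii : nr ii = 1.
Proof. by rewrite /nr normc_def /= expr0n add0r expr1n sqrtr1. Qed.

Lemma nr_le_ReIm (z : C) : nr z <= `|complex.Re z| + `|complex.Im z|.
Proof.
rewrite {1}(complexE z) (le_trans (nrD _ _)) // nr_real lerD2l.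
by rewrite nrM nr_ii mul1r nr_real.
Qed.

Lemma nr_ge_Re (z : C) : `|complex.Re z| <= nr z.
Proof.
rewrite /nr normc_def /= -sqrtr_sqr; apply: ler_wsqrtr.
by rewrite lerDl sqr_ge0.
Qed.

Lemma nr_ge_Im (z : C) : `|complex.Im z| <= nr z.
Proof.
rewrite /nr normc_def /= -sqrtr_sqr; apply: ler_wsqrtr.
by rewrite lerDr sqr_ge0.
Qed.

Lemma pow_small (s d b : R) : 0 <= s -> 0 < d -> 2 <= b -> exists k, s / b ^+ k < d.
Proof.
move=> s0 d0 b2; exists (Num.Def.archi_bound (s / d)).
have b0 : 0 < b by lra.
have sd : 0 <= s / d by rewrite divr_ge0 // ltW.
rewrite ltr_pdivrMr ?exprn_gt0 //.
have := upper_nthrootP (leqnn (Num.Def.archi_bound (s / d))).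
rewrite ltr_pdivrMr // mulrC => h; apply: lt_le_trans h _.
by apply: (ler_wpM2l (ltW d0)); rewrite lerXn2r ?nnegrE // ltW.
Qed.

Definition in_square (c : C) (s : R) (z : C) :=
  (complex.Re c <= complex.Re z <= complex.Re c + s) /\
  (complex.Im c <= complex.Im z <= complex.Im c + s).

Lemma in_square_dist c s z w : in_square c s z -> in_square c s w -> nr (z - w) <= 2 * s.
Proof.
case: z w c => [a b] [a' b'] [x y] [/= /andP[h1 h2] /andP[h3 h4]] [/= /andP[h5 h6] /andP[h7 h8]].
apply: le_trans (nr_le_ReIm _) _ => /=.
have : `|a - a'| <= s by rewrite ler_norml; lra.
have : `|b - b'| <= s by rewrite ler_norml; lra.
lra.
Qed.

(** The perimeter times the bound. Only boundary points are constrained, so [g] may be singular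
    inside. *)
Lemma square_sum_bound N g (c : C) (s M : R) : (0 < N)%N -> 0 <= s ->
  (forall z, in_square c s z ->
     [|| complex.Re z == complex.Re c, complex.Re z == complex.Re c + s,
         complex.Im z == complex.Im c | complex.Im z == complex.Im c + s] ->
     nr (g z) <= M) ->
  nr (square_sum N g c (s / N%:R)%:C%C) <= 4 * s * M.
Proof.
move=> N0 s0 hM.
have Npos : 0 < (N%:R : R) by rewrite ltr0n.
pose h := s / N%:R.
have hE : N%:R * h%:C%C = s%:C%C :> C.
  by rewrite natC -realCM mulrC divfK ?gt_eqF.
have step (i : nat) : i%:R * h%:C%C = (i%:R * h)%:C%C :> C.
  by rewrite natC realCM.
have hi i : (i <= N)%N -> 0 <= i%:R * h <= s.
  move=> iN; apply/andP; split; first by rewrite mulr_ge0 // divr_ge0 // ltW.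
  by rewrite /h mulrA ler_pdivrMr // mulrC ler_wpM2l // ler_nat.
have nh : N%:R * nr (h%:C%C : C) = s.
  by rewrite nr_real ger0_norm ?divr_ge0 // ?ltW // mulrC divfK ?gt_eqF.
have nh2 : N%:R * nr (ii * h%:C%C : C) = s by rewrite nrM nr_ii mul1r.
have b1 : nr (trap N g c h%:C%C) <= s * M.
  rewrite -{1}nh; apply: trap_bound => i iN; rewrite step; have /andP[p q] := hi _ iN; case: (c) hM => x y hM.
  apply: hM; first by split; rewrite /=; lra.
  by apply/or4P; constructor 3; apply/eqP => /=; ring.
have b2 : nr (trap N g (c + N%:R * h%:C%C) (ii * h%:C%C)) <= s * M.
  rewrite -{1}nh2; apply: trap_bound => i iN; rewrite hE [i%:R * _]mulrCA step.
  have /andP[p q] := hi _ iN; case: (c) hM => x y hM.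
  apply: hM; first by split; rewrite /=; lra.
  by apply/or4P; constructor 2; apply/eqP => /=; ring.
have b3 : nr (trap N g (c + N%:R * (ii * h%:C%C)) h%:C%C) <= s * M.
  rewrite -{1}nh; apply: trap_bound => i iN; rewrite [N%:R * _]mulrCA hE step.
  have /andP[p q] := hi _ iN; case: (c) hM => x y hM.
  apply: hM; first by split; rewrite /=; lra.
  by apply/or4P; constructor 4; apply/eqP => /=; ring.
have b4 : nr (trap N g c (ii * h%:C%C)) <= s * M.
  rewrite -{1}nh2; apply: trap_bound => i iN; rewrite [i%:R * _]mulrCA step.
  have /andP[p q] := hi _ iN; case: (c) hM => x y hM.
  apply: hM; first by split; rewrite /=; lra.
  by apply/or4P; constructor 1; apply/eqP => /=; ring.
rewrite /square_sum; have := nrD (trap N g c h%:C%C) (trap N g (c + N%:R * h%:C%C) (ii * h%:C%C)).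
set A := trap _ _ _ _ in b1 *; set B := trap _ _ _ _ in b2 *.
set D := trap _ _ _ _ in b3 *; set E := trap _ _ _ _ in b4 *.
have := nrD (A + B) (- D); have := nrD (A + B - D) (- E); rewrite !nrN; lra.
Qed.

Definition cdiff (g : C -> C) (a : C) := exists D : C, forall e : R, 0 < e ->
  exists d : R, 0 < d /\ forall w, nr (w - a) < d ->
    nr (g w - g a - D * (w - a)) <= e * nr (w - a).

Lemma pow3_pos j : (0 < 3 ^ j)%N. Proof. by rewrite expn_gt0. Qed.

(* Trapezoidal sums along a square vanish on the affine part of g at a. *)
Lemma goursat_local (g : C -> C) (a : C) (e : R) : 0 < e -> cdiff g a ->
  exists d : R, 0 < d /\ forall c (s : R), 0 <= s -> s < d -> in_square c s a ->
    forall N, (0 < N)%N -> nr (square_sum N g c (s / N%:R)%:C%C) <= e * s ^+ 2.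
Proof.
move=> e0 [D hD]; have e8 : 0 < e / 8 by lra.
have [d [d0 hd]] := hD _ e8.
exists (d / 2); split; first by rewrite divr_gt0.
move=> c s s0 sd ha N N0.
pose r w := g w - g a - D * (w - a).
have -> : g = (fun w => r w + ((g a - D * a) + D * w)).
  by apply/funext => w; rewrite /r; ring.
rewrite square_sumD square_sum_affine addr0.
have -> : e * s ^+ 2 = 4 * s * (e / 8 * (2 * s)) by field.
apply: square_sum_bound => // z hz _.
have h2 := in_square_dist hz ha.
apply: le_trans (hd _ _) _; first by lra.
by rewrite ler_wpM2l // ltW.
Qed.

(** The bound is proportional to the area, so that the bounds of nine subsquares add up to that of
    the square. Smallness is asked only of fine subdivisions, along powers of 3 to match the cutting
    into thirds. *)
Definition small_sum (g : C -> C) (e : R) (p : C * R) :=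
  exists J, forall j, (J <= j)%N ->
    nr (square_sum (3 ^ j) g p.1 (p.2 / (3 ^ j)%:R)%:C%C) <= e * p.2 ^+ 2.

Lemma small_sum_split g e (c : C) (s : R) :
  (forall p q : 'I_3, small_sum g e (c + p%:R * (s / 3)%:C%C + q%:R * (ii * (s / 3)%:C%C), s / 3)) ->
  small_sum g e (c, s).
Proof.
move=> h; have /choice [J hJ] : forall x : 'I_3 * 'I_3, exists J, forall j, (J <= j)%N ->
    nr (square_sum (3 ^ j) g (c + x.1%:R * (s / 3)%:C%C + x.2%:R * (ii * (s / 3)%:C%C))
     (s / 3 / (3 ^ j)%:R)%:C%C) <= e * (s / 3) ^+ 2.
  by move=> [p q]; exact: h.
(* Cutting into thirds uses up one factor 3 of the subdivision, hence the shift by one. *)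
exists (\max_x J x).+1 => -[//|j]; rewrite ltnS => hj /=.
have -> : (3 ^ j.+1 = 3 ^ j + 3 ^ j + 3 ^ j)%N by rewrite expnS; lia.
have N0 : 0 < ((3 ^ j)%:R : R) by rewrite ltr0n pow3_pos.
have -> : s / (3 ^ j + 3 ^ j + 3 ^ j)%:R = s / 3 / (3 ^ j)%:R.
  rewrite !natrD (_ : _ + _ + _ = 3 * (3 ^ j)%:R); last by ring.
  by field; rewrite gt_eqF.
rewrite square_sum_split.
have hE : (3 ^ j)%:R * (s / 3 / (3 ^ j)%:R)%:C%C = (s / 3)%:C%C :> C.
  by rewrite natC -realCM mulrC divfK ?gt_eqF.
have -> : e * s ^+ 2 = \sum_(p < 3) \sum_(q < 3) (e * (s / 3) ^+ 2).
  by rewrite !sumr_const !card_ord; field.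
apply: le_trans (nr_sum _ _) _; apply: ler_sum => p _.
apply: le_trans (nr_sum _ _) _; apply: ler_sum => q _.
rewrite hE [_ * (ii * _)]mulrCA hE; apply: (hJ (p, q)).
by apply: leq_trans hj; apply: (leq_bigmax (p, q)).
Qed.

(** If the bound fails for a square, it fails for one of its nine pieces. Dependent choice yields
    nested bad squares shrinking to a point, where [goursat_local] contradicts them. *)
Lemma goursat g (c : C) (s : R) : 0 < s ->
  (forall z, in_square c s z -> cdiff g z) -> forall e, 0 < e -> small_sum g e (c, s).
Proof.
move=> s0 hg e e0; apply: contrapT => hn.
pose rel (x y : C * R) := [/\ y.2 = x.2 / 3,
  complex.Re x.1 <= complex.Re y.1 & complex.Re y.1 + y.2 <= complex.Re x.1 + x.2] /\
  [/\ complex.Im x.1 <= complex.Im y.1 & complex.Im y.1 + y.2 <= complex.Im x.1 + x.2].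
have step : forall x : {x : C * R | ~ small_sum g e x /\ 0 < x.2},
   {y : {x : C * R | ~ small_sum g e x /\ 0 < x.2} | rel (sval x) (sval y)}.
  move=> [[c' s'] [nx /= s'0]]; apply: cid.
  have /existsNP [p /existsNP [q hpq]] : ~ (forall p q : 'I_3, small_sum g e
     (c' + p%:R * (s' / 3)%:C%C + q%:R * (ii * (s' / 3)%:C%C), s' / 3)).
    by move=> h; apply: nx; apply: small_sum_split.
  have s3 : 0 < s' / 3 by rewrite divr_gt0.
  exists (exist _ (_, s' / 3) (conj hpq s3)); rewrite /rel /=.
  rewrite !natC.
  have p0 : 0 <= (p%:R : R) by [].
  have q0 : 0 <= (q%:R : R) by [].
  have p2 : (p%:R : R) <= 2 by rewrite ler_nat -ltnS.
  have q2 : (q%:R : R) <= 2 by rewrite ler_nat -ltnS.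
  case: (c') => x y; rewrite /=.
  by split; split => //; nra.
have [F [F0 FS]] := @dependent_choice _ _ step (exist _ (c, s) (conj hn s0)).
pose X k := complex.Re (sval (F k)).1; pose Y k := complex.Im (sval (F k)).1.
pose S k := (sval (F k)).2.
have Sk k : S k = s / 3 ^+ k.
  elim: k => [|k ih]; first by rewrite /S F0 expr0 divr1.
  have [[h _ _] _] := FS k; rewrite /S h -/(S k) ih exprS; field.
  by rewrite expf_neq0.
have S0 k : 0 <= S k by rewrite Sk divr_ge0 ?exprn_ge0 // ltW.
have [a ha] : exists a, forall k, X k <= a <= X k + S k.
  by apply: nested_intervals => // k; have [[_ h1 h2] _] := FS k.
have [b hb] : exists b, forall k, Y k <= b <= Y k + S k.
  by apply: nested_intervals => // k; have [_ [h1 h2]] := FS k.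
have : cdiff g (Complex a b).
  by apply: hg; have := ha 0%N; have := hb 0%N; rewrite /X /Y /S F0 /=; split.
move=> /(goursat_local e0) [d [d0 hd]].
have three : (2 : R) <= 3 by lra.
have [k hk] := pow_small (ltW s0) d0 three; rewrite -Sk in hk.
have [nk _] := svalP (F k); apply: nk; exists 0%N => j _.
apply: (hd _ _ (S0 k) hk _ _ (pow3_pos j)).
by split; [exact: ha|exact: hb].
Qed.
End Goursat.

(** * Sums around a singularity at the origin *)

Section SquaresAroundPole.
Variable R : realType.
Local Notation C := (cplx R).
Local Notation ii := (Complex 0 1 : C).

Lemma differentiable_cdiff (g : C -> C) (a : C) : differentiable g a -> cdiff g a.
Proof.
move=> dg; exists ('D_1 g a) => e /(diff_eps dg) [d [d0 hd]].
exists d; split=> // w /hd; rewrite [a + _]addrC subrK.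
have -> // : 'D_(w - a) g a = 'D_1 g a * (w - a).
have := deriveZv (w - a) (1 : C) dg.
by rewrite /GRing.scale /= mulr1 => ->; apply: mulrC.
Qed.

Lemma realCV (a : R) : (a^-1)%:C%C = (a%:C%C)^-1 :> C.
Proof. by rewrite fmorphV. Qed.

Lemma trap_Im_ge N (g : C -> C) (a h : C) (m : R) :
  (forall i, (i <= N)%N -> m <= complex.Im (g (a + i%:R * h) * h)) ->
  N%:R * m <= complex.Im (trap N g a h).
Proof.
rewrite /trap; elim: N => [|N ih] hm; first by rewrite big_ord0 mul0r.
rewrite big_ord_recr /=.
have ih' := ih (fun i iN => hm i (leqW iN)).
set A := \sum_(_ < N) _ in ih' *.
set u := g _; set v := g _.
have h1 : m <= complex.Im (u * h) by apply: hm.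
have h2 : m <= complex.Im (v * h) by apply: hm.
have -> : (u + v) / 2%:R * h = (2^-1 : R)%:C%C * (u * h + v * h).
  by rewrite realCV -natC; ring.
move: h1 h2 ih'; rewrite -natr1.
case: (u * h) => x1 y1; case: (v * h) => x2 y2; case: A => x3 y3 /=.
by rewrite mulrDl; lra.
Qed.

Lemma Im_invM (x y a b : R) : complex.Im ((Complex x y : C)^-1 * Complex a b) =
  (x * b - y * a) / (x ^+ 2 + y ^+ 2).
Proof.
have -> : complex.Im ((Complex x y : C)^-1 * Complex a b) =
   x / (x ^+ 2 + y ^+ 2) * b + - (y / (x ^+ 2 + y ^+ 2)) * a by [].
by ring.
Qed.

(** Discrete form of the winding number. On each side Im(dw / w) = h / (h^2 + t^2) dt is at least dt
    / (2 h), and the side has length 2 h, so each of the four sides contributes at least 1, for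
    every [N]. *)
Lemma winding_lower N (h : R) : (0 < N)%N -> 0 < h ->
  4 <= nr (square_sum N (fun w : C => w^-1) (Complex (- h) (- h)) (2 * h / N%:R)%:C%C).
Proof.
move=> N0 h0.
have Npos : 0 < (N%:R : R) by rewrite ltr0n.
apply: le_trans (nr_ge_Im _); apply: le_trans (ler_norm _).
set k := 2 * h / N%:R.
have kN : N%:R * k = 2 * h by rewrite mulrC divfK ?gt_eqF.
have k0 : 0 < k by rewrite divr_gt0 // mulr_gt0.
have hE : N%:R * k%:C%C = (2 * h)%:C%C :> C by rewrite natC -realCM kN.
have hi i : (i <= N)%N -> 0 <= i%:R * k <= 2 * h.
  move=> iN; rewrite mulr_ge0 ?(ltW k0) //= -kN.
  by apply: (ler_wpM2r (ltW k0)); rewrite ler_nat.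
have key (t : R) : -h <= t <= h -> 1 <= N%:R * (k * (h / (h ^+ 2 + t ^+ 2))).
  move=> /andP[t1 t2]; have q : 0 < h ^+ 2 + t ^+ 2 by rewrite ltr_pwDl ?sqr_ge0 ?exprn_gt0.
  by rewrite mulrA kN mulrA ler_pdivlMr //; nra.
have key' (t : R) : -h <= t <= h -> N%:R^-1 <= k * (h / (h ^+ 2 + t ^+ 2)).
  by move=> /key; rewrite -[N%:R^-1]mulr1 ler_pdivrMl.
have one (A : C) : N%:R * N%:R^-1 <= complex.Im A -> 1 <= complex.Im A.
  by rewrite divff // gt_eqF.
clearbody k.
have b1 : 1 <= complex.Im (trap N (fun w : C => w^-1) (Complex (- h) (- h)) k%:C%C).
  apply/one/trap_Im_ge => i /hi /andP[i1 i2].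
  apply: le_trans (key' (- h + i%:R * k) _) _; first by lra.
  rewrite natC -realCM.
  rewrite (_ : Complex (- h) (- h) + (i%:R * k)%:C%C = Complex (- h + i%:R * k) (- h) :> C); last by congr Complex; ring.
  rewrite (_ : k%:C%C = Complex k 0 :> C); last by congr Complex; ring.
  by rewrite  Im_invM le_eqVlt; apply/orP; left; apply/eqP; rewrite ?sqrrN ?[h ^+ 2 + _]addrC; ring.
have b2 : 1 <= complex.Im (trap N (fun w : C => w^-1) (Complex (- h) (- h) + N%:R * k%:C%C) (ii * k%:C%C)).
  apply/one/trap_Im_ge => i /hi /andP[i1 i2].
  apply: le_trans (key' (- h + i%:R * k) _) _; first by lra.
  rewrite hE [(i%:R : C) * _]mulrCA; rewrite natC -realCM.
  rewrite (_ : Complex (- h) (- h) + (2 * h)%:C%C + ii * (i%:R * k)%:C%C = Complex h (- h + i%:R * k) :> C); last by congr Complex; ring.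
  rewrite (_ : ii * k%:C%C = Complex 0 k :> C); last by congr Complex; ring.
  by rewrite  Im_invM le_eqVlt; apply/orP; left; apply/eqP; rewrite ?sqrrN ?[h ^+ 2 + _]addrC; ring.
have b3 : 1 <= complex.Im (- trap N (fun w : C => w^-1) (Complex (- h) (- h) + N%:R * (ii * k%:C%C)) k%:C%C).
  rewrite -mulN1r -trapZ; apply/one/trap_Im_ge => i /hi /andP[i1 i2].
  apply: le_trans (key' (- h + i%:R * k) _) _; first by lra.
  rewrite [N%:R * _]mulrCA hE natC -realCM.
  rewrite (_ : Complex (- h) (- h) + ii * (2 * h)%:C%C + (i%:R * k)%:C%C = Complex (- h + i%:R * k) h :> C); last by congr Complex; ring.
  rewrite (_ : -1 * (Complex (- h + i%:R * k) h : C)^-1 * k%:C%C = (Complex (- h + i%:R * k) h : C)^-1 * Complex (-k) 0 :> C); last by rewrite mulN1r mulNr -mulrN; congr (_ * _); congr Complex; ring.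
  by rewrite  Im_invM le_eqVlt; apply/orP; left; apply/eqP; rewrite ?sqrrN ?[h ^+ 2 + _]addrC; ring.
have b4 : 1 <= complex.Im (- trap N (fun w : C => w^-1) (Complex (- h) (- h)) (ii * k%:C%C)).
  rewrite -mulN1r -trapZ; apply/one/trap_Im_ge => i /hi /andP[i1 i2].
  apply: le_trans (key' (- h + i%:R * k) _) _; first by lra.
  rewrite [(i%:R : C) * _]mulrCA natC -realCM.
  rewrite (_ : Complex (- h) (- h) + ii * (i%:R * k)%:C%C = Complex (- h) (- h + i%:R * k) :> C); last by congr Complex; ring.
  rewrite (_ : -1 * (Complex (- h) (- h + i%:R * k) : C)^-1 * (ii * k%:C%C) = (Complex (- h) (- h + i%:R * k) : C)^-1 * Complex 0 (-k) :> C); last by rewrite mulN1r mulNr -mulrN; congr (_ * _); congr Complex; ring.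
  by rewrite  Im_invM le_eqVlt; apply/orP; left; apply/eqP; rewrite ?sqrrN ?[h ^+ 2 + _]addrC; ring.
rewrite /square_sum; move: b1 b2 b3 b4.
case: (trap _ _ _ _) => ? ?; case: (trap _ _ _ _) => ? ?.
case: (trap _ _ _ _) => ? ?; case: (trap _ _ _ _) => ? ? /=; lra.
Qed.

(** Unlike in [small_sum] the bound is not scaled by the area: it has to survive the passage between
    concentric squares of different size. *)
Definition small_abs (g : C -> C) (h e : R) :=
  exists J, forall j, (J <= j)%N ->
    nr (square_sum (3 ^ j) g (Complex (- h) (- h)) (2 * h / (3 ^ j)%:R)%:C%C) <= e.

(** The eight outer pieces avoid the origin and fall under Goursat's lemma; the middle piece is the
    concentric square of a third of the size. *)
Lemma small_abs_third (g : C -> C) (h e e' : R) : 0 < h -> 0 < e' ->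
  (forall z : C, z != 0 -> `|complex.Re z| <= h -> `|complex.Im z| <= h -> cdiff g z) ->
  small_abs g (h / 3) e -> small_abs g h (e + e').
Proof.
move=> h0 e'0 hg [J0 hJ0].
pose s := 2 * h / 3.
pose cor (x : 'I_3 * 'I_3) : C := Complex (- h) (- h) + x.1%:R * s%:C%C + x.2%:R * (ii * s%:C%C).
pose ctr : 'I_3 * 'I_3 := (@Ordinal 3 1 isT, @Ordinal 3 1 isT).
have s0 : 0 < s by rewrite divr_gt0 // mulr_gt0.
(* Eight pieces, each contributing [ep * s ^+ 2], add up to [e']. *)
pose ep := e' / (8 * s ^+ 2).
have ep0 : 0 < ep by rewrite divr_gt0 // mulr_gt0 // exprn_gt0.
have corE x : cor x = Complex (- h + x.1%:R * s) (- h + x.2%:R * s).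
  by rewrite /cor !natC /=; congr Complex; ring.
have /choice [J hJ] : forall x : 'I_3 * 'I_3, exists J, x != ctr -> forall j, (J <= j)%N ->
    nr (square_sum (3 ^ j) g (cor x) (s / (3 ^ j)%:R)%:C%C) <= ep * s ^+ 2.
  move=> x; have [->|xc] := eqVneq x ctr; first by exists 0%N.
  suff [J hJ] : small_sum g ep (cor x, s) by exists J.
  apply: goursat => // z; rewrite corE.
  have p2 : (x.1%:R : R) <= 2 by rewrite ler_nat -ltnS.
  have q2 : (x.2%:R : R) <= 2 by rewrite ler_nat -ltnS.
  have p0 : 0 <= (x.1%:R : R) by [].
  have q0 : 0 <= (x.2%:R : R) by [].
  rewrite /in_square /= => -[/andP[z1 z2] /andP[z3 z4]].
  have sE : s * 3 = 2 * h by rewrite /s divfK.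
  apply: hg; last 2 first.
  - by rewrite ler_norml; apply/andP; split; nra.
  - by rewrite ler_norml; apply/andP; split; nra.
  (* A piece that contains the origin has both indices equal to 1, so it is the excluded middle
     one. *)
  apply/eqP => zE; move: z1 z2 z3 z4; rewrite zE /= => z1 z2 z3 z4.
  move: xc; case: (x) z1 z2 z3 z4 => -[p hp] [q hq] /= z1 z2 z3 z4 /negP; apply.
  have hh (m : nat) : (m < 3)%N -> - h + m%:R * s <= 0 -> 0 <= - h + m%:R * s + s -> m = 1%N.
    case: m => [|[|[|m]]] //= _; last by move=> k1 _; exfalso; nra.
    by move=> _; rewrite mul0r => k; exfalso; lra.
  by apply/eqP; congr pair; apply: val_inj; apply: hh.
exists (maxn J0 (\max_x J x)).+1 => -[//|j]; rewrite ltnS geq_max => /andP[j0 hj].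
have -> : (3 ^ j.+1 = 3 ^ j + 3 ^ j + 3 ^ j)%N by rewrite expnS; lia.
have N0 : 0 < ((3 ^ j)%:R : R) by rewrite ltr0n pow3_pos.
have -> : 2 * h / (3 ^ j + 3 ^ j + 3 ^ j)%:R = s / (3 ^ j)%:R.
  rewrite !natrD (_ : _ + _ + _ = 3 * (3 ^ j)%:R); last by ring.
  by rewrite /s; field; rewrite gt_eqF.
rewrite square_sum_split.
have hE : (3 ^ j)%:R * (s / (3 ^ j)%:R)%:C%C = s%:C%C :> C.
  by rewrite natC -realCM mulrC divfK ?gt_eqF.
rewrite pair_big /= (eq_bigr (fun x => square_sum (3 ^ j) g (cor x) (s / (3 ^ j)%:R)%:C%C)); last first.
  by move=> x _; rewrite hE [_ * (ii * _)]mulrCA hE.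
rewrite (bigD1 ctr) //=; apply: le_trans (nrD _ _) _; apply: lerD.
  have e1 : - h + s = - (h / 3) by rewrite /s; field.
  have e2 : s = 2 * (h / 3) by rewrite /s; field.
  by rewrite corE /= mul1r e1 e2; apply: hJ0.
apply: le_trans (nr_sum _ _) _.
apply: le_trans (_ : \sum_(x | x != ctr) (ep * s ^+ 2) <= _); last first.
  have -> : \sum_(x : 'I_3 * 'I_3 | x != ctr) (ep * s ^+ 2) = 8 * (ep * s ^+ 2).
    have c9 : #|{: 'I_3 * 'I_3}| = 9%N by rewrite card_prod !card_ord.
    have : \sum_(x : 'I_3 * 'I_3) (ep * s ^+ 2) =
       ep * s ^+ 2 + \sum_(x : 'I_3 * 'I_3 | x != ctr) (ep * s ^+ 2) by rewrite (bigD1 ctr).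
    rewrite sumr_const c9 -mulr_natl.
    set A := \sum_(_ | _) _; lra.
  by rewrite /ep le_eqVlt; apply/orP; left; apply/eqP; field; rewrite gt_eqF.
apply: ler_sum => x xc; apply: hJ => //.
by apply: leq_trans hj; apply: (leq_bigmax x).
Qed.

(** Replaces the deformation of a contour into a small one around the singularity; at each level
    half of the remaining allowance [e'] is spent. *)
Lemma small_abs_scale (g : C -> C) k (h e e' : R) : 0 < h -> 0 < e' ->
  (forall z : C, z != 0 -> `|complex.Re z| <= h -> `|complex.Im z| <= h -> cdiff g z) ->
  small_abs g (h / 3 ^+ k) e -> small_abs g h (e + e').
Proof.
elim: k h e e' => [|k ih] h e e' h0 e'0 hg.
  rewrite expr0 divr1 => -[J hJ]; exists J => j /hJ h1.
  by apply: le_trans h1 _; rewrite lerDl ltW.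
rewrite exprS invfM mulrA => hs.
have e2 : 0 < e' / 2 by rewrite divr_gt0.
have -> : e + e' = (e + e' / 2) + e' / 2 by field.
apply: small_abs_third => //; apply: ih => //; first by rewrite divr_gt0.
by move=> z z0 z1 z2; apply: hg => //; lra.
Qed.
End SquaresAroundPole.

(** * Cauchy's estimate *)

Section CauchyEstimate.
Variable R : realType.
Local Notation C := (cplx R).
Local Notation ii := (Complex 0 1 : C).

Lemma nr_gt0 (V : normedModType C) (v : V) : (0 < nr v) = (v != 0).
Proof.
apply/idP/idP => [|v0]; first by apply: contraTneq => ->; rewrite nr0 ltxx.
by rewrite lt_neqAle nr_ge0 andbT eq_sym; apply: contra v0 => /eqP /nr_eq0 ->.
Qed.

(* With g(w) = (f(w) - f(0) - f'(0) w) / w^2, summing f(w)/w^2 along the square gives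
   f'(0) times the sum of 1/w, which is bounded below, up to the sum of g, which is
   arbitrarily small because w g(w) tends to 0 at the only singularity. *)
Lemma cauchy1 (f : C -> C) (r M : R) : 0 < r ->
  (forall z, nr z < r -> differentiable f z) ->
  (forall z, nr z < r -> nr (f z) <= M) -> nr ('D_1 f 0) <= 16 * M / r.
Proof.
move=> r0 df fM.
(* With half-side [r / 4] every point of the square has norm at most [r / 2], so the square lies
   inside the ball. *)
pose D := 'D_1 f 0; pose h := r / 4.
have h0 : 0 < h by rewrite divr_gt0.
have hr : 4 * h = r by rewrite /h; field.
pose g w := (f w - f 0 - D * w) * (w^-1 * w^-1).
have gE : (fun w => f w * (w^-1 * w^-1)) =
  (fun w => (g w + f 0 * (w^-1 * w^-1)) + D * w^-1).
  (* At w = 0 both sides vanish, because the inverse of 0 is 0. *)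
  apply/funext => w; rewrite /g; have [->|w0] := eqVneq w 0.
    by rewrite invr0 !mulr0 !addr0.
  by field.
have M0 : 0 <= M by apply: le_trans (fM 0 _); rewrite ?nr_ge0 // nr0.
have small (z : C) : `|complex.Re z| <= h -> `|complex.Im z| <= h -> nr z < r.
  by move=> h1 h2; apply: le_lt_trans (nr_le_ReIm _) _; lra.
have bdry (k : R) (z : C) : 0 < k -> [|| complex.Re z == - k, complex.Re z == - k + 2 * k,
         complex.Im z == - k | complex.Im z == - k + 2 * k] -> k <= nr z.
  move=> k0; have -> : - k + 2 * k = k by ring.
  have a1 := nr_ge_Re z; have a2 := nr_ge_Im z.
  case/or4P => /eqP e; move: a1 a2; rewrite e ?normrN (gtr0_norm k0) //; lra.
have ing (k : R) (z : C) : in_square (Complex (- k) (- k)) (2 * k) z ->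
    `|complex.Re z| <= k /\ `|complex.Im z| <= k.
  by move=> [/= /andP[a1 a2] /andP[a3 a4]]; rewrite !ler_norml; split; lra.
have gd (z : C) : z != 0 -> `|complex.Re z| <= h -> `|complex.Im z| <= h -> cdiff g z.
  move=> z0 z1 z2; apply: differentiable_cdiff.
  have dz := df _ (small _ z1 z2).
  apply: differentiableM; last first.
    by apply: differentiableM; apply: differentiableV.
  apply: differentiableB; first exact: differentiableB.
  by apply: differentiableM.
have D0 : cdiff f 0 by apply: differentiable_cdiff; apply: df; rewrite nr0.
(* On the boundary of a square of half-side hh close to 0, |g(w)| is at most e / |w|, hence at most
   e / hh; times the perimeter 8 hh this is 8 e. The last e pays for the return to half-side h. *)
have gs (e : R) : 0 < e -> small_abs g h (8 * e + e).
  move=> e0; have := diff_eps (df 0 _) e0; rewrite nr0 => /(_ r0) [d [d0 hd]].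
  have d2 : 0 < d / 2 by lra.
  have three : (2 : R) <= 3 by lra.
  have [k hk] := pow_small (ltW h0) d2 three.
  apply: (@small_abs_scale _ _ k) => //; exists 0%N => j _.
  set hh := h / 3 ^+ k in hk *.
  have hh0 : 0 < hh by rewrite divr_gt0 // exprn_gt0.
  have -> : 8 * e = 4 * (2 * hh) * (e / hh) by field; rewrite gt_eqF.
  apply: square_sum_bound => [||z /ing [z1 z2] /(bdry _ _ hh0) z3]; [exact: pow3_pos|lra|].
  have z0 : z != 0 by rewrite -nr_gt0; lra.
  have zd : nr z < d by apply: le_lt_trans (nr_le_ReIm _) _; lra.
  have := hd _ zd; rewrite add0r.
  have -> : 'D_z f 0 = D * z.
    have := deriveZv z (1 : C) (df 0 _); rewrite nr0 => /(_ r0).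
    by rewrite /GRing.scale /= mulr1 => ->; apply: mulrC.
  rewrite /g !nrM nrV => hz.
  have nz : 0 < nr z by rewrite nr_gt0.
  rewrite mulrA -ler_pdivlMr ?invr_gt0 // invrK ler_pdivrMr //.
  by apply: le_trans hz _; rewrite ler_pM2r // mulrAC ler_pdivlMr // ler_pM2l.
apply/ler_addgt0Pr => e e0.
have e9 : 0 < e / 9 by lra.
have [J hJ] := gs _ e9; have {hJ} hJ := hJ J (leqnn J).
have w4 := winding_lower (pow3_pos J) h0.
have q1 : nr (square_sum (3 ^ J) (fun w => f w * (w^-1 * w^-1)) (Complex (- h) (- h)) (2 * h / (3 ^ J)%:R)%:C%C) <= 4 * (2 * h) * (M / h ^+ 2).
  apply: square_sum_bound => [||z /ing [z1 z2] /(bdry _ _ h0) z3]; [exact: pow3_pos|lra|].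
  have nz : 0 < nr z by lra.
  rewrite !nrM nrV -invfM ler_pdivrMr ?mulr_gt0 // mulrAC ler_pdivlMr ?exprn_gt0 //.
  apply: ler_pM; rewrite ?nr_ge0 ?sqr_ge0 ?fM ?small //.
  by rewrite expr2 ler_pM // ltW.
have q2 : nr (square_sum (3 ^ J) (fun w : C => w^-1 * w^-1) (Complex (- h) (- h)) (2 * h / (3 ^ J)%:R)%:C%C) <= 4 * (2 * h) * (1 / h ^+ 2).
  apply: square_sum_bound => [||z /ing [z1 z2] /(bdry _ _ h0) z3]; [exact: pow3_pos|lra|].
  have nz : 0 < nr z by lra.
  rewrite !nrM nrV -invfM mul1r lef_pV2 ?posrE ?mulr_gt0 ?exprn_gt0 //.
  by rewrite expr2 ler_pM // ltW.
move: q1; rewrite gE !square_sumD !square_sumZ.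
move: w4 q2 hJ; set K := square_sum _ _ _ _; set S := square_sum _ _ _ _; set G := square_sum _ _ _ _.
move=> w4 q2 hJ q1.
have f0 : nr (f 0) <= M by apply: fM; rewrite nr0.
(* The sums of f(w) / w^2 and of f(0) / w^2 are each at most 8 h * M / h^2, together 16 M / h = 64 M
   / r; division by the lower bound 4 for |K| leaves the constant 16. *)
have h1 : nr (D * K) <= 4 * (2 * h) * (M / h ^+ 2) + (4 * (2 * h) * (1 / h ^+ 2)) * M + e.
  have -> : D * K = (G + f 0 * S + D * K) + - (f 0 * S) + - G by ring.
  have := nrD (G + f 0 * S + D * K + - (f 0 * S)) (- G).
  have := nrD (G + f 0 * S + D * K) (- (f 0 * S)); rewrite !nrN.
  have : nr (f 0 * S) <= 4 * (2 * h) * (1 / h ^+ 2) * M.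
    by rewrite nrM mulrC ler_pM ?nr_ge0.
  lra.
have h2 : 4 * (2 * h) * (M / h ^+ 2) + (4 * (2 * h) * (1 / h ^+ 2)) * M = 4 * (16 * M / r).
  by rewrite -hr; field; rewrite gt_eqF.
rewrite h2 nrM in h1.
have : nr D * 4 <= nr D * nr K by rewrite ler_wpM2l // nr_ge0.
rewrite -/D; lra.
Qed.

(** Restriction to the complex line through [a] in the direction [v], on which the radius becomes
    [r / nr v]. *)
Lemma cauchy_est (V : normedModType C) (f : V -> C) (a v : V) (r M : R) : 0 < r ->
  (forall z, nr (z - a) < r -> differentiable f z) ->
  (forall z, nr (z - a) < r -> nr (f z) <= M) -> nr ('D_v f a) <= 16 * M * nr v / r.
Proof.
move=> r0 df fM; have [->|v0] := eqVneq v 0.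
  by rewrite derive0 !nr0 mulr0 mul0r.
have nv : 0 < nr v by rewrite nr_gt0.
pose phi (t : C) := f (a + t *: v).
have -> : 'D_v f a = 'D_1 phi 0.
  rewrite /derive.
  suff -> : (fun t : C => t^-1 *: ((f \o shift a) (t *: v) - f a)) =
    (fun t : C => t^-1 *: ((phi \o shift 0) (t *: (1 : C)) - phi 0)) by [].
  apply/funext => t /=.
  by rewrite /phi /= addr0 [t%:A]mulr1 scale0r addr0 [a + _]addrC.
have -> : 16 * M * nr v / r = 16 * M / (r / nr v) by rewrite invf_div mulrA.
have inr (t : C) : nr t < r / nr v -> nr (a + t *: v - a) < r.
  by rewrite addrAC subrr add0r nrZ ltr_pdivlMr.
apply: cauchy1; first by rewrite divr_gt0.
  move=> t /inr ht; rewrite (_ : phi = f \o (fun t : C => a + t *: v)) //.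
  apply: differentiable_comp; last exact: df.
  apply: differentiableD => //.
by move=> t /inr /fM.
Qed.

(* Halving: on the nested intervals the increment exceeds (K + e) times the length,
   against differentiability at the common point. *)
Lemma mean_value_ineq (phi : R -> C) (K : R) :
  (forall t, 0 <= t <= 1 -> exists D : C, nr D <= K /\ forall e : R, 0 < e ->
     exists d : R, 0 < d /\ forall s, `|s - t| < d ->
       nr (phi s - phi t - (s - t)%:C%C * D) <= e * `|s - t|) ->
  nr (phi 1 - phi 0) <= K.
Proof.
move=> h; apply/ler_addgt0Pr => e e0; rewrite leNgt; apply/negP => bad0.
pose bad (x : R * R) := (K + e) * x.2 < nr (phi (x.1 + x.2) - phi x.1).
have b0 : bad (0, 1) by rewrite /bad /= mulr1 add0r.
(* The sign of the length is not part of the subset type, so each inclusion carries the alternative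
   of a negative length; [S0] rules it out afterwards. *)
pose rel (x y : R * R) := [/\ y.2 = x.2 / 2, x.1 <= y.1 \/ x.2 < 0 & y.1 + y.2 <= x.1 + x.2 \/ x.2 < 0].
have step : forall x : {x : R * R | bad x}, {y : {x : R * R | bad x} | rel (sval x) (sval y)}.
  move=> [[x l] hb]; apply: cid.
  have [h1|h1] := boolP `[< bad (x, l / 2) >].
    move/asboolP : h1 => h1; exists (exist (fun x => is_true (bad x)) _ h1); split => //=; first by left.
    by have [?|?] := ltP l 0; [right|left; lra].
  have h2 : bad (x + l / 2, l / 2).
    move/asboolP/negP : h1; rewrite /bad /= -leNgt => h1; move: hb; rewrite /bad /=.
    have -> : x + l / 2 + l / 2 = x + l by field.
    have := nrD (phi (x + l) - phi (x + l / 2)) (phi (x + l / 2) - phi x).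
    rewrite addrA subrK; lra.
  exists (exist (fun x => is_true (bad x)) _ h2); split => //=.
    by have [?|?] := ltP l 0; [right|left; lra].
  by left; lra.
have [F [F0 FS]] := @dependent_choice _ _ step (exist (fun x => is_true (bad x)) _ b0).
have Sk k : (sval (F k)).2 = 1 / 2 ^+ k.
  elim: k => [|k ih]; first by rewrite F0 expr0 divr1.
  by have [-> _ _] := FS k; rewrite ih exprS; field; rewrite expf_neq0.
have S0 k : 0 <= (sval (F k)).2 by rewrite Sk divr_ge0 ?exprn_ge0.
have [t ht] : exists a, forall k, (sval (F k)).1 <= a <= (sval (F k)).1 + (sval (F k)).2.
  apply: nested_intervals => // k; have [_ h1 h2] := FS k; have := S0 k; move=> h3.
    by case: h1 => //; lra.
  by case: h2 => //; lra.
have [D [DK hD]] : exists D : C, nr D <= K /\ forall e : R, 0 < e ->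
     exists d : R, 0 < d /\ forall s, `|s - t| < d ->
       nr (phi s - phi t - (s - t)%:C%C * D) <= e * `|s - t|.
  by apply: h; have := ht 0%N; rewrite F0 /= add0r.
have [d [d0 hd]] := hD _ e0.
have [k hk] := pow_small (ler01 : 0 <= 1) d0 (lexx 2).
rewrite -Sk in hk.
have := svalP (F k); have /andP[] := ht k; have := S0 k; rewrite /bad.
move: hk; case: (sval (F k)) => x l /= hk l0 t1 t2.
(* Since [t] lies between [x] and [x + l], its distances to the endpoints add up to [l], and the two
   errors to at most [e * l]. *)
have e1 : `|x + l - t| = x + l - t by rewrite ger0_norm //; lra.
have e2 : `|x - t| = t - x by rewrite distrC ger0_norm //; lra.
have := hd (x + l); rewrite e1 => /(_ ltac:(lra)).
have := hd x; rewrite e2 => /(_ ltac:(lra)).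
set A := phi x - phi t - _; set B := phi (x + l) - phi t - _ => hA hB.
have -> : phi (x + l) - phi x = B + - A + l%:C%C * D.
  have -> : (l%:C%C : C) = (x + l - t)%:C%C - (x - t)%:C%C.
    by rewrite -rmorphB /=; congr (_%:C%C); ring.
  by rewrite /A /B; ring.
have := nrD (B + - A) (l%:C%C * D); have := nrD B (- A); rewrite nrN nrM nr_real ger0_norm //.
have : l * nr D <= l * K by rewrite ler_wpM2l.
by move=> ? ? ? ?; lra.
Qed.
End CauchyEstimate.

(** * Taylor estimate, limits of complex sequences *)

Section Taylor.
Variable R : realType.
Local Notation C := (cplx R).

Definition holo_ball (V : normedModType C) (f : V -> C) (a : V) (r : R) :=
  forall z, nr (z - a) < r -> differentiable f z.

(** The constant [c] serves two purposes: 0 gives a Lipschitz bound, and the derivative at [a] gives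
    the Taylor remainder. *)
Lemma mean_value_segment (V : normedModType C) (f : V -> C) (a w : V) (c : C) (K : R) :
  (forall t : R, 0 <= t <= 1 -> differentiable f (a + t%:C%C *: w) /\
     nr ('D_w f (a + t%:C%C *: w) - c) <= K) ->
  nr (f (a + w) - f a - c) <= K.
Proof.
move=> h; pose phi (t : R) := f (a + (t%:C%C : C) *: w) - t%:C%C * c.
have -> : f (a + w) - f a - c = phi 1 - phi 0.
  by rewrite /phi scale1r mul1r scale0r addr0 mul0r subr0 addrAC.
apply: mean_value_ineq => t /h [dft hK]; exists ('D_w f (a + t%:C%C *: w) - c).
split=> // e e0.
have nw : 0 < nr w + 1 by rewrite ltr_wpDl ?nr_ge0.
have e1 : 0 < e / (nr w + 1) by rewrite divr_gt0.
have [d [d0 hd]] := diff_eps dft e1.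
exists (d / (nr w + 1)); split; first by rewrite divr_gt0.
move=> s hs.
have st : nr ((s - t)%:C%C *: w) <= `|s - t| * (nr w + 1).
  by rewrite nrZ nr_real ler_wpM2l // lerDl.
have /hd : nr ((s - t)%:C%C *: w) < d.
  by apply: le_lt_trans st _; rewrite -ltr_pdivlMr.
rewrite deriveZv //.
have -> : a + t%:C%C *: w + (s - t)%:C%C *: w = a + s%:C%C *: w.
  by rewrite -addrA -scalerDl -rmorphD /=; congr (_ + _%:C%C *: _); ring.
move=> h1.
have -> : phi s - phi t - (s - t)%:C%C * ('D_w f (a + t%:C%C *: w) - c) =
  f (a + s%:C%C *: w) - f (a + t%:C%C *: w) - (s - t)%:C%C *: 'D_w f (a + t%:C%C *: w).
  rewrite /phi -[X in _ = _ - X]/((s - t)%:C%C * _) rmorphB /=; ring.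
apply: le_trans h1 _; apply: le_trans (ler_wpM2l (ltW e1) st) _.
by rewrite mulrCA divfK ?gt_eqF // mulrC.
Qed.

Lemma holo_sub (V : normedModType C) (f : V -> C) (a b : V) (r s : R) :
  holo_ball f a r -> nr (b - a) + s <= r -> holo_ball f b s.
Proof.
move=> hf h z hz; apply: hf; have := nrD (z - b) (b - a); rewrite addrA subrK; lra.
Qed.

Lemma holo_lipschitz (V : normedModType C) (f : V -> C) (a x w : V) (r M : R) : 0 < r ->
  holo_ball f a r -> (forall z, nr (z - a) < r -> nr (f z) <= M) ->
  nr (x - a) + nr w < r / 2 -> nr (f (x + w) - f x) <= 32 * M * nr w / r.
Proof.
move=> r0 hf fM hx; have := @mean_value_segment V f x w 0 (32 * M * nr w / r).
rewrite subr0; apply=> t /andP[t0 t1]; rewrite subr0.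
have hz : nr (x + t%:C%C *: w - a) < r / 2.
  apply: le_lt_trans hx; rewrite addrAC (le_trans (nrD _ _)) // lerD2l nrZ nr_real.
  by rewrite ger0_norm // ler_piMl ?nr_ge0.
split; first by apply: hf; lra.
have r2 : 0 < r / 2 by lra.
have -> : 32 * M * nr w / r = 16 * M * nr w / (r / 2) by field; rewrite gt_eqF.
apply: cauchy_est => //; first by apply: holo_sub hf _; lra.
move=> z hz2; apply: fM.
have := nrD (z - (x + t%:C%C *: w)) (x + t%:C%C *: w - a); rewrite addrA subrK; lra.
Qed.

Lemma derive_shift (V : normedModType C) (f : V -> C) (a u w : V) :
  'D_w (fun z => f (z + u)) a = 'D_w f (a + u).
Proof.
rewrite /derive.
suff -> : (fun t : C => t^-1 *: (((fun z => f (z + u)) \o shift a) (t *: w) - f (a + u))) =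
  (fun t : C => t^-1 *: ((f \o shift (a + u)) (t *: w) - f (a + u))) by [].
by apply/funext => t /=; rewrite addrA.
Qed.

Lemma differentiable_shift (V : normedModType C) (f : V -> C) (a u : V) :
  differentiable f (a + u) -> differentiable (fun z => f (z + u)) a.
Proof.
move=> df; rewrite (_ : (fun z => f (z + u)) = f \o (fun z => z + u)) //.
apply: differentiable_comp => //.
Qed.

(** The increment of the derivative is the derivative of the increment f(z + u) - f(z). The
    Lipschitz bound for the latter, followed by Cauchy's estimate on radius r / 4, gives 16 * 32 * 4
    = 2048. *)
Lemma holo_taylor (V : normedModType C) (f : V -> C) (a w : V) (r M : R) : 0 < r ->
  holo_ball f a r -> (forall z, nr (z - a) < r -> nr (f z) <= M) ->
  nr w < r / 4 -> nr (f (a + w) - f a - 'D_w f a) <= 2048 * M * nr w ^+ 2 / r ^+ 2.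
Proof.
move=> r0 hf fM hw; apply: mean_value_segment => t /andP[t0 t1].
have ntw : nr (t%:C%C *: w) <= nr w.
  by rewrite nrZ nr_real ger0_norm // ler_piMl ?nr_ge0.
have M0 : 0 <= M by apply: le_trans (fM a _); rewrite ?nr_ge0 // subrr nr0.
set u := t%:C%C *: w in ntw *.
have dfa z : nr (z - a) < r / 2 -> differentiable f (z + u).
  by move=> hz; apply: hf; rewrite addrAC; have := nrD (z - a) u; lra.
split; first by apply: dfa; rewrite subrr nr0; lra.
have -> : 'D_w f (a + u) - 'D_w f a = 'D_w (fun z => f (z + u) - f z) a.
  rewrite -derive_shift -deriveB //; apply: diff_derivable.
    by apply/differentiable_shift/dfa; rewrite subrr nr0; lra.
  by apply: hf; rewrite subrr nr0.
have r4 : 0 < r / 4 by lra.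
have -> : 2048 * M * nr w ^+ 2 / r ^+ 2 = 16 * (32 * M * nr w / r) * nr w / (r / 4).
  by field; rewrite gt_eqF.
apply: cauchy_est => // z hz.
  apply: differentiableB; last by apply: hf; lra.
  by apply/differentiable_shift/dfa; lra.
apply: le_trans (_ : 32 * M * nr u / r <= _).
  by apply: holo_lipschitz hf fM _ => //; lra.
by rewrite ler_wpM2r ?invr_ge0 ?(ltW r0) // ler_wpM2l // mulr_ge0.
Qed.

Definition tends (u : nat -> C) (l : C) :=
  forall e : R, 0 < e -> exists N, forall k, (N <= k)%N -> nr (u k - l) <= e.

Lemma tends_unique u l l' : tends u l -> tends u l' -> l = l'.
Proof.
move=> h h'; apply/eqP; rewrite -subr_eq0; apply/eqP/nr_eq0/eqP.
rewrite eq_le nr_ge0 andbT; apply/ler_addgt0Pr => e e0; rewrite add0r.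
have e2 : 0 < e / 2 by lra.
have [N hN] := h _ e2; have [N' hN'] := h' _ e2.
have := hN _ (leq_maxl N N'); have := hN' _ (leq_maxr N N').
have := nrD (u (maxn N N') - l') (- (u (maxn N N') - l)); rewrite nrN.
have -> : u (maxn N N') - l' - (u (maxn N N') - l) = l - l' by ring.
lra.
Qed.

Lemma tendsD u v l m : tends u l -> tends v m -> tends (fun k => u k + v k) (l + m).
Proof.
move=> h h' e e0; have e2 : 0 < e / 2 by lra.
have [N hN] := h _ e2; have [N' hN'] := h' _ e2.
exists (maxn N N') => k; rewrite geq_max => /andP[/hN h1 /hN' h2].
have := nrD (u k - l) (v k - m).
have -> : u k - l + (v k - m) = u k + v k - (l + m) by ring.
lra.
Qed.

Lemma tendsZ c u l : tends u l -> tends (fun k => c * u k) (c * l).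
Proof.
move=> h e e0; have c1 : 0 < nr c + 1 by rewrite ltr_wpDl ?nr_ge0.
have [N hN] := h _ (divr_gt0 e0 c1); exists N => k /hN hk.
rewrite -mulrBr nrM; move: hk; rewrite ler_pdivlMr // => hk; apply: le_trans hk.
by rewrite mulrC ler_wpM2l ?nr_ge0 // lerDl.
Qed.

Lemma tends_eq u v l N : (forall k, (N <= k)%N -> u k = v k) -> tends u l -> tends v l.
Proof.
move=> uv h e /h [N' hN']; exists (maxn N N') => k; rewrite geq_max => /andP[h1 h2].
by rewrite -uv // hN'.
Qed.

Lemma tends_le u l (M : R) N : (forall k, (N <= k)%N -> nr (u k) <= M) -> tends u l -> nr l <= M.
Proof.
move=> hu h; apply/ler_addgt0Pr => e /h [N' hN'].
have := hu _ (leq_maxl N N'); have := hN' _ (leq_maxr N N').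
have := nrD (u (maxn N N')) (- (u (maxn N N') - l)); rewrite nrN.
have -> : u (maxn N N') - (u (maxn N N') - l) = l by ring.
lra.
Qed.

Lemma tends_cst l : tends (fun _ => l) l.
Proof. by move=> e e0; exists 0%N => k _; rewrite subrr nr0 ltW. Qed.

Lemma tends_prod_inv (K : R) : 0 <= K -> forall e : R, 0 < e ->
  exists N, forall k, (N <= k)%N -> K / k.+1%:R <= e.
Proof.
move=> K0 e e0; exists (Num.Def.archi_bound (K / e)) => k hk.
rewrite ler_pdivrMr // mulrC -ler_pdivrMr //.
apply: ltW; apply: lt_le_trans (archi_boundP _) _; first by rewrite divr_ge0 // ltW.
by rewrite ler_nat ltnW.
Qed.

Lemma real_cauchy (u : nat -> R) :
  (forall e : R, 0 < e -> exists N, forall k l, (N <= k)%N -> (N <= l)%N -> `|u k - u l| <= e) ->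
  exists l : R, forall e : R, 0 < e -> exists N, forall k, (N <= k)%N -> `|u k - l| <= e.
Proof.
move=> hu; have : cvg (u @ \oo).
  apply/cauchy_cvgP/cauchy_ballP => e e0.
  have e2 : 0 < e / 2 by lra.
  have [N hN] := hu _ e2; rewrite near_map2.
  exists ([set k | (N <= k)%N], [set k | (N <= k)%N]) => /=.
    by split; exists N.
  move=> [k l] /= [hk hl]; rewrite /ball /=; have := hN _ _ hk hl; lra.
move=> /cvgrPdist_le h; exists (lim (u @ \oo)) => e /h [N _ hN]; exists N => k hk.
by rewrite distrC; apply: hN.
Qed.

Lemma tends_complete (u : nat -> C) :
  (forall e : R, 0 < e -> exists N, forall k l, (N <= k)%N -> (N <= l)%N -> nr (u k - u l) <= e) ->
  exists l, tends u l.
Proof.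
move=> hu.
have [x hx] : exists l : R, forall e : R, 0 < e -> exists N, forall k, (N <= k)%N -> `|complex.Re (u k) - l| <= e.
  apply: real_cauchy => e /hu [N hN]; exists N => k l hk hl.
  apply: le_trans (hN _ _ hk hl); apply: le_trans (nr_ge_Re _).
  by case: (u k) => ? ?; case: (u l).
have [y hy] : exists l : R, forall e : R, 0 < e -> exists N, forall k, (N <= k)%N -> `|complex.Im (u k) - l| <= e.
  apply: real_cauchy => e /hu [N hN]; exists N => k l hk hl.
  apply: le_trans (hN _ _ hk hl); apply: le_trans (nr_ge_Im _).
  by case: (u k) => ? ?; case: (u l).
exists (Complex x y) => e e0; have e2 : 0 < e / 2 by lra.
have [N hN] := hx _ e2; have [N' hN'] := hy _ e2.
exists (maxn N N') => k; rewrite geq_max => /andP[/hN h1 /hN' h2].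
apply: le_trans (nr_le_ReIm _) _; move: h1 h2; case: (u k) => a b /=; lra.
Qed.
End Taylor.

(** * Limits and derivatives of holomorphic functions *)

Section Weierstrass.
Variable R : realType.
Local Notation C := (cplx R).

Lemma continuous_bounded (V : normedModType C) (f : V -> C) (a : V) :
  differentiable f a -> exists d : R, 0 < d /\ forall z, nr (z - a) < d -> nr (f z) <= nr (f a) + 1.
Proof.
move=> /differentiable_continuous /nr_continuous /(_ 1 ltr01) [d [d0 hd]].
exists d; split=> // z /hd; have := nrD (f z - f a) (f a); rewrite subrK; lra.
Qed.

Lemma holo_center (V : normedModType C) (f : V -> C) a (r : R) : 0 < r -> holo_ball f a r ->
  differentiable f a.
Proof. by move=> r0; apply; rewrite subrr nr0. Qed.

(** By Cauchy's estimate the derivatives at [a] form a Cauchy sequence. Their limit is linear and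
    bounded, and the second-order Taylor estimate, uniform in k, passes to the limit, which makes
    this map the differential of [g]. *)
Lemma weierstrass (V : normedModType C) (f : nat -> V -> C) (g : V -> C) (a : V) (r : R) N0 :
  0 < r -> (forall k, (N0 <= k)%N -> holo_ball (f k) a r) ->
  (forall e : R, 0 < e -> exists N, forall k z, (N <= k)%N -> nr (z - a) < r ->
     nr (f k z - g z) <= e) ->
  differentiable g a /\ forall w, tends (fun k => 'D_w (f k) a) ('D_w g a).
Proof.
move=> r0 hf fg.
have [N1 hN1] := fg _ ltr01.
have [m mN0 mN1] : exists2 m, (N0 <= m)%N & (N1 <= m)%N.
  by exists (maxn N0 N1); rewrite ?leq_maxl ?leq_maxr.
have [d [d0 hd]] := continuous_bounded (holo_center r0 (hf m mN0)).
(* A common bound near [a]: [f k] and [f m] are each within 1 of [g], and [f m] is at most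
   [nr (f m a) + 1] there, hence the 3. *)
pose s := Num.min d r; pose M := nr (f m a) + 3.
have s0 : 0 < s by rewrite lt_min d0.
have sr : s <= r by rewrite ge_min lexx orbT.
have sd : s <= d by rewrite ge_min lexx.
have hfs k : (m <= k)%N -> holo_ball (f k) a s.
  move=> mk; apply: holo_sub (hf k _) _; last by rewrite subrr nr0 add0r.
  exact: leq_trans mk.
have fM k z : (m <= k)%N -> nr (z - a) < s -> nr (f k z) <= M.
  move=> mk hz.
  have h1 := hN1 k z (leq_trans mN1 mk) (lt_le_trans hz sr).
  have h2 := hN1 m z mN1 (lt_le_trans hz sr).
  have h3 := hd _ (lt_le_trans hz sd).
  have := nrD (f k z - g z) (- (f m z - g z)); rewrite nrN.
  have -> : f k z - g z - (f m z - g z) = f k z - f m z by ring.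
  have := nrD (f k z - f m z) (f m z); rewrite subrK /M; lra.
have hc w : exists l, tends (fun k => 'D_w (f k) a) l.
  apply: tends_complete => e e0.
  pose K := 16 * nr w / s.
  have K0 : 0 <= K by rewrite divr_ge0 ?mulr_ge0 ?nr_ge0 // ltW.
  have K1 : 0 < K + 1 by lra.
  have e1 : 0 < e / (K + 1) / 2 by rewrite !divr_gt0.
  have [N hN] := fg _ e1; exists (maxn m N) => k l.
  rewrite !geq_max => /andP[mk Nk] /andP[ml Nl].
  have dk : derivable (f k) a w by exact/diff_derivable/(holo_center s0)/hfs.
  have dl : derivable (f l) a w by exact/diff_derivable/(holo_center s0)/hfs.
  rewrite -(deriveB dk dl).
  apply: le_trans (_ : 16 * (e / (K + 1)) * nr w / s <= _); last first.
    have -> : 16 * (e / (K + 1)) * nr w / s = K * (e / (K + 1)) by rewrite /K; ring.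
    by rewrite mulrA ler_pdivrMr // [e * _]mulrC ler_pM2r //; lra.
  apply: (@cauchy_est _ _ (f k - f l) a w s _ s0) => z hz.
    by apply: differentiableB; [exact: hfs mk _ hz|exact: hfs ml _ hz].
  have h1 := hN _ _ Nk (lt_le_trans hz sr); have h2 := hN _ _ Nl (lt_le_trans hz sr).
  have := nrD (f k z - g z) (- (f l z - g z)); rewrite nrN.
  have -> : f k z - g z - (f l z - g z) = f k z - f l z by ring.
  rewrite -[(f k - f l) z]/(f k z - f l z); lra.
have [L hL] := choice hc.
have linL : linear L.
  move=> c u v; apply: (tends_unique (hL _)).
  apply: tends_eq (tendsD (tendsZ c (hL u)) (hL v)) => k mk.
  have dk := holo_center s0 (hfs k mk).
  by rewrite deriveDv // deriveZv.
pose LL : {linear V -> C} := HB.pack L (GRing.isLinear.Build _ _ _ _ L linL).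
have LK w : nr (L w) <= 16 * M / s * nr w.
  apply: (@tends_le _ _ _ _ m _ (hL w)) => k mk; rewrite mulrAC.
  exact: cauchy_est s0 (hfs k mk) (fM k ^~ mk).
have fgz z : nr (z - a) < r -> tends (f^~ z) (g z).
  by move=> hz e /fg [N hN]; exists N => k hk; apply: hN.
have LT w : nr w < s / 4 -> nr (g (a + w) - g a - L w) <= 2048 * M * nr w ^+ 2 / s ^+ 2.
  move=> hw.
  have t1 : tends (fun k => f k (a + w) + (-1) * f k a + (-1) * 'D_w (f k) a) (g (a + w) + (-1) * g a + (-1) * L w).
    apply: tendsD (tendsZ _ (hL w)); apply: tendsD; last apply: tendsZ.
      by apply: fgz; rewrite addrAC subrr add0r; lra.
    by apply: fgz; rewrite subrr nr0.
  rewrite !mulN1r in t1; apply: (@tends_le _ _ _ _ m _ t1) => k mk; rewrite !mulN1r.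
  exact: holo_taylor s0 (hfs k mk) (fM k ^~ mk) hw.
have M0 : 0 <= M by rewrite /M; have := nr_ge0 (f m a); lra.
have [||dg dgL] := @diff_intro _ V C g a LL (16 * M / s) => //.
  move=> e e0; pose K := 2048 * M / s ^+ 2.
  have K0 : 0 <= K by apply: divr_ge0; [apply: mulr_ge0 (ler0n _ _) M0|exact: sqr_ge0].
  have K1 : 0 < K + 1 by lra.
  exists (Num.min (s / 4) (e / (K + 1))); split.
    by rewrite lt_min !divr_gt0.
  move=> w; rewrite lt_min => /andP[w1 w2]; apply: le_trans (LT w w1) _.
  have -> : 2048 * M * nr w ^+ 2 / s ^+ 2 = K * nr w * nr w by rewrite /K; ring.
  rewrite ler_wpM2r ?nr_ge0 //; move: w2; rewrite ltr_pdivlMr // => w2.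
  have := nr_ge0 w; lra.
by split=> // w; rewrite dgL; exact: hL.
Qed.

(** The step 1 / (k + 1) is discrete, so that the quotients form a sequence of holomorphic functions
    to which [weierstrass] applies. *)
Definition diff_quot (V : normedModType C) (f : V -> C) (v : V) (k : nat) (z : V) : C :=
  k.+1%:R * (f (z + (k.+1%:R^-1 : C) *: v) - f z).

Lemma nr_step (V : normedModType C) (v : V) k : nr ((k.+1%:R^-1 : C) *: v) = nr v / k.+1%:R.
Proof. by rewrite nrZ nrV nr_nat mulrC. Qed.

Lemma diff_quot_tends (V : normedModType C) (f : V -> C) (v a : V) :
  differentiable f a -> tends (fun k => diff_quot f v k a) ('D_v f a).
Proof.
move=> df e e0.
have nv : 0 < nr v + 1 by rewrite ltr_wpDl ?nr_ge0.
have e1 : 0 < e / (nr v + 1) by rewrite divr_gt0.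
have [d [d0 hd]] := diff_eps df e1.
have d2 : 0 < d / 2 by lra.
have [N hN] := tends_prod_inv (nr_ge0 v) d2; exists N => k hk.
have h1 := hN _ hk.
have h3 : nr v / k.+1%:R < d by apply: le_lt_trans h1 _; lra.
have := hd ((k.+1%:R^-1 : C) *: v); rewrite nr_step => /(_ h3).
have k0 : (0 : R) < k.+1%:R by rewrite ltr0n.
have kC : (k.+1%:R : C) != 0 by rewrite pnatr_eq0.
rewrite deriveZv // => h2.
have -> : diff_quot f v k a - 'D_v f a =
   k.+1%:R * (f (a + (k.+1%:R^-1 : C) *: v) - f a - (k.+1%:R^-1 : C) *: 'D_v f a).
  by rewrite /diff_quot [in RHS]mulrBr -[X in _ = _ - _ * X]/(_ * _) mulrA mulfV // mul1r.
rewrite nrM nr_nat; apply: le_trans (ler_wpM2l (ltW k0) h2) _.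
have -> : k.+1%:R * (e / (nr v + 1) * (nr v / k.+1%:R)) = e / (nr v + 1) * nr v.
  by field; rewrite !gt_eqF.
by rewrite mulrAC ler_pdivrMr // ler_pM2l // lerDl.
Qed.

Lemma diff_quot_uniform (V : normedModType C) (f : V -> C) (v a : V) (r : R) :
  0 < r -> holo_ball f a r -> exists s : R, [/\ 0 < s,
    exists N0, forall k, (N0 <= k)%N -> holo_ball (diff_quot f v k) a s &
    forall e : R, 0 < e -> exists N, forall k z, (N <= k)%N -> nr (z - a) < s ->
       nr (diff_quot f v k z - 'D_v f z) <= e].
Proof.
move=> r0 hf; have [d [d0 hd]] := continuous_bounded (holo_center r0 hf).
pose t := Num.min d r; pose M := nr (f a) + 1.
have t0 : 0 < t by rewrite lt_min d0.
have tr : t <= r by rewrite ge_min lexx orbT.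
have td : t <= d by rewrite ge_min lexx.
have M0 : 0 <= M by rewrite /M; have := nr_ge0 (f a); lra.
exists (t / 2); split; first by lra.
  have t4 : 0 < t / 4 by lra.
  have [N hN] := tends_prod_inv (nr_ge0 v) t4; exists N => k /hN; rewrite -nr_step => hk z hz.
  rewrite /diff_quot; apply: (@differentiableZ _ _ _ (fun z => f (z + (k.+1%:R^-1 : C) *: v) - f z)).
  apply: differentiableB; last by apply: hf; lra.
  apply: differentiable_shift; apply: hf; rewrite addrAC.
  have := nrD (z - a) ((k.+1%:R^-1 : C) *: v); lra.
move=> e e0.
pose K := 2048 * M * nr v ^+ 2 / (t / 2) ^+ 2.
have t20 : 0 < t / 2 by lra.
have K0 : 0 <= K.
  apply: divr_ge0 (sqr_ge0 _); apply: mulr_ge0 (sqr_ge0 _).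
  exact: mulr_ge0 (ler0n _ _) M0.
have t16 : 0 < t / 16 by lra.
have [N1 hN1] := tends_prod_inv (nr_ge0 v) t16; have [N2 hN2] := tends_prod_inv K0 e0.
exists (maxn N1 N2) => k z; rewrite geq_max => /andP[/hN1 k1 /hN2 k2] hz.
rewrite -nr_step in k1.
have k0 : (0 : R) < k.+1%:R by rewrite ltr0n.
have kC : (k.+1%:R : C) != 0 by rewrite pnatr_eq0.
have hfz : holo_ball f z (t / 2) by apply: holo_sub hf _; lra.
have fz y : nr (y - z) < t / 2 -> nr (f y) <= M.
  by move=> hy; apply: hd; have := nrD (y - z) (z - a); rewrite addrA subrK; lra.
have hw : nr ((k.+1%:R^-1 : C) *: v) < t / 2 / 4 by lra.
have := holo_taylor t20 hfz fz hw.
rewrite deriveZv; last exact: (holo_center t20 hfz).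
move=> h2.
have -> : diff_quot f v k z - 'D_v f z =
   k.+1%:R * (f (z + (k.+1%:R^-1 : C) *: v) - f z - (k.+1%:R^-1 : C) *: 'D_v f z).
  by rewrite /diff_quot [in RHS]mulrBr -[X in _ = _ - _ * X]/(_ * _) mulrA mulfV // mul1r.
rewrite nrM nr_nat; apply: le_trans (ler_wpM2l (ltW k0) h2) _; apply: le_trans k2.
by rewrite nr_step /K le_eqVlt; apply/orP; left; apply/eqP; field; rewrite !gt_eqF.
Qed.

Lemma derive_holo (V : normedModType C) (f : V -> C) (v a : V) (r : R) :
  0 < r -> holo_ball f a r -> differentiable ('D_v f) a.
Proof.
move=> r0 hf; have [s [s0 [N0 hN0] hu]] := diff_quot_uniform v r0 hf.
by have [] := weierstrass s0 hN0 hu.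
Qed.

Lemma holo_ball_derive (V : normedModType C) (f : V -> C) (v a : V) (r : R) :
  holo_ball f a r -> holo_ball ('D_v f) a r.
Proof.
move=> hf z hz; apply: (@derive_holo _ _ _ _ (r - nr (z - a))); first by lra.
by apply: holo_sub hf _; lra.
Qed.

(* D_u of the difference quotients of f along v tends to both sides. *)
Lemma derive_comm (V : normedModType C) (f : V -> C) (u v a : V) (r : R) :
  0 < r -> holo_ball f a r -> 'D_u ('D_v f) a = 'D_v ('D_u f) a.
Proof.
move=> r0 hf; have [s [s0 [N0 hN0] hu]] := diff_quot_uniform v r0 hf.
have [_ /(_ u) h1] := weierstrass s0 hN0 hu.
apply: (tends_unique h1).
have r4 : 0 < r / 4 by lra.
have [N hN] := tends_prod_inv (nr_ge0 v) r4.
apply: (@tends_eq _ (fun k => diff_quot ('D_u f) v k a) _ _ N); last first.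
  exact/diff_quot_tends/(derive_holo _ r0 hf).
move=> k /hN; rewrite -nr_step => hk.
rewrite /diff_quot.
have d1 : differentiable (fun z => f (z + (k.+1%:R^-1 : C) *: v)) a.
  by apply: differentiable_shift; apply: hf; rewrite addrAC subrr add0r; lra.
have d2 := holo_center r0 hf.
rewrite (_ : (fun z => _) = k.+1%:R *: ((fun z => f (z + (k.+1%:R^-1 : C) *: v)) - f)) //.
by rewrite deriveZ ?deriveB ?derive_shift //; [exact: diff_derivable..|apply: derivableB; exact: diff_derivable].
Qed.
End Weierstrass.

(** * First-order operators *)

HB.lock Definition pd (R : realType) (n : nat) (l : 'I_n) (f : 'rV[cplx R]_n -> cplx R)
  (z : 'rV[cplx R]_n) : cplx R := 'D_(delta_mx ord0 l) f z.

Section FirstOrderOperators.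
Variables (R : realType) (n : nat).
Local Notation C := (cplx R).
Local Notation V := 'rV[C]_n.
Implicit Types (f g : V -> C) (z : V) (r : R) (l : 'I_n).

Lemma pdE l f : pd l f = 'D_(delta_mx ord0 l) f.
Proof. by apply/funext => z; rewrite pd.unlock. Qed.

Lemma pdD l f g z : differentiable f z -> differentiable g z ->
  pd l (fun x => f x + g x) z = pd l f z + pd l g z.
Proof. by move=> df dg; rewrite !pdE -deriveD //; apply: diff_derivable. Qed.

Lemma pdM l f g z : differentiable f z -> differentiable g z ->
  pd l (fun x => f x * g x) z = pd l f z * g z + f z * pd l g z.
Proof.
move=> df dg; rewrite !pdE (_ : (fun x => f x * g x) = f * g) //.
rewrite deriveM; [|exact: diff_derivable..].
by rewrite addrC /GRing.scale /= [g z * _]mulrC.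
Qed.

Lemma pd_cst l (c : C) z : pd l (fun _ => c) z = 0.
Proof. by rewrite !pdE (_ : (fun _ => c) = cst c) // derive_cst. Qed.

Lemma differentiable_fsum (I : Type) (s : seq I) (P : pred I) (F : I -> V -> C) z :
  (forall i, differentiable (F i) z) -> differentiable (fun x => \sum_(i <- s | P i) F i x) z.
Proof.
move=> h; elim: s => [|i s ih].
  by rewrite (_ : (fun x => _) = cst 0) //; apply/funext => x; rewrite big_nil.
rewrite (_ : (fun x => _) = (fun x => (if P i then F i x else 0) + \sum_(i <- s | P i) F i x)).
  by apply: differentiableD => //; case: (P i).
by apply/funext => x; rewrite big_cons; case: (P i); rewrite ?add0r.
Qed.

Lemma differentiable_fprod (I : Type) (s : seq I) (P : pred I) (F : I -> V -> C) z :
  (forall i, differentiable (F i) z) -> differentiable (fun x => \prod_(i <- s | P i) F i x) z.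
Proof.
move=> h; elim: s => [|i s ih].
  by rewrite (_ : (fun x => _) = cst 1) //; apply/funext => x; rewrite big_nil.
rewrite (_ : (fun x => _) = (fun x => (if P i then F i x else 1) * \prod_(i <- s | P i) F i x)).
  by apply: differentiableM => //; case: (P i).
by apply/funext => x; rewrite big_cons; case: (P i); rewrite ?mul1r.
Qed.

Lemma pd_sum l (I : finType) (F : I -> V -> C) z :
  (forall i, differentiable (F i) z) -> pd l (fun x => \sum_i F i x) z = \sum_i pd l (F i) z.
Proof.
move=> h; elim: (index_enum I) => [|i s ih].
  by rewrite big_nil (_ : (fun x => _) = (fun=> 0)) ?pd_cst //; apply/funext => x; rewrite big_nil.
rewrite big_cons -ih.
have -> : (fun x => \sum_(j <- i :: s) F j x) = (fun x => F i x + \sum_(j <- s) F j x).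
  by apply/funext => x; rewrite big_cons.
by apply: pdD; [exact: h|exact: differentiable_fsum].
Qed.

Lemma pd_local l (f g : V -> C) (r : R) z : nr z < r ->
  (forall y, nr y < r -> f y = g y) -> pd l f z = pd l g z.
Proof.
move=> hz fg; rewrite !pdE; apply: near_eq_derive.
apply/nr_nbhs; exists (r - nr z); split; first by lra.
by move=> y hy; apply: fg; have := nrD (y - z) z; rewrite subrK; lra.
Qed.

Definition hol (r : R) (f : V -> C) := forall z, nr z < r -> differentiable f z.

Lemma holE r f : hol r f <-> holo_ball f 0 r.
Proof. by split=> h z hz; apply: h; rewrite ?subr0 // in hz *. Qed.

Lemma hol_pd r l f : hol r f -> hol r (pd l f).
Proof. by move=> /holE h; apply/holE; rewrite pdE; apply: holo_ball_derive. Qed.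

Lemma pd_comm r k l f z : hol r f -> nr z < r -> pd k (pd l f) z = pd l (pd k f) z.
Proof.
move=> hf hz; rewrite !pdE; apply: (@derive_comm _ _ _ _ _ _ (r - nr z)); first by lra.
by move=> y hy; apply: hf; have := nrD (y - z) z; rewrite subrK; lra.
Qed.

Lemma holD r f g : hol r f -> hol r g -> hol r (fun z => f z + g z).
Proof. by move=> hf hg z hz; apply: differentiableD; [exact: hf|exact: hg]. Qed.
Lemma holM r f g : hol r f -> hol r g -> hol r (fun z => f z * g z).
Proof. by move=> hf hg z hz; apply: differentiableM; [exact: hf|exact: hg]. Qed.
Lemma hol_cst r c : hol r (fun _ => c).
Proof. by move=> z hz. Qed.
Lemma holN r f : hol r f -> hol r (fun z => - f z).
Proof. by move=> hf z hz; apply: differentiableN; exact: hf. Qed.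
Lemma hol_sum r (I : Type) (s : seq I) (P : pred I) (F : I -> V -> C) :
  (forall i, hol r (F i)) -> hol r (fun x => \sum_(i <- s | P i) F i x).
Proof. by move=> h z hz; apply: differentiable_fsum => i; exact: h. Qed.
Lemma hol_le r s f : s <= r -> hol r f -> hol s f.
Proof. by move=> sr hf z hz; apply: hf; lra. Qed.

Lemma pdN l f z : differentiable f z -> pd l (fun x => - f x) z = - pd l f z.
Proof. by move=> df; rewrite !pdE -deriveN //; apply: diff_derivable. Qed.

Definition dir (v : 'I_n -> V -> C) (f : V -> C) (z : V) : C := \sum_l v l z * pd l f z.

Lemma hol_dir r v f : (forall l, hol r (v l)) -> hol r f -> hol r (dir v f).
Proof. by move=> hv hf; apply: hol_sum => l; apply: holM => //; apply: hol_pd. Qed.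

Lemma dirM v f g z : differentiable f z -> differentiable g z ->
  dir v (fun x => f x * g x) z = dir v f z * g z + f z * dir v g z.
Proof.
move=> df dg; rewrite /dir mulr_suml mulr_sumr -big_split /=.
by apply: eq_bigr => l _; rewrite (pdM l df dg); ring.
Qed.

Lemma dirD v f g z : differentiable f z -> differentiable g z ->
  dir v (fun x => f x + g x) z = dir v f z + dir v g z.
Proof.
move=> df dg; rewrite /dir -big_split /=.
by apply: eq_bigr => l _; rewrite (pdD l df dg); ring.
Qed.

Lemma dirN v f z : differentiable f z -> dir v (fun x => - f x) z = - dir v f z.
Proof.
move=> df; rewrite /dir -sumrN.
by apply: eq_bigr => l _; rewrite (pdN l df); ring.
Qed.

Lemma dir_sum v (I : finType) (F : I -> V -> C) z :
  (forall i, differentiable (F i) z) -> dir v (fun x => \sum_i F i x) z = \sum_i dir v (F i) z.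
Proof.
move=> h; rewrite /dir exchange_big /=.
by apply: eq_bigr => l _; rewrite (pd_sum l h) mulr_sumr.
Qed.

Lemma dir_cst v c z : dir v (fun _ => c) z = 0.
Proof. by rewrite /dir big1 // => l _; rewrite pd_cst mulr0. Qed.

Lemma dir_local v f g (r : R) z : nr z < r ->
  (forall y, nr y < r -> f y = g y) -> dir v f z = dir v g z.
Proof. by move=> hz fg; apply: eq_bigr => l _; rewrite (pd_local l hz fg). Qed.

(** The second-order parts cancel by symmetry of the second partial derivatives. *)
Lemma dir_comm r v v' f z : nr z < r -> (forall l, hol r (v l)) -> (forall l, hol r (v' l)) ->
  hol r f -> dir v (dir v' f) z - dir v' (dir v f) z =
  \sum_k (dir v (v' k) z - dir v' (v k) z) * pd k f z.
Proof.
move=> hz hv hv' hf.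
have E w w' : (forall l, hol r (w l)) -> (forall l, hol r (w' l)) ->
   dir w (dir w' f) z = \sum_k dir w (w' k) z * pd k f z +
     \sum_k \sum_l w l z * w' k z * pd l (pd k f) z.
  move=> hw hw'; rewrite dir_sum; last first.
    by move=> k; apply: holM hz => //; exact: hol_pd.
  rewrite -big_split /=; apply: eq_bigr => k _.
  rewrite dirM; [|exact: hw'|exact: hol_pd hz].
  by congr (_ + _); rewrite mulr_sumr; apply: eq_bigr => l _; ring.
rewrite !E // [X in _ - (_ + X)]exchange_big /=.
rewrite opprD addrACA [X in _ + X](_ : _ = 0) ?addr0; last first.
  apply/eqP; rewrite subr_eq0; apply/eqP.
  apply: eq_bigr => k _; apply: eq_bigr => l _.
  by rewrite (pd_comm k l hf hz); ring.
by rewrite -sumrB; apply: eq_bigr => k _; ring.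
Qed.

Variable e : nat.
Implicit Types (u : 'I_e -> V -> C) (v : 'I_n -> V -> C) (psi : 'I_e -> 'I_e -> V -> C).

(** The matrix acts from the right on a row [u], because the unknowns are the rows of the gauge in
    X_{z_i} H = H Theta_i. *)
Definition op v psi u : 'I_e -> V -> C := fun b z =>
  dir v (u b) z + \sum_c u c z * psi c b z.

Lemma hol_op r v psi u : (forall l, hol r (v l)) -> (forall c b, hol r (psi c b)) ->
  (forall b, hol r (u b)) -> forall b, hol r (op v psi u b).
Proof.
move=> hv hp hu b; apply: holD; first exact: hol_dir.
by apply: hol_sum => c; apply: holM.
Qed.

Lemma op_local v psi u u' (r : R) b z : nr z < r ->
  (forall b y, nr y < r -> u b y = u' b y) -> op v psi u b z = op v psi u' b z.
Proof.
move=> hz uu; rewrite /op (dir_local v hz (uu b)); congr (_ + _).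
by apply: eq_bigr => c _; rewrite uu.
Qed.

Lemma op0 v psi b z : op v psi (fun _ _ => 0) b z = 0.
Proof. by rewrite /op dir_cst add0r big1 // => c _; rewrite mul0r. Qed.

Lemma op_sum v psi (I : finType) (F : I -> 'I_e -> V -> C) b z :
  (forall i b, differentiable (F i b) z) ->
  op v psi (fun b x => \sum_i F i b x) b z = \sum_i op v psi (F i) b z.
Proof.
move=> h; rewrite /op (dir_sum _ (h^~ b)) big_split /=; congr (_ + _).
by rewrite exchange_big /=; apply: eq_bigr => c _; rewrite mulr_suml.
Qed.

Lemma op_mul v psi (c : V -> C) u b z : differentiable c z -> (forall b, differentiable (u b) z) ->
  op v psi (fun b x => c x * u b x) b z = dir v c z * u b z + c z * op v psi u b z.
Proof.
move=> dc du; rewrite /op (dirM _ dc (du b)) mulrDr addrA; congr (_ + _).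
by rewrite mulr_sumr; apply: eq_bigr => k _; rewrite mulrA.
Qed.

(** Terms in which one operator differentiates [u] and the other multiplies it are symmetric in the
    two. What remains is the bracket of the fields and the curvature, the two expressions assumed to
    vanish. *)
Lemma op_comm r v v' psi psi' u b z : nr z < r ->
  (forall l, hol r (v l)) -> (forall l, hol r (v' l)) ->
  (forall c b, hol r (psi c b)) -> (forall c b, hol r (psi' c b)) ->
  (forall b, hol r (u b)) ->
  (forall k, dir v (v' k) z - dir v' (v k) z = 0) ->
  (forall c b, dir v (psi' c b) z - dir v' (psi c b) z
     + \sum_d (psi' c d z * psi d b z - psi c d z * psi' d b z) = 0) ->
  op v psi (op v' psi' u) b z = op v' psi' (op v psi u) b z.
Proof.
move=> hz hv hv' hp hp' hu h1 h2; apply/eqP; rewrite -subr_eq0; apply/eqP.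
have E w w' q q' : (forall l, hol r (w l)) -> (forall l, hol r (w' l)) ->
  (forall c b, hol r (q c b)) -> (forall c b, hol r (q' c b)) ->
  op w q (op w' q' u) b z = dir w (dir w' (u b)) z +
   (\sum_c (dir w (u c) z * q' c b z + dir w' (u c) z * q c b z) +
    \sum_c u c z * (dir w (q' c b) z + \sum_d q' c d z * q d b z)).
  move=> hw hw' hq hq'; rewrite {1}/op {1}/op dirD; last 2 first.
  - exact: hol_dir hz.
  - by apply: hol_sum hz => c; exact: holM.
  rewrite (@dir_sum w _ (fun c x => u c x * q' c b x)); last by move=> c; apply: (holM (hu c) (hq' c b)) hz.
  rewrite -!addrA; congr (_ + _).
  have -> : \sum_c op w' q' u c z * q c b z =
    \sum_c dir w' (u c) z * q c b z + \sum_c u c z * (\sum_d q' c d z * q d b z).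
    rewrite /op; under eq_bigr do rewrite mulrDl.
    rewrite big_split /=; congr (_ + _).
    under eq_bigr do rewrite mulr_suml.
    rewrite exchange_big /=; apply: eq_bigr => c _; rewrite mulr_sumr.
    by apply: eq_bigr => d _; rewrite mulrA.
  have -> : \sum_c dir w (fun x => u c x * q' c b x) z =
    \sum_c dir w (u c) z * q' c b z + \sum_c u c z * dir w (q' c b) z.
    rewrite -big_split /=; apply: eq_bigr => c _.
    by rewrite dirM; [|exact: hu|exact: hq'].
  under [X in _ = _ + X]eq_bigr do rewrite mulrDr.
  by rewrite !big_split /=; ring.
rewrite !E // opprD addrACA (dir_comm hz hv hv' (hu b)).
rewrite big1 ?add0r; last by move=> k _; rewrite h1 mul0r.
rewrite opprD addrACA -!sumrB -big_split /= big1 // => c _.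
have := h2 c b; rewrite sumrB => h; rewrite [X in X + _](_ : _ = 0); last by ring.
by rewrite add0r -mulrBr opprD addrACA h mulr0.
Qed.
End FirstOrderOperators.

(** * Loss of radius under differentiation *)

Section OperatorBounds.
Variables (R : realType) (n : nat).
Local Notation C := (cplx R).
Local Notation V := 'rV[C]_n.
Implicit Types (f g : V -> C) (z : V) (r : R) (l : 'I_n).

Lemma nr_rV_le z (d : R) : 0 <= d -> (nr z <= d <-> forall l, nr (z ord0 l) <= d).
Proof.
move=> d0; have dC : 0 <= (d%:C%C : C) by rewrite lecR.
rewrite -(@lecR R) -nrE [`|z|]mx_normE -[d%:C%C]/((NngNum dC)%:num) num_le.
split.
  move=> /bigmax_leP [_ h] l; have := h (ord0, l) isT.
  by rewrite -num_le /= nrE lecR.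
move=> h; apply/bigmax_leP; split; first by rewrite -num_le.
by move=> [i l] _; rewrite -num_le /= (ord1 i) nrE lecR.
Qed.

Lemma nr_coord z l : nr (z ord0 l) <= nr z.
Proof. by have [h _] := nr_rV_le z (nr_ge0 z); apply: h. Qed.

Lemma nr_delta l : nr (delta_mx ord0 l : V) <= 1.
Proof.
apply/nr_rV_le => // k; rewrite mxE eqxx /=; case: (_ == _); last by rewrite nr0.
by rewrite nr_nat.
Qed.

(** In place of Stirling: k^k is at most (2k)(2k-1)...(k+1), which is k! times a binomial
    coefficient of the row 2k, and that row sums to 4^k. *)
Lemma expn_le_fact k : (k ^ k <= 4 ^ k * k`!)%N.
Proof.
have h : (k ^ k <= (k + k) ^_ k)%N.
  rewrite ffact_prod -[X in (X <= _)%N](_ : \prod_(i < k) k = _)%N; last first.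
    by rewrite prod_nat_const card_ord.
  by apply: leq_prod => i _; have := ltn_ord i; lia.
apply: leq_trans h _; rewrite -bin_ffact leq_mul2r; apply/orP; right.
have -> : (4 ^ k = 2 ^ (k + k))%N by rewrite expnD -expnMn.
have -> : (2 ^ (k + k) = \sum_(i < (k + k).+1) 'C(k + k, i))%N.
  rewrite -[2%N]/(1 + 1)%N expnDn; apply: eq_bigr => i _.
  by rewrite !exp1n !muln1.
have hk : (k < (k + k).+1)%N by lia.
by rewrite (bigD1 (Ordinal hk)) //= leq_addr.
Qed.

Lemma differentiable_coordC z l : differentiable (fun x : V => x ord0 l) z.
Proof. exact: differentiable_coord. Qed.

Lemma pd_coord l i z : pd l (fun x : V => x ord0 i) z = (l == i)%:R.
Proof.
rewrite pdE.
have [dz dE] : differentiable (fun x : V => x ord0 i) z /\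
   forall w, 'D_w (fun x : V => x ord0 i) z = w ord0 i.
  have lin : linear (fun x : V => x ord0 i : C) by move=> a x y; rewrite !mxE.
  pose L : {linear V -> C} := HB.pack (fun x : V => x ord0 i : C)
     (GRing.isLinear.Build _ _ _ _ (fun x : V => x ord0 i : C) lin).
  apply: (@diff_intro _ _ _ _ _ L 1).
    by move=> w; rewrite mul1r; apply: nr_coord.
  move=> e e0; exists 1; split=> // w _.
  rewrite (_ : _ - _ - _ = 0); first by rewrite nr0 mulr_ge0 ?nr_ge0 // ltW.
  by rewrite /= mxE; ring.
by rewrite dE mxE eqxx eq_sym.
Qed.

Lemma pd_bound l f (s t M : R) z : s < t -> hol t f ->
  (forall y, nr y < t -> nr (f y) <= M) -> nr z < s -> nr (pd l f z) <= 16 * M / (t - s).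
Proof.
move=> st hf fM hz; rewrite pdE.
have M0 : 0 <= M by apply: le_trans (fM z _); rewrite ?nr_ge0 //; lra.
have ts : 0 < t - s by lra.
have inb y : nr (y - z) < t - s -> nr y < t.
  by move=> hy; have := nrD (y - z) z; rewrite subrK; lra.
apply: le_trans (cauchy_est (delta_mx ord0 l) ts (M := M) _ _) _.
- by move=> y /inb; apply: hf.
- by move=> y /inb; apply: fM.
rewrite -!mulrA ler_wpM2l // ler_wpM2l // mulrC ler_piMr ?nr_delta //.
by rewrite invr_ge0 ltW.
Qed.

Variable e : nat.

Lemma op_bound (v : 'I_n -> V -> C) (psi : 'I_e -> 'I_e -> V -> C) (u : 'I_e -> V -> C)
    (A s t M : R) b z :
  0 <= A -> s < t -> t - s <= 1 ->
  (forall l y, nr y < t -> nr (v l y) <= A) -> (forall c b y, nr y < t -> nr (psi c b y) <= A) ->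
  (forall b, hol t (u b)) -> (forall b y, nr y < t -> nr (u b y) <= M) -> nr z < s ->
  nr (op v psi u b z) <= (16 * n%:R * A + e%:R * A) * M / (t - s).
Proof.
move=> A0 st ts1 hv hp hu uM hz.
have hzt : nr z < t by lra.
have M0 : 0 <= M by apply: le_trans (uM b z _); rewrite ?nr_ge0 //; lra.
have ts : 0 < t - s by lra.
have q1 : nr (dir v (u b) z) <= n%:R * (A * (16 * M / (t - s))).
  apply: le_trans (nr_sum _ _) _.
  have -> : n%:R * (A * (16 * M / (t - s))) = \sum_(l < n) (A * (16 * M / (t - s))).
    by rewrite sumr_const card_ord mulr_natl.
  apply: ler_sum => l _; rewrite nrM; apply: ler_pM; rewrite ?nr_ge0 ?hv //.
  exact: pd_bound st (hu b) (uM b) hz.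
have q2 : nr (\sum_c u c z * psi c b z) <= e%:R * (M * A).
  apply: le_trans (nr_sum _ _) _.
  have -> : e%:R * (M * A) = \sum_(l < e) (M * A).
    by rewrite sumr_const card_ord mulr_natl.
  by apply: ler_sum => c _; rewrite nrM; apply: ler_pM; rewrite ?nr_ge0 ?hp ?uM.
(* Since [t - s <= 1], the zero-order part can be given the denominator of the derivative part. *)
have q3 : e%:R * (M * A) <= e%:R * A * M / (t - s).
  have -> : e%:R * A * M / (t - s) = e%:R * (M * A) / (t - s) by ring.
  rewrite ler_pdivlMr // ler_piMr //.
  by rewrite !mulr_ge0.
rewrite /op; apply: le_trans (nrD _ _) _.
have -> : (16 * n%:R * A + e%:R * A) * M / (t - s) =
  n%:R * (A * (16 * M / (t - s))) + e%:R * A * M / (t - s) by ring.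
lra.
Qed.
End OperatorBounds.

(** * Lie series *)

Section LieSeriesBounds.
Variables (R : realType) (n : nat).
Local Notation C := (cplx R).
Local Notation V := 'rV[C]_n.
Implicit Types (f g : V -> C) (z : V) (r : R) (l : 'I_n).

Lemma tends_sum (I : Type) (s : seq I) (u : I -> nat -> C) (l : I -> C) :
  (forall i, tends (u i) (l i)) -> tends (fun k => \sum_(i <- s) u i k) (\sum_(i <- s) l i).
Proof.
move=> h; elim: s => [|i s ih].
  by rewrite big_nil; apply: (tends_eq (N := 0)) (tends_cst 0) => k _; rewrite big_nil.
rewrite big_cons; apply: (tends_eq (N := 0)) (tendsD (h i) ih) => k _.
by rewrite big_cons.
Qed.

Definition lie_coef (i : 'I_n) (m : nat) (z : V) : C := (m`!%:R)^-1 * (- z ord0 i) ^+ m.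

Lemma lie_coef0 i z : lie_coef i 0 z = 1.
Proof. by rewrite /lie_coef fact0 invr1 mul1r expr0. Qed.

Lemma lie_coefS i m : lie_coef i m.+1 = (fun z => lie_coef i m z * (- (m.+1%:R)^-1 * z ord0 i)).
Proof.
apply/funext => z; rewrite /lie_coef factS natrM exprS.
have h1 : (m.+1%:R : C) != 0 by rewrite pnatr_eq0.
have h2 : (m`!%:R : C) != 0 by rewrite pnatr_eq0 -lt0n fact_gt0.
move: (m.+1%:R : C) (m`!%:R : C) (z ord0 i) h1 h2 => a b x h1 h2.
by field; rewrite h1 h2.
Qed.

Lemma hol_lie_coef r i m : hol r (lie_coef i m).
Proof.
elim: m => [|m ih].
  by rewrite (_ : lie_coef i 0 = fun=> 1); [exact: hol_cst|apply/funext => z; exact: lie_coef0].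
rewrite lie_coefS; apply: holM => //; apply: holM; first exact: hol_cst.
by move=> z _; exact: differentiable_coordC.
Qed.

Lemma pd_lie_coef l i m z : pd l (lie_coef i m.+1) z = - (l == i)%:R * lie_coef i m z.
Proof.
elim: m => [|m ih]; rewrite lie_coefS.
  rewrite (_ : (fun z => _) = fun z => (-1) * z ord0 i); last first.
    by apply/funext => x; rewrite lie_coef0 mul1r invr1.
  have d2 : differentiable (fun z : V => z ord0 i) z by exact: differentiable_coordC.
  have d3 : differentiable (fun _ : V => - 1 : C) z by exact: differentiable_cst.
  by rewrite (pdM l d3 d2) pd_cst pd_coord lie_coef0; ring.
have d1 : differentiable (lie_coef i m.+1) z.
  exact: hol_lie_coef (ltr_pwDl ltr01 (lexx (nr z))).
have d2 : differentiable (fun z : V => z ord0 i) z by exact: differentiable_coordC.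
have d3 : differentiable (fun _ : V => - (m.+2%:R : C)^-1) z.
  exact: differentiable_cst.
have d4 : differentiable (fun z : V => - (m.+2%:R)^-1 * z ord0 i) z by exact: differentiableM.
rewrite (pdM l d1 d4) (pdM l d3 d2) pd_cst pd_coord ih.
have h1 : (m.+1%:R : C) != 0 by rewrite pnatr_eq0.
have h2 : (m.+2%:R : C) != 0 by rewrite pnatr_eq0.
have h3 : (m.+2%:R : C) = m.+1%:R + 1 by rewrite natr1.
rewrite lie_coefS; move: h1 h2; rewrite h3.
move: (m.+1%:R : C) ((l == i)%:R : C) (lie_coef i m z) (z ord0 i) => a b x y h1 h2.
by field; rewrite h1 h2.
Qed.

Lemma nr_lie_coef i m z : nr (lie_coef i m z) <= nr z ^+ m / m`!%:R.
Proof.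
have nrX (x : C) k : nr (x ^+ k) = nr x ^+ k.
  by elim: k => [|k ih]; rewrite ?expr0 ?(nr_nat R 1) // !exprS nrM ih.
rewrite /lie_coef nrM nrV nr_nat nrX nrN mulrC ler_wpM2r ?invr_ge0 //.
by apply: lerXn2r; rewrite ?nnegrE ?nr_ge0 // nr_coord.
Qed.

Variable e : nat.
Implicit Types (u : 'I_e -> V -> C) (v : 'I_n -> V -> C) (psi : 'I_e -> 'I_e -> V -> C).

Lemma hol_iter_op r v psi u k : (forall l, hol r (v l)) -> (forall c b, hol r (psi c b)) ->
  (forall b, hol r (u b)) -> forall b, hol r (iter k (op v psi) u b).
Proof. by move=> hv hp hu; elim: k => //= k ih; apply: hol_op. Qed.

Section Estimates.
Variables (v : 'I_n -> V -> C) (psi : 'I_e -> 'I_e -> V -> C) (u : 'I_e -> V -> C).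
Variables (A M r : R).
Hypotheses (A0 : 0 <= A) (r0 : 0 < r) (r1 : r <= 1).
Hypotheses (hv : forall l, hol r (v l)) (hp : forall c b, hol r (psi c b))
  (hu : forall b, hol r (u b)).
Hypotheses (vA : forall l z, nr z < r -> nr (v l z) <= A)
  (pA : forall c b z, nr z < r -> nr (psi c b z) <= A)
  (uM : forall b z, nr z < r -> nr (u b z) <= M).
(** The constant of [op_bound], increased by 1 so that it is at least 1 even if [n], [e] or [A]
    vanishes. *)
Let B := 16 * n%:R * A + e%:R * A + 1.
(** Without components [M] bounds nothing and may be negative; with a component its value at 0 shows
    the sign. *)
Let M0 : 0 <= M \/ e = 0%N.
Proof.
case: (posnP e) => [|e0]; first by right.
left; apply: le_trans (uM (Ordinal e0) (z := 0) _); rewrite ?nr_ge0 //.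
by rewrite nr0.
Qed.

Lemma op_const_ge1 : 1 <= B.
Proof. by rewrite /B lerDr !addr_ge0 ?mulr_ge0. Qed.

(* Each of the k applications of the operator costs a radius r / (2 k). *)
Lemma iter_op_bound k b z : nr z < r / 2 ->
  nr (iter k (op v psi) u b z) <= M * (2 * B * k%:R / r) ^+ k.
Proof.
have rp := r0; have rl := r1; have Ap := A0; case: k => [|k] hz; first by rewrite expr0 mulr1; apply: uM; apply: lt_le_trans hz _; lra.
have Mp : 0 <= M by case: M0 => // e0; move: b; rewrite e0 => -[].
have B1 := op_const_ge1.
have k0 : 0 < (k.+1%:R : R) by rewrite ltr0n.
pose d := r / (2 * k.+1%:R).
have d0 : 0 < d by rewrite divr_gt0 // mulr_gt0.
have kd : k.+1%:R * d = r / 2 by rewrite /d; field; rewrite gt_eqF.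
have d1 : d <= 1.
  rewrite /d ler_pdivrMr ?mulr_gt0 // mul1r.
  have : (1 : R) <= k.+1%:R by rewrite ler1n.
  lra.
have -> : 2 * B * k.+1%:R / r = B / d by rewrite /d; field; rewrite !gt_eqF.
clearbody d.
suff : forall j, (j <= k.+1)%N -> forall b z, nr z < r - j%:R * d ->
    nr (iter j (op v psi) u b z) <= M * (B / d) ^+ j.
  by apply => //; rewrite kd; lra.
clear b z hz.
elim=> [|j ih] jk b z hz; first by rewrite expr0 mulr1; apply: uM; rewrite mul0r subr0 in hz.
have sE : r - j.+1%:R * d = r - j%:R * d - d by rewrite -natr1; ring.
rewrite sE in hz.
have jr : r - j%:R * d <= r by rewrite gerBl mulr_ge0 // ltW.
apply: le_trans (_ : (16 * n%:R * A + e%:R * A) * (M * (B / d) ^+ j) / (r - j%:R * d - (r - j%:R * d - d)) <= _).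
  apply: (@op_bound _ _ _ v psi (iter j (op v psi) u) _ _ _ _ _ _ A0 _ _ _ _ _ _ hz).
  - by lra.
  - by lra.
  - by move=> l y hy; apply: vA; lra.
  - by move=> c b' y hy; apply: pA; lra.
  - by move=> b'; apply: hol_le jr _; exact: hol_iter_op.
  - by apply: ih; apply: ltnW.
rewrite (_ : r - j%:R * d - (r - j%:R * d - d) = d); last by ring.
rewrite exprS (_ : M * (B / d * (B / d) ^+ j) = B * (M * (B / d) ^+ j) / d); last by ring.
apply: ler_wpM2r; first by rewrite invr_ge0 ltW.
apply: ler_wpM2r; last by rewrite /B lerDl.
by rewrite mulr_ge0 // exprn_ge0 // divr_ge0 ?ltW //; lra.
Qed.

(** Chosen so that |z| * 2 B / r is at most 1/8; the factor 4^k from k^k / k! then leaves a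
    geometric series of ratio 1/2. *)
Let r' := r / (16 * B).

Lemma lie_radius_gt0 : 0 < r'.
Proof. by rewrite divr_gt0 // mulr_gt0 //; have := op_const_ge1; lra. Qed.

Lemma lie_radius_le : r' <= r / 16.
Proof.
have rp := r0; have B1 := op_const_ge1; rewrite /r' ler_wpM2l ?(ltW r0) // lef_pV2 ?posrE ?mulr_gt0 //; lra.
Qed.

Lemma coef_bound k i z : nr z < r' -> nr (lie_coef i k z) * (2 * B * k%:R / r) ^+ k <= (2^-1) ^+ k.
Proof.
move=> hz; have rp := r0; have B1 := op_const_ge1; have Bp : 0 < B by lra.
have f0 : (0 : R) < k`!%:R by rewrite ltr0n fact_gt0.
have q0 : 0 <= 2 * B * k%:R / r by rewrite divr_ge0 ?mulr_ge0 // ltW.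
apply: le_trans (ler_wpM2r (exprn_ge0 _ q0) (nr_lie_coef _ _ _)) _.
have kk : (k%:R ^+ k : R) <= 4 ^+ k * k`!%:R.
  by rewrite -!natrX -natrM ler_nat expn_le_fact.
have h1 : nr z * (2 * B / r) <= 8^-1.
  rewrite mulrA ler_pdivrMr //; move: (ltW hz); rewrite /r' ler_pdivlMr ?mulr_gt0 //; lra.
have -> : nr z ^+ k / k`!%:R * (2 * B * k%:R / r) ^+ k =
   (nr z * (2 * B / r)) ^+ k * (k%:R ^+ k / k`!%:R).
  rewrite (_ : 2 * B * k%:R / r = (2 * B / r) * k%:R); last by ring.
  by rewrite !exprMn; ring.
apply: le_trans (_ : (8^-1) ^+ k * 4 ^+ k <= _); last first.
  rewrite -exprMn; apply: lerXn2r; rewrite ?nnegrE //; last by lra.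
apply: ler_pM.
- by rewrite exprn_ge0 // mulr_ge0 ?nr_ge0 // divr_ge0 ?mulr_ge0 // ltW.
- by rewrite divr_ge0 // exprn_ge0.
- apply: lerXn2r h1; rewrite ?nnegrE ?invr_ge0 //.
  by rewrite mulr_ge0 ?nr_ge0 // divr_ge0 ?mulr_ge0 // ltW.
- by rewrite ler_pdivrMr.
Qed.

Lemma term_bound i k b z : nr z < r' ->
  nr (lie_coef i k z * iter k (op v psi) u b z) <= M * (2^-1) ^+ k.
Proof.
move=> hz; have rp := r0; have rl := r1; have Ap := A0; have Mp : 0 <= M by case: M0 => // e0; move: (b); rewrite e0 => -[].
have z2 : nr z < r / 2 by have := lie_radius_le; lra.
rewrite nrM; apply: le_trans (ler_wpM2l (nr_ge0 _) (iter_op_bound k b z2)) _.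
by rewrite mulrCA ler_wpM2l // coef_bound.
Qed.

(** This is the term left over by telescoping, with one operator more than the order of its
    coefficient. The extra operator takes the radius from r / 2 to r / 4, hence the denominator. *)
Lemma last_bound i k b z : nr z < r' ->
  nr (lie_coef i k z * iter k.+1 (op v psi) u b z) <= B * M / (r / 4) * (2^-1) ^+ k.
Proof.
move=> hz; have rp := r0; have rl := r1; have Ap := A0; have Mp : 0 <= M by case: M0 => // e0; move: (b); rewrite e0 => -[].
have z4 : nr z < r / 4 by have := lie_radius_le; lra.
have B1 := op_const_ge1.
pose Q := M * (2 * B * k%:R / r) ^+ k.
have Q0 : 0 <= Q.
  by rewrite mulr_ge0 // exprn_ge0 // divr_ge0 ?mulr_ge0 // ?(ltW r0) //; lra.
have hb : nr (iter k.+1 (op v psi) u b z) <= B * Q / (r / 4).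
  apply: le_trans (_ : (16 * n%:R * A + e%:R * A) * Q / (r / 2 - r / 4) <= _).
    apply: (@op_bound _ _ _ v psi (iter k (op v psi) u) _ _ (r / 2) _ _ _ A0 _ _ _ _ _ _ z4).
    - by lra.
    - by lra.
    - by move=> l y hy; apply: vA; lra.
    - by move=> c b' y hy; apply: pA; lra.
    - by move=> b'; apply: (@hol_le _ _ r); [lra|exact: hol_iter_op].
    - by move=> b' y; apply: iter_op_bound.
  rewrite (_ : r / 2 - r / 4 = r / 4); last by field.
  apply: ler_wpM2r; first by rewrite invr_ge0; lra.
  by apply: ler_wpM2r => //; rewrite /B lerDl.
rewrite nrM; apply: le_trans (ler_wpM2l (nr_ge0 _) hb) _.
have -> : nr (lie_coef i k z) * (B * Q / (r / 4)) =
  B * M / (r / 4) * (nr (lie_coef i k z) * (2 * B * k%:R / r) ^+ k) by rewrite /Q; ring.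
apply: ler_wpM2l; last exact: coef_bound.
by rewrite divr_ge0 ?mulr_ge0 //; lra.
Qed.
End Estimates.
End LieSeriesBounds.

(** * Convergence of the Lie series and simultaneous solutions *)

Section LieSeries.
Variables (R : realType) (n : nat).
Local Notation C := (cplx R).
Local Notation V := 'rV[C]_n.
Implicit Types (f g : V -> C) (z : V) (r : R) (l : 'I_n).

Lemma fin_radius (I : finType) (P : I -> R -> Prop) (r : R) : 0 < r ->
  (forall i s t, s <= t -> P i t -> P i s) -> (forall i, exists2 d, 0 < d & P i d) ->
  exists s, [/\ 0 < s, s <= r & forall i, P i s].
Proof.
move=> r0 mono hP.
have [s [s0 sr hs]] : exists s, [/\ 0 < s, s <= r & forall i, i \in index_enum I -> P i s].
  elim: (index_enum I) => [|i l [s [s0 sr hs]]]; first by exists r.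
  have [d d0 hd] := hP i; exists (Num.min s d); split.
  - by rewrite lt_min s0.
  - by rewrite ge_min sr.
  move=> j; rewrite inE => /orP[/eqP ->|/hs].
    by apply: mono hd; rewrite ge_min lexx orbT.
  by apply: mono; rewrite ge_min lexx.
by exists s; split=> // i; apply: hs; rewrite mem_index_enum.
Qed.

Lemma fin_bounded (I : finType) (F : I -> V -> C) r : 0 < r -> (forall i, hol r (F i)) ->
  exists s A, [/\ 0 < s, s <= r, 0 <= A & forall i z, nr z < s -> nr (F i z) <= A].
Proof.
move=> r0 hF.
pose A := \sum_i (nr (F i 0) + 1).
have [s [s0 sr hs]] : exists s, [/\ 0 < s, s <= r & forall i z, nr z < s -> nr (F i z) <= A].
  apply: fin_radius => //; first by move=> i s t st h z hz; apply: h; lra.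
  move=> i; have d0 : differentiable (F i) 0 by apply: hF; rewrite nr0.
  have [d [d1 hd]] := continuous_bounded d0; exists d => // z hz.
  apply: le_trans (hd z _) _; first by rewrite subr0.
  by rewrite /A (bigD1 i) //= lerDl sumr_ge0 // => j _; rewrite addr_ge0 // nr_ge0.
exists s, A; split=> //.
by rewrite sumr_ge0 // => j _; rewrite addr_ge0 // nr_ge0.
Qed.

Variable e : nat.
Implicit Types (u : 'I_e -> V -> C) (v : 'I_n -> V -> C) (psi : 'I_e -> 'I_e -> V -> C).

Definition lie_sum v psi u i N : 'I_e -> V -> C := fun b z =>
  \sum_(m < N) lie_coef i m z * iter m (op v psi) u b z.

Lemma hol_lie_sum r v psi u i N : (forall l, hol r (v l)) -> (forall c b, hol r (psi c b)) ->
  (forall b, hol r (u b)) -> forall b, hol r (lie_sum v psi u i N b).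
Proof.
move=> hv hp hu b; apply: hol_sum => m; apply: holM; first exact: hol_lie_coef.
exact: hol_iter_op.
Qed.

Lemma op_lie_term r v psi v' psi' u i m b z : nr z < r ->
  (forall l, hol r (v l)) -> (forall c b, hol r (psi c b)) -> (forall b, hol r (u b)) ->
  op v' psi' (fun b x => lie_coef i m x * iter m (op v psi) u b x) b z =
  (if m is m'.+1 then - v' i z * lie_coef i m' z else 0) * iter m (op v psi) u b z
  + lie_coef i m z * op v' psi' (iter m (op v psi) u) b z.
Proof.
move=> hz hv hp hu; rewrite op_mul; last 2 first.
- exact: hol_lie_coef hz.
- by move=> b'; apply: hol_iter_op hz.
congr (_ * _ + _); case: m => [|m].
  rewrite (_ : lie_coef i 0 = fun=> 1) ?dir_cst //.
  by apply/funext => x; rewrite lie_coef0.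
rewrite /dir (bigD1 i) //= pd_lie_coef eqxx big1 ?addr0; first by rewrite mulr1n; ring.
by move=> l /negbTE li; rewrite pd_lie_coef li oppr0 mul0r mulr0.
Qed.

Lemma op_lie_sum r v psi v' psi' u i N b z : nr z < r ->
  (forall l, hol r (v l)) -> (forall c b, hol r (psi c b)) -> (forall b, hol r (u b)) ->
  op v' psi' (lie_sum v psi u i N) b z = \sum_(m < N)
   ((if (m : nat) is m'.+1 then - v' i z * lie_coef i m' z else 0) * iter m (op v psi) u b z
    + lie_coef i m z * op v' psi' (iter m (op v psi) u) b z).
Proof.
move=> hz hv hp hu; rewrite /lie_sum op_sum; last first.
  by move=> m b'; apply: holM hz; [exact: hol_lie_coef|exact: hol_iter_op].
by apply: eq_bigr => m _; apply: (@op_lie_term r).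
Qed.

(* The sum telescopes because v(z_i) = 1. *)
Lemma op_lie_sum_self r v psi u i N b z : nr z < r ->
  (forall l, hol r (v l)) -> (forall c b, hol r (psi c b)) -> (forall b, hol r (u b)) ->
  v i z = 1 ->
  op v psi (lie_sum v psi u i N.+1) b z = lie_coef i N z * iter N.+1 (op v psi) u b z.
Proof.
move=> hz hv hp hu vi; rewrite (op_lie_sum v psi i N.+1 b hz hv hp hu) vi.
elim: N => [|N ih]; first by rewrite big_ord_recr big_ord0 /= mul0r !add0r.
rewrite big_ord_recr ih /=; ring.
Qed.

(** As v'(z_i) = 0, [v'] does not see the coefficients, and by commutation every iterate of [u]
    stays in the kernel of the second operator. *)
Lemma op_lie_sum_other r v psi v' psi' u i N b z : nr z < r ->
  (forall l, hol r (v l)) -> (forall c b, hol r (psi c b)) -> (forall b, hol r (u b)) ->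
  v' i z = 0 ->
  (forall f : 'I_e -> V -> C, (forall b, hol r (f b)) -> forall b z, nr z < r ->
     op v' psi' (op v psi f) b z = op v psi (op v' psi' f) b z) ->
  (forall b z, nr z < r -> op v' psi' u b z = 0) ->
  op v' psi' (lie_sum v psi u i N) b z = 0.
Proof.
move=> hz hv hp hu vi hc hu0; rewrite (op_lie_sum v' psi' i N b hz hv hp hu) vi.
have it m : forall b z, nr z < r -> op v' psi' (iter m (op v psi) u) b z = 0.
  elim: m => [|m ih] b' y hy; first exact: hu0.
  rewrite iterS hc //; last exact: hol_iter_op.
  rewrite (op_local v psi b' hy (u' := fun _ _ => 0)); first exact: op0.
  by move=> b'' x hx; rewrite ih.
rewrite big1 // => m _; rewrite it // mulr0 addr0.
by case: (nat_of_ord m) => [|m']; rewrite ?oppr0 ?mul0r.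
Qed.

Lemma half_pow_small (K : R) : 0 <= K -> forall eps : R, 0 < eps ->
  exists N, forall k, (N <= k)%N -> K * (2^-1) ^+ k <= eps.
Proof.
move=> K0 eps e0; have [N hN] := pow_small K0 e0 (lexx 2).
exists N => k /subnK <-; rewrite exprD mulrCA.
apply: le_trans (_ : 1 * (K * 2^-1 ^+ N) <= _); last by rewrite mul1r exprVn ltW.
apply: ler_wpM2r; first by rewrite mulr_ge0 // exprn_ge0 // invr_ge0.
by rewrite exprn_ile1 ?invr_ge0 // invf_le1 // ler1n.
Qed.

Lemma lie_estimates r v psi u : 0 < r ->
  (forall l, hol r (v l)) -> (forall c b, hol r (psi c b)) -> (forall b, hol r (u b)) ->
  exists r' (K : R), [/\ 0 < r', r' <= r, 0 <= K &
    forall i k b z, nr z < r' ->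
      nr (lie_coef i k z * iter k (op v psi) u b z) <= K * (2^-1) ^+ k /\
      nr (lie_coef i k z * iter k.+1 (op v psi) u b z) <= K * (2^-1) ^+ k].
Proof.
move=> r0 hv hp hu.
have [s1 [A1 [s10 s1r A10 hA1]]] := fin_bounded r0 hv.
have [s2 [A2 [s20 s2r A20 hA2]]] := @fin_bounded ('I_e * 'I_e)%type (fun x => psi x.1 x.2) r r0 (fun x => hp x.1 x.2).
have [s3 [M [s30 s3r M0 hM]]] := fin_bounded r0 hu.
have [s [s0 [h1 h2] [h3 h4]]] : exists s, [/\ 0 < s, s <= 1 /\ s <= s1 & s <= s2 /\ s <= s3].
  exists (Num.min (Num.min 1 s1) (Num.min s2 s3)).
  by rewrite !lt_min !ge_min !lexx !orbT ltr01 s10 s20 s30.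
have [A [A0 AA1 AA2]] : exists A, [/\ 0 <= A, A1 <= A & A2 <= A].
  by exists (A1 + A2); rewrite addr_ge0 // lerDl lerDr.
have sr : s <= r by lra.
have hv' l : hol s (v l) by apply: hol_le sr _.
have hp' c b : hol s (psi c b) by apply: hol_le sr _.
have hu' b : hol s (u b) by apply: hol_le sr _.
have vA l z : nr z < s -> nr (v l z) <= A.
  by move=> hz; apply: le_trans AA1; apply: hA1; lra.
have pA c b z : nr z < s -> nr (psi c b z) <= A.
  by move=> hz; apply: le_trans AA2; apply: (hA2 (c, b)); lra.
have uM b z : nr z < s -> nr (u b z) <= M by move=> hz; apply: hM; lra.
have q1 := lie_radius_gt0 n e A0 s0; have q2 := lie_radius_le n e A0 s0; have B1 := op_const_ge1 n e A0.
have tb := term_bound A0 s0 h1 hv' hp' hu' vA pA uM.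
have lb := last_bound A0 s0 h1 hv' hp' hu' vA pA uM.
move: q1 q2 B1 tb lb; set B := 16 * n%:R * A + _ + 1; move=> q1 q2 B1 tb lb.
have K0 : 0 <= B * M / (s / 4) by rewrite divr_ge0 ?mulr_ge0 //; lra.
exists (s / (16 * B)), (M + B * M / (s / 4)); split=> //; first by lra.
  by rewrite addr_ge0.
move=> i k b z hz; split.
  apply: le_trans (tb i k b z hz) _; apply: ler_wpM2r; last by rewrite lerDl.
  by rewrite exprn_ge0 // invr_ge0.
apply: le_trans (lb i k b z hz) _; apply: ler_wpM2r; last by rewrite lerDr.
by rewrite exprn_ge0 // invr_ge0.
Qed.

Lemma tends_op v psi (S : nat -> 'I_e -> V -> C) w r b z : nr z < r ->
  (forall N b, hol r (S N b)) ->
  (forall b (eps : R), 0 < eps -> exists N, forall k z, (N <= k)%N -> nr z < r ->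
     nr (S k b z - w b z) <= eps) ->
  tends (fun N => op v psi (S N) b z) (op v psi w b z).
Proof.
move=> hz hS hw; have rz : 0 < r - nr z by lra.
have inb y : nr (y - z) < r - nr z -> nr y < r.
  by move=> hy; have := nrD (y - z) z; rewrite subrK; lra.
have W b' : forall x, tends (fun k => 'D_x (S k b') z) ('D_x (w b') z).
  have [||_] := @weierstrass _ _ (S^~ b') (w b') z _ 0%N rz => //.
    by move=> k _ y /inb; apply: hS.
  move=> eps /(hw b') [N hN]; exists N => k y Nk /inb; exact: hN.
apply: tendsD; apply: tends_sum => l.
  by apply: tendsZ; rewrite pd.unlock; exact: (W b (delta_mx ord0 l)).
have h : tends (fun k => S k l z) (w l z) by move=> eps /(hw l) [N hN]; exists N => k Nk; exact: hN.
have := tendsZ (psi l b z) h.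
by under eq_fun do rewrite mulrC; rewrite mulrC.
Qed.

Lemma hol_limit (S : nat -> V -> C) (w : V -> C) r :
  (forall N, hol r (S N)) ->
  (forall (eps : R), 0 < eps -> exists N, forall k z, (N <= k)%N -> nr z < r ->
     nr (S k z - w z) <= eps) ->
  hol r w.
Proof.
move=> hS hw z hz; have rz : 0 < r - nr z by lra.
have inb y : nr (y - z) < r - nr z -> nr y < r.
  by move=> hy; have := nrD (y - z) z; rewrite subrK; lra.
have [||dw _] := @weierstrass _ _ S w z _ 0%N rz => //.
  by move=> k _ y /inb; apply: hS.
move=> eps /hw [N hN]; exists N => k y Nk /inb; exact: hN.
Qed.

(** One step of the construction. The last clause, quantified over all second operators, is what
    allows the equations to be solved one after another. *)
Lemma lie_series r v psi u i : 0 < r ->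
  (forall l, hol r (v l)) -> (forall c b, hol r (psi c b)) -> (forall b, hol r (u b)) ->
  (forall z, nr z < r -> v i z = 1) ->
  exists r' (w : 'I_e -> V -> C), [/\ 0 < r', r' <= r, forall b, hol r' (w b),
    forall b z, nr z < r' -> op v psi w b z = 0 & (forall b, w b 0 = u b 0) /\
    forall v' psi', (forall z, nr z < r -> v' i z = 0) ->
     (forall s, s <= r -> forall f : 'I_e -> V -> C, (forall b, hol s (f b)) ->
      forall b z, nr z < s ->
       op v' psi' (op v psi f) b z = op v psi (op v' psi' f) b z) ->
     (forall b z, nr z < r -> op v' psi' u b z = 0) ->
     forall b z, nr z < r' -> op v' psi' w b z = 0].
Proof.
move=> r0 hv hp hu vi.
have [r' [K [r'0 r'r K0 hK]]] := lie_estimates r0 hv hp hu.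
pose S N := lie_sum v psi u i N.
have hS N b : hol r' (S N b) by apply: hol_le r'r _; exact: hol_lie_sum.
(* The tail of the geometric series with terms K / 2^m. *)
have SE N q b z : nr z < r' ->
    nr (S (N + q)%N b z - S N b z) <= 2 * K * ((2^-1) ^+ N - (2^-1) ^+ (N + q)).
  move=> hz; elim: q => [|q ih]; first by rewrite addn0 !subrr nr0 mulr0.
  rewrite addnS /S /lie_sum big_ord_recr /= -/(S (N + q)%N b z) addrAC.
  apply: le_trans (nrD _ _) _; have [h _] := hK i (N + q)%N b z hz.
  by rewrite exprS; lra.
have half_ge0 k : 0 <= (2^-1 : R) ^+ k by rewrite exprn_ge0 // invr_ge0.
have K20 : 0 <= 2 * K by rewrite mulr_ge0.
have SE' N k b z : nr z < r' -> (N <= k)%N -> nr (S k b z - S N b z) <= 2 * K * (2^-1) ^+ N.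
  move=> hz /subnKC <-; apply: le_trans (SE _ _ _ _ hz) _.
  by rewrite ler_wpM2l // gerBl.
have /choice [w' hw'] : forall x : 'I_e * V, exists l : C, nr x.2 < r' -> tends (fun N => S N x.1 x.2) l.
  move=> [b z]; have [hz|hz] := ltP (nr z) r'; last by exists 0 => /= h; exfalso; lra.
  suff [a ha] : exists a, tends (fun N => S N b z) a by exists a.
  apply: tends_complete => eps e0; have e2 : 0 < eps / 2 by lra.
  have [N hN] := half_pow_small K20 e2; exists N => k q Nk Nq /=.
  have h1 := SE' _ _ b z hz Nk; have h2 := SE' _ _ b z hz Nq; have h3 := hN _ (leqnn N).
  have := nrD (S k b z - S N b z) (- (S q b z - S N b z)); rewrite nrN.
  have -> : S k b z - S N b z - (S q b z - S N b z) = S k b z - S q b z by ring.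
  lra.
pose w b z := w' (b, z).
have hw b (eps : R) : 0 < eps -> exists N, forall k z, (N <= k)%N -> nr z < r' ->
     nr (S k b z - w b z) <= eps.
  move=> e0; have [N hN] := half_pow_small K20 e0; exists N => k z Nk hz.
  apply: le_trans (hN _ Nk).
  have t1 := tendsD (tends_cst (S k b z)) (tendsZ (-1) (hw' (b, z) hz)).
  rewrite mulN1r in t1; apply: (@tends_le _ _ _ _ k _ t1) => m km /=.
  by rewrite mulN1r -nrN opprB; apply: SE'.
exists r', w; split=> //.
- by move=> b; apply: hol_limit (hS^~ b) (hw b).
- move=> b z hz; have t1 := tends_op v psi b hz hS hw; apply: (tends_unique t1).
  move=> eps e0; have [N hN] := half_pow_small K0 e0; exists N.+1 => -[//|k] Nk.
  have hzr : nr z < r by lra.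
  rewrite subr0 (op_lie_sum_self k b hzr hv hp hu (vi z hzr)).
  have [_ h] := hK i k b z hz; apply: le_trans h _; exact: hN.
split.
  move=> b; have hz : nr (0 : V) < r' by rewrite nr0.
  apply: (tends_unique (hw' (b, 0) hz)).
  apply: (@tends_eq _ (fun=> u b 0) _ _ 1%N); last exact: tends_cst.
  move=> [//|k] _; rewrite /S /lie_sum big_ord_recl /= lie_coef0 mul1r big1 ?addr0 // => m _.
  by rewrite /lie_coef mxE oppr0 expr0n /= mulr0 mul0r.
move=> v' psi' vi' hc hu' b z hz; have t1 := tends_op v' psi' b hz hS hw.
have hzr : nr z < r by lra.
apply: (tends_unique t1); apply: (@tends_eq _ (fun=> 0) _ _ 0%N); last exact: tends_cst.
move=> k _; rewrite (op_lie_sum_other k b hzr hv hp hu (vi' z hzr)) //.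
exact: hc.
Qed.

(** Commutation is demanded on every smaller ball, because each Lie series shrinks the domain. *)
Definition compatible r k (g : 'I_k -> 'I_n) (v : 'I_k -> 'I_n -> V -> C)
    (psi : 'I_k -> 'I_e -> 'I_e -> V -> C) :=
  [/\ forall j l, hol r (v j l), forall j c b, hol r (psi j c b),
    forall j m z, nr z < r -> v j (g m) z = (j == m)%:R &
    forall i j s, s <= r -> forall f : 'I_e -> V -> C, (forall b, hol s (f b)) ->
      forall b z, nr z < s ->
       op (v i) (psi i) (op (v j) (psi j) f) b z = op (v j) (psi j) (op (v i) (psi i) f) b z].

Lemma flat_section r k (g : 'I_k -> 'I_n) (v : 'I_k -> 'I_n -> V -> C)
    (psi : 'I_k -> 'I_e -> 'I_e -> V -> C) (u0 : 'I_e -> C) : 0 < r -> compatible r g v psi ->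
  exists r' (w : 'I_e -> V -> C), [/\ 0 < r', r' <= r, forall b, hol r' (w b),
    forall b, w b 0 = u0 b &
    forall j b z, nr z < r' -> op (v j) (psi j) w b z = 0].
Proof.
move=> r0 [hv hp hg hc].
(* The series in the coordinate [g m] solves the equation of index m and keeps the earlier ones,
   whose fields annihilate that coordinate. *)
suff key m : (m <= k)%N -> exists r' (w : 'I_e -> V -> C),
    [/\ 0 < r', r' <= r, forall b, hol r' (w b), forall b, w b 0 = u0 b &
    forall j : 'I_k, (j < m)%N -> forall b z, nr z < r' -> op (v j) (psi j) w b z = 0].
  have [r' [w [h1 h2 h3 h4 h5]]] := key k (leqnn k).
  by exists r', w; split=> // j; apply: h5.
elim: m => [|m ih] mk.
  by exists r, (fun b _ => u0 b); split=> // b; exact: hol_cst.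
have [s [w [s0 sr hw w0 hjw]]] := ih (ltnW mk).
pose jm := Ordinal mk.
have [||||r' [w' [r'0 r's hw' hw'm [w'0 hother]]]] :=
  @lie_series s (v jm) (psi jm) w (g jm) s0.
- by move=> l; apply: hol_le sr _.
- by move=> c b; apply: hol_le sr _.
- exact: hw.
- by move=> z hz; rewrite hg ?eqxx //; lra.
exists r', w'; split=> //; first by lra.
  by move=> b; rewrite w'0.
move=> j; rewrite ltnS leq_eqVlt => /orP[/eqP jE|jlt] b z hz.
  by rewrite (_ : j = jm) ?hw'm //; apply: val_inj.
apply: hother hz.
- move=> y hy; rewrite hg; last by lra.
  by rewrite (_ : (j == jm) = false) //; apply/eqP => /(congr1 val) /= h; rewrite h ltnn in jlt.
- by move=> t ts f hf b' y hy; apply: (hc _ _ t) => //; lra.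
- by move=> b' y hy; apply: hjw.
Qed.
End LieSeries.

(** * Commuting frames of a regular Poisson structure *)

Section PoissonFrame.
Variables (R : realType) (n e k : nat).
Local Notation C := (cplx R).
Local Notation V := 'rV[C]_n.
Variables (s : 'I_n -> 'I_n -> V -> C) (th : 'I_n -> 'I_e -> 'I_e -> V -> C).
Variables (cm : 'I_k -> 'I_n -> V -> C) (g : 'I_k -> 'I_n) (r : R).

(** [cm] will be the inverse of a maximal minor of [s]. The potential is the same combination of the
    [th i] with a minus sign, which turns X u = u th into the vanishing of [op]. *)
Definition frame_field (j : 'I_k) (l : 'I_n) : V -> C := fun z => \sum_i cm j i z * s i l z.
Definition frame_pot (j : 'I_k) (c b : 'I_e) : V -> C := fun z => - \sum_i cm j i z * th i c b z.

Lemma dir_frame j f z : dir (frame_field j) f z = \sum_i cm j i z * dir (s i) f z.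
Proof.
rewrite /dir; under eq_bigr do rewrite mulr_suml.
rewrite exchange_big /=; apply: eq_bigr => i _; rewrite mulr_sumr.
by apply: eq_bigr => l _; rewrite mulrA.
Qed.

Hypotheses (hs : forall i l, hol r (s i l)) (hth : forall i c b, hol r (th i c b))
  (hcm : forall j i, hol r (cm j i)).

(** The arbitrary [a] serves twice: columns of [s] give the bracket of two frame fields, entries of
    [th] give the derivative part of their curvature. *)
Lemma frame_bracket (a : 'I_n -> V -> C) (j j' : 'I_k) z : nr z < r -> (forall i, hol r (a i)) ->
  dir (frame_field j) (fun x => \sum_i cm j' i x * a i x) z
  - dir (frame_field j') (fun x => \sum_i cm j i x * a i x) z =
  \sum_m (dir (frame_field j) (cm j' m) z - dir (frame_field j') (cm j m) z) * a m z
  + \sum_i \sum_i' cm j i z * cm j' i' z * (dir (s i) (a i') z - dir (s i') (a i) z).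
Proof.
move=> hz ha.
have E p q : dir (frame_field p) (fun x => \sum_i cm q i x * a i x) z =
   \sum_m dir (frame_field p) (cm q m) z * a m z +
   \sum_i \sum_i' cm p i z * cm q i' z * dir (s i) (a i') z.
  rewrite (@dir_sum _ _ _ _ (fun i x => cm q i x * a i x)); last first.
    by move=> i; apply: (holM (hcm q i) (ha i)) hz.
  rewrite [X in _ = _ + X]exchange_big -big_split /=; apply: eq_bigr => m _.
  rewrite (dirM _ (hcm q m hz) (ha m z hz)); congr (_ + _).
  rewrite dir_frame mulr_sumr; apply: eq_bigr => i _.
  by rewrite mulrA [cm q m z * _]mulrC.
rewrite !E [X in _ - (_ + X)]exchange_big /= opprD addrACA.
congr (_ + _).
  by rewrite -sumrB; apply: eq_bigr => m _; rewrite mulrBl.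
rewrite -sumrB; apply: eq_bigr => i _; rewrite -sumrB; apply: eq_bigr => i' _.
by rewrite mulrBr [cm j' i' z * _]mulrC.
Qed.

Hypothesis jacobi : forall i j l z, nr z < r ->
  dir (s i) (s j l) z - dir (s j) (s i l) z = \sum_m pd m (s i j) z * s m l z.
Hypothesis flat : forall i j c b z, nr z < r ->
  dir (s i) (th j c b) z - dir (s j) (th i c b) z =
  \sum_m pd m (s i j) z * th m c b z
  - \sum_d (th i c d z * th j d b z - th j c d z * th i d b z).
Hypothesis frame1 : forall j m z, nr z < r -> frame_field j (g m) z = (j == m)%:R.
Hypothesis frame2 : forall i l z, nr z < r ->
  s i l z = \sum_j s i (g j) z * frame_field j l z.
Hypothesis frame3 : forall i c b z, nr z < r ->
  th i c b z = \sum_j s i (g j) z * (- frame_pot j c b z).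

Lemma hol_frame_field j l : hol r (frame_field j l).
Proof. by apply: hol_sum => i; apply: holM. Qed.

Lemma hol_frame_pot j c b : hol r (frame_pot j c b).
Proof. by apply: holN; apply: hol_sum => i; apply: holM. Qed.

(** Coefficients of the bracket of two frame fields in terms of the rows of [s]. The point is that
    [jacobi] and [flat] produce the same coefficients, once against [s] and once against [th]. *)
Let coef (j j' : 'I_k) (m : 'I_n) z := dir (frame_field j) (cm j' m) z - dir (frame_field j') (cm j m) z
  + \sum_i \sum_i' cm j i z * cm j' i' z * pd m (s i i') z.

Let sum_coef (j j' : 'I_k) (a : 'I_n -> C) z :
  \sum_m (dir (frame_field j) (cm j' m) z - dir (frame_field j') (cm j m) z) * a m
  + \sum_i \sum_i' cm j i z * cm j' i' z * (\sum_m pd m (s i i') z * a m) =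
  \sum_m coef j j' m z * a m.
Proof.
rewrite /coef; under [RHS]eq_bigr do rewrite mulrDl.
rewrite big_split /=; congr (_ + _).
under [RHS]eq_bigr do rewrite mulr_suml.
rewrite [RHS]exchange_big /=; apply: eq_bigr => i _.
under [RHS]eq_bigr do rewrite mulr_suml.
rewrite [RHS]exchange_big /=; apply: eq_bigr => i' _.
by rewrite mulr_sumr; apply: eq_bigr => m _; rewrite mulrA.
Qed.

Let bracket_coef j j' l z : nr z < r ->
  dir (frame_field j) (frame_field j' l) z - dir (frame_field j') (frame_field j l) z =
  \sum_m coef j j' m z * s m l z.
Proof.
move=> hz; rewrite (frame_bracket (a := fun i => s i l) j j' hz (fun i => hs i l)).
rewrite -(sum_coef j j' (fun m => s m l z)); congr (_ + _).
by apply: eq_bigr => i _; apply: eq_bigr => i' _; rewrite jacobi.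
Qed.

Let bracket_g j j' m z : nr z < r -> \sum_i coef j j' i z * s i (g m) z = 0.
Proof.
move=> hz; rewrite -bracket_coef //.
have E p q : dir (frame_field p) (frame_field q (g m)) z = 0.
  rewrite (dir_local _ hz (g := fun=> (q == m)%:R)) ?dir_cst // => y hy.
  exact: frame1.
by rewrite !E subrr.
Qed.

(* The bracket is a combination of rows of s, and such a combination vanishes as soon as
   its entries with index g m do (frame2). *)
Lemma frame_comm j j' l z : nr z < r ->
  dir (frame_field j) (frame_field j' l) z - dir (frame_field j') (frame_field j l) z = 0.
Proof.
move=> hz; rewrite bracket_coef //.
under eq_bigr do rewrite frame2 // mulr_sumr.
rewrite exchange_big /= big1 // => m _.
by under eq_bigr do rewrite mulrA; rewrite -mulr_suml bracket_g // mul0r.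
Qed.

(** The quadratic part of [flat] cancels the products of potentials. The rest is the sum of [coef]
    against [th], which by [frame3] factors through the entries that [bracket_g] annihilates. *)
Lemma frame_flat j j' c b z : nr z < r ->
  dir (frame_field j) (frame_pot j' c b) z - dir (frame_field j') (frame_pot j c b) z
  + \sum_d (frame_pot j' c d z * frame_pot j d b z - frame_pot j c d z * frame_pot j' d b z) = 0.
Proof.
move=> hz.
have hsum q : differentiable (fun x => \sum_i cm q i x * th i c b x) z.
  by move: (hz); apply: hol_sum => i; apply: holM.
have -> : dir (frame_field j) (frame_pot j' c b) z - dir (frame_field j') (frame_pot j c b) z =
   - (dir (frame_field j) (fun x => \sum_i cm j' i x * th i c b x) z
     - dir (frame_field j') (fun x => \sum_i cm j i x * th i c b x) z).
  by rewrite /frame_pot (dirN _ (hsum j')) (dirN _ (hsum j)); ring.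
rewrite (frame_bracket (a := fun i => th i c b) j j' hz (fun i => hth i c b)).
have -> : \sum_i \sum_i' cm j i z * cm j' i' z * (dir (s i) (th i' c b) z - dir (s i') (th i c b) z) =
  \sum_i \sum_i' cm j i z * cm j' i' z * (\sum_m pd m (s i i') z * th m c b z)
  - \sum_d (frame_pot j c d z * frame_pot j' d b z - frame_pot j' c d z * frame_pot j d b z).
  have -> : \sum_d (frame_pot j c d z * frame_pot j' d b z - frame_pot j' c d z * frame_pot j d b z) =
    \sum_i \sum_i' cm j i z * cm j' i' z * \sum_d (th i c d z * th i' d b z - th i' c d z * th i d b z).
    have E p q : \sum_d frame_pot p c d z * frame_pot q d b z =
       \sum_i \sum_i' cm p i z * cm q i' z * \sum_d th i c d z * th i' d b z.
      rewrite /frame_pot; under eq_bigr do rewrite mulrNN mulr_suml.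
      rewrite exchange_big /=; apply: eq_bigr => i _.
      under eq_bigr do rewrite mulr_sumr.
      rewrite exchange_big /=; apply: eq_bigr => i' _.
      by rewrite mulr_sumr; apply: eq_bigr => d _; ring.
    rewrite sumrB !E [X in _ - X]exchange_big /= -sumrB; apply: eq_bigr => i _.
    rewrite -sumrB; apply: eq_bigr => i' _; rewrite sumrB.
    by rewrite mulrBr [cm j' i' z * _]mulrC.
  rewrite -sumrB; apply: eq_bigr => i _; rewrite -sumrB; apply: eq_bigr => i' _.
  by rewrite flat // mulrBr.
rewrite addrA (sum_coef j j' (fun m => th m c b z)).
have -> : \sum_m coef j j' m z * th m c b z = 0.
  under eq_bigr do rewrite frame3 // mulr_sumr.
  rewrite exchange_big /= big1 // => m _.
  by under eq_bigr do rewrite mulrA; rewrite -mulr_suml bracket_g // mul0r.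
by rewrite !sumrB; ring.
Qed.

Lemma frame_compatible : compatible r g frame_field frame_pot.
Proof.
split; [exact: hol_frame_field|exact: hol_frame_pot|by move=> j m z; exact: frame1|].
move=> i j t tr f hf b z hz.
have hzr : nr z < r by lra.
apply: (@op_comm _ _ _ t) => //.
- by move=> l; apply: hol_le tr _; exact: hol_frame_field.
- by move=> l; apply: hol_le tr _; exact: hol_frame_field.
- by move=> c d; apply: hol_le tr _; exact: hol_frame_pot.
- by move=> c d; apply: hol_le tr _; exact: hol_frame_pot.
- by move=> l; apply: frame_comm.
- by move=> c d; apply: frame_flat.
Qed.

Lemma frame_op_all (u : 'I_e -> V -> C) z : nr z < r ->
  (forall j b, op (frame_field j) (frame_pot j) u b z = 0) ->
  forall i b, dir (s i) (u b) z = \sum_c u c z * th i c b z.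
Proof.
move=> hz hu i b.
have -> : dir (s i) (u b) z = \sum_j s i (g j) z * dir (frame_field j) (u b) z.
  rewrite /dir; under eq_bigr do rewrite frame2 // mulr_suml.
  rewrite exchange_big /=; apply: eq_bigr => j _; rewrite mulr_sumr.
  by apply: eq_bigr => l _; rewrite mulrA.
have -> : \sum_c u c z * th i c b z = \sum_j s i (g j) z * (- \sum_c u c z * frame_pot j c b z).
  under eq_bigr do rewrite frame3 // mulr_sumr.
  rewrite exchange_big /=; apply: eq_bigr => j _; rewrite -sumrN mulr_sumr.
  by apply: eq_bigr => c _; ring.
apply: eq_bigr => j _; congr (_ * _).
by have /eqP := hu j b; rewrite /op addr_eq0 => /eqP.
Qed.
End PoissonFrame.

(** * Maximal minors and the trivializing gauge *)

Lemma exists_unit_minor (F : fieldType) (n : nat) (A : 'M[F]_n) :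
  exists f g : 'I_(\rank A) -> 'I_n, mxsub f g A \in unitmx.
Proof.
pose B := rowsub (maxrankfun A) A.
have fB : row_full B^T by rewrite /row_full mxrank_tr; exact: maxrowsub_free.
exists (maxrankfun A), (fullrankfun fB).
rewrite -unitmx_tr (_ : _^T = rowsub (fullrankfun fB) B^T) ?fullrowsub_unit //.
by apply/matrixP => i j; rewrite !mxE.
Qed.

(** Skeleton decomposition: the rows through an invertible minor of size equal to the rank span the
    row space, and the columns of the minor determine the coefficients. *)
Lemma minor_span (F : fieldType) (n k : nat) (A : 'M[F]_n) (f g : 'I_k -> 'I_n) :
  \rank A = k -> mxsub f g A \in unitmx ->
  A = colsub g A *m invmx (mxsub f g A) *m rowsub f A.
Proof.
move=> rA uA.
have BA : (rowsub f A <= A)%MS by rewrite rowsubE submxMl.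
have rB : \rank (rowsub f A) = k.
  apply/eqP; rewrite eqn_leq rank_leq_row /=.
  have := mxrankM_maxl (rowsub f A) (colsub g 1%:M : 'M[F]_(n, k)).
  rewrite mulmx_colsub mulmx1 (_ : colsub g (rowsub f A) = mxsub f g A); last first.
    by apply/matrixP => i j; rewrite !mxE.
  by rewrite mxrank_unit.
have : (A <= rowsub f A)%MS by rewrite -(geq_leqif (mxrank_leqif_sup BA)) rB rA.
move=> /submxP [Y AY].
have gA : colsub g A = Y *m mxsub f g A.
  by rewrite {1}AY -mulmx_colsub; congr (_ *m _); apply/matrixP => i j; rewrite !mxE.
by rewrite gA mulmxK.
Qed.

Section FlatSections.
Variables (R : realType) (n : nat).
Local Notation C := (cplx R).
Local Notation V := 'rV[C]_n.

Lemma differentiable_det (k : nat) (M : V -> 'M[C]_k) z :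
  (forall i j, differentiable (fun x => M x i j) z) -> differentiable (fun x => \det (M x)) z.
Proof.
move=> h; rewrite /determinant; apply: differentiable_fsum => p.
apply: (@differentiableM _ _ (fun=> _)); first exact: differentiable_cst.
by apply: differentiable_fprod => i; exact: h.
Qed.

Lemma differentiable_adj (k : nat) (M : V -> 'M[C]_k) z a b :
  (forall i j, differentiable (fun x => M x i j) z) -> differentiable (fun x => (\adj (M x)) a b) z.
Proof.
move=> h; rewrite (_ : (fun x => _) = (fun x => (-1) ^+ (b + a) * \det (row' b (col' a (M x))))); last first.
  by apply/funext => x; rewrite mxE.
apply: (@differentiableM _ _ (fun=> (-1) ^+ (b + a))); first exact: differentiable_cst.
apply: differentiable_det => i j.
rewrite (_ : (fun x => _) = (fun x => M x (lift b i) (lift a j))); first exact: h.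
by apply/funext => x; rewrite !mxE.
Qed.

Lemma nonzero_ball (f : V -> C) : differentiable f 0 -> f 0 != 0 ->
  exists d : R, 0 < d /\ forall z, nr z < d -> f z != 0.
Proof.
move=> /differentiable_continuous /nr_continuous h f0.
have f0' : 0 < nr (f 0) by rewrite nr_gt0.
have [d [d0 hd]] := h _ f0'; exists d; split=> // z hz.
apply/eqP => fz; have := hd z; rewrite subr0 => /(_ hz).
by rewrite fz sub0r nrN ltxx.
Qed.

Lemma eq_dense (f g : V -> C) (P : V -> Prop) z : differentiable f z -> differentiable g z ->
  (forall d : R, 0 < d -> exists y, [/\ nr (y - z) < d, P y & f y = g y]) -> f z = g z.
Proof.
move=> /differentiable_continuous /nr_continuous hf /differentiable_continuous /nr_continuous hg h.
apply/eqP; rewrite -subr_eq0; apply/eqP/nr_eq0/eqP; rewrite eq_le nr_ge0 andbT.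
apply/ler_addgt0Pr => e e0; rewrite add0r; have e2 : 0 < e / 2 by lra.
have [d1 [d10 h1]] := hf _ e2; have [d2 [d20 h2]] := hg _ e2.
have [|y [hy _ fg]] := h (Num.min d1 d2); first by rewrite lt_min d10.
move: hy; rewrite lt_min => /andP[/h1 q1 /h2 q2].
rewrite fg in q1.
have := nrD (g y - g z) (- (g y - f z)); rewrite nrN.
have -> : g y - g z - (g y - f z) = f z - g z by ring.
lra.
Qed.

Variable e : nat.
Variables (s : 'I_n -> 'I_n -> V -> C) (th : 'I_n -> 'I_e -> 'I_e -> V -> C).

Lemma poisson_flat_section (r : R) (k : nat) : 0 < r ->
  (forall i l, hol r (s i l)) -> (forall i c b, hol r (th i c b)) ->
  (forall i j l z, nr z < r ->
    dir (s i) (s j l) z - dir (s j) (s i l) z = \sum_m pd m (s i j) z * s m l z) ->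
  (forall i j c b z, nr z < r ->
    dir (s i) (th j c b) z - dir (s j) (th i c b) z =
    \sum_m pd m (s i j) z * th m c b z
    - \sum_d (th i c d z * th j d b z - th j c d z * th i d b z)) ->
  (forall z, nr z < r -> \rank (\matrix_(i, l) s i l z) = k) ->
  (forall z (d : R), nr z < r -> 0 < d -> exists y, [/\ nr (y - z) < d, nr y < r &
     forall c b, exists eta : 'I_n -> C, forall i, th i c b y = \sum_m s i m y * eta m]) ->
  exists (r' : R) (H : V -> 'M[C]_e), [/\ 0 < r', r' <= r,
    forall a b, hol r' (fun z => H z a b), forall z, nr z < r' -> H z \in unitmx &
    forall i a b z, nr z < r' ->
      dir (s i) (fun x => H x a b) z = \sum_c H z a c * th i c b z].
Proof.
move=> r0 hs hth jac flat rk dns.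
pose S z := \matrix_(i, l) s i l z.
have SE : \rank (S 0) = k by apply: rk; rewrite nr0.
have [f [g uS]] : exists f g : 'I_k -> 'I_n, mxsub f g (S 0) \in unitmx.
  by rewrite -SE; exact: exists_unit_minor.
pose M z := mxsub f g (S z).
have hM z : nr z < r -> forall i j, differentiable (fun x => M x i j) z.
  move=> hz i j; rewrite (_ : (fun x => _) = s (f i) (g j)); first exact: hs.
  by apply/funext => x; rewrite !mxE.
have d0 : differentiable (fun x => \det (M x)) 0.
  by apply: differentiable_det; apply: hM; rewrite nr0.
have [t [t0 ht]] : exists t : R, 0 < t /\ forall z, nr z < t -> \det (M z) != 0.
  by apply: nonzero_ball d0 _; move: uS; rewrite unitmxE unitfE.
have [r1 [r10 r1r r1t]] : exists r1, [/\ 0 < r1, r1 <= r & r1 <= t].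
  by exists (Num.min r t); rewrite lt_min r0 t0 !ge_min !lexx orbT.
(* The inverse minor composed with the selection of its rows, written with adjugate and determinant
   so that its entries are visibly holomorphic. *)
pose cm (j : 'I_k) (i : 'I_n) z := \sum_a (\det (M z))^-1 * (\adj (M z)) j a * (f a == i)%:R.
have hcm j i : hol r1 (cm j i).
  apply: hol_sum => a z hz; have hzr : nr z < r by lra.
  apply: (@differentiableM _ _ (fun z => (\det (M z))^-1 * (\adj (M z)) j a) (fun=> _)); last exact: differentiable_cst.
  apply: differentiableM; last by apply: differentiable_adj; exact: hM.
  apply: differentiableV; first by apply: differentiable_det; exact: hM.
  by apply: ht; lra.
have cmE z : nr z < r1 -> \matrix_(j, i) cm j i z = invmx (M z) *m rowsub f 1%:M.
  move=> hz; have uM : M z \in unitmx by rewrite unitmxE unitfE ht //; lra.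
  by apply/matrixP => j i; rewrite !mxE /cm; apply: eq_bigr => a _; rewrite /invmx uM !mxE.
have ffE z : nr z < r1 -> \matrix_(j, l) frame_field s cm j l z = invmx (M z) *m rowsub f (S z).
  move=> hz; rewrite rowsubE mulmxA -cmE //.
  by apply/matrixP => j l; rewrite !mxE; apply: eq_bigr => i _; rewrite !mxE.
have F1 j m z : nr z < r1 -> frame_field s cm j (g m) z = (j == m)%:R.
  move=> hz; have uM : M z \in unitmx by rewrite unitmxE unitfE ht //; lra.
  have := mulVmx uM => /matrixP /(_ j m); rewrite [RHS]mxE => <-.
  have -> : M z = colsub g (rowsub f (S z)) by apply/matrixP => a b; rewrite !mxE.
  have -> : colsub g (rowsub f (S z)) = M z by apply/matrixP => a b; rewrite !mxE.
  have := ffE z hz => /matrixP /(_ j (g m)); rewrite !mxE => ->.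
  by apply: eq_bigr => a _; rewrite !mxE.
have F2 i l z : nr z < r1 -> s i l z = \sum_j s i (g j) z * frame_field s cm j l z.
  move=> hz; have uM : M z \in unitmx by rewrite unitmxE unitfE ht //; lra.
  have rz : \rank (S z) = k by apply: rk; lra.
  have := minor_span rz uM; rewrite -mulmxA -/(M z) -ffE // => /matrixP /(_ i l).
  by rewrite !mxE => ->; apply: eq_bigr => j _; rewrite !mxE.
have hpot j c b : hol r1 (frame_pot th cm j c b).
  by apply: hol_frame_pot => // i c' b'; apply: hol_le r1r _.
have F3 i c b z : nr z < r1 -> th i c b z = \sum_j s i (g j) z * (- frame_pot th cm j c b z).
  move=> hz; have hzr : nr z < r by lra.
  apply: (@eq_dense (th i c b) (fun z => \sum_j s i (g j) z * (- frame_pot th cm j c b z)) (fun=> True)).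
  - exact: hth.
  - move: (hz); apply: hol_sum => j; apply: holM; first exact: hol_le r1r _.
    exact: holN.
  move=> d d0'; have dm : 0 < Num.min d (r1 - nr z) by rewrite lt_min d0' subr_gt0.
  have [y [hy yr hy2]] := dns z _ hzr dm; move: hy; rewrite lt_min => /andP[hy hyz].
  exists y; split=> //; have [eta heta] := hy2 c b.
  have yr1 : nr y < r1 by have := nrD (y - z) z; rewrite subrK; lra.
  (* At [y] the potential is [s] contracted with [eta], so the claim is [F2] contracted with [eta];
     continuity carries it to [z]. *)
  have -> : th i c b y = \sum_m (\sum_j s i (g j) y * frame_field s cm j m y) * eta m.
    by rewrite heta; apply: eq_bigr => m _; rewrite -F2.
  under eq_bigr do rewrite mulr_suml.
  rewrite exchange_big /=; apply: eq_bigr => j _.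
  rewrite /frame_pot opprK.
  under [in RHS]eq_bigr do rewrite heta mulr_sumr.
  rewrite exchange_big /= mulr_sumr; apply: eq_bigr => m _.
  by rewrite -mulrA; congr (_ * _); rewrite mulr_suml; apply: eq_bigr => q _; rewrite mulrA.
have hs1 i l : hol r1 (s i l) by apply: hol_le r1r _.
have hth1 i c b : hol r1 (th i c b) by apply: hol_le r1r _.
have cmp : compatible r1 g (frame_field s cm) (frame_pot th cm).
  apply: frame_compatible => //.
  - by move=> i j l z hz; apply: jac; lra.
  - by move=> i j c b z hz; apply: flat; lra.
(* Row a of the gauge starts at the a-th unit vector, so [H] is the identity at 0 and invertible
   nearby. *)
have /choice [W hW] : forall a : 'I_e, exists x : R * ('I_e -> V -> C), [/\ 0 < x.1, x.1 <= r1, forall b, hol x.1 (x.2 b),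
    forall b, x.2 b 0 = (a == b)%:R &
    forall j b z, nr z < x.1 -> op (frame_field s cm j) (frame_pot th cm j) x.2 b z = 0].
  move=> a; have [r' [w hw]] := flat_section (fun b => (a == b)%:R) r10 cmp.
  by exists (r', w).
have [r2 [r20 r2r1 hr2]] : exists r2, [/\ 0 < r2, r2 <= r1 & forall a, r2 <= (W a).1].
  apply: (@fin_radius _ _ (fun a x => x <= (W a).1)) => //.
    by move=> a p q pq hq; lra.
  by move=> a; exists (W a).1 => //; have [] := hW a.
pose H z : 'M[C]_e := \matrix_(a, b) (W a).2 b z.
have HE a b : (fun z => H z a b) = (W a).2 b by apply/funext => z; rewrite mxE.
have hH a b : hol r2 (fun z => H z a b).
  by rewrite HE; have [_ _ h _ _] := hW a; apply: hol_le (hr2 a) _; exact: h.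
have dH : differentiable (fun z => \det (H z)) 0.
  by apply: differentiable_det => i j; apply: hH; rewrite nr0.
have [t3 [t30 ht3]] : exists t : R, 0 < t /\ forall z, nr z < t -> \det (H z) != 0.
  apply: nonzero_ball dH _.
  have -> : H 0 = 1%:M by apply/matrixP => a b; rewrite !mxE; have [_ _ _ -> _] := hW a.
  by rewrite det1 oner_eq0.
exists (Num.min r2 t3), H; split.
- by rewrite lt_min r20.
- by rewrite ge_min (le_trans r2r1 r1r).
- by move=> a b; apply: hol_le (hH a b); rewrite ge_min lexx.
- by move=> z; rewrite lt_min => /andP[_ hz]; rewrite unitmxE unitfE ht3.
move=> i a b z; rewrite lt_min => /andP[hz _].
rewrite HE (frame_op_all (g := g) (cm := cm) (th := th) (r := r1) F2 F3) //.
- by apply: eq_bigr => c _; rewrite mxE.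
- by lra.
by move=> j b'; have [_ _ _ _ h] := hW a; apply: h; have := hr2 a; lra.
Qed.
End FlatSections.

(** * Charts of the manifold *)

Section Charts.
Variables (R : realType) (n : nat).
Local Notation C := (cplx R).
Local Notation V := 'rV[C]_n.

Lemma derive_coord (l : 'I_n) (w z : V) : 'D_w (fun x : V => x ord0 l) z = w ord0 l.
Proof.
have dc : differentiable (fun x : V => x ord0 l) z by exact: differentiable_coord.
rewrite {1}(row_sum_delta w).
have E (I : Type) (q : seq I) (F : I -> V) :
    'D_(\sum_(i <- q) F i) (fun x : V => x ord0 l) z = \sum_(i <- q) 'D_(F i) (fun x : V => x ord0 l) z.
  elim: q => [|i q ih]; first by rewrite !big_nil derive0.
  by rewrite !big_cons deriveDv // ih.
rewrite E (bigD1 l) //= deriveZv // big1 ?addr0.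
  by have := pd_coord l l z; rewrite pd.unlock eqxx => ->; rewrite /GRing.scale /= mulr1.
move=> i il; rewrite deriveZv //.
by have := pd_coord i l z; rewrite pd.unlock (negbTE il) => ->; rewrite scaler0.
Qed.

Lemma derive_row_sum (f : V -> C) (a w : V) : differentiable f a ->
  'D_w f a = \sum_l w ord0 l * 'D_(delta_mx ord0 l) f a.
Proof.
move=> df; rewrite {1}(row_sum_delta w).
elim: (index_enum _) => [|l q ih]; first by rewrite !big_nil derive0.
by rewrite !big_cons deriveDv // deriveZv // ih.
Qed.

Lemma derive_comp (F : V -> C) (G : V -> V) (a w : V) :
  differentiable G a -> differentiable F (G a) ->
  'D_w (F \o G) a = \sum_l 'D_w (fun z => G z ord0 l) a * 'D_(delta_mx ord0 l) F (G a).
Proof.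
move=> dG dF.
have chain (W : normedModType C) (K : V -> W) : differentiable K (G a) ->
    'D_w (K \o G) a = 'D_('D_w G a) K (G a).
  move=> dK; have dKG := differentiable_comp dG dK.
  by rewrite (deriveE _ dKG) (diff_comp dG dK) /= (deriveE _ dK) (deriveE _ dG).
rewrite (chain _ _ dF) (derive_row_sum _ dF).
apply: eq_bigr => l _; congr (_ * _).
have dc : differentiable (fun x : V => x ord0 l) (G a) by exact: differentiable_coord.
by rewrite -(derive_coord l ('D_w G a) (G a)) -(chain _ _ dc).
Qed.

Lemma nr_lt_rV (z : V) (d : R) : 0 < d -> (forall l, nr (z ord0 l) < d) -> nr z < d.
Proof.
move=> d0 h.
have [s [s0 sd hs]] := @fin_radius R 'I_n (fun l s => s <= d - nr (z ord0 l)) d d0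
  (fun _ _ _ st hst => le_trans st hst)
  (fun l => ex_intro2 _ _ (d - nr (z ord0 l)) (eq_ind_r is_true (h l) (subr_gt0 _ _)) (lexx _)).
apply: le_lt_trans (_ : d - s < d); last by lra.
by apply/nr_rV_le => [|l]; [lra|have := hs l; lra].
Qed.

(** The form in which density of the complement of the divisor is used: all coordinates are shifted
    by one small positive real number. *)
Lemma perturb_nonzero (z : V) (d : R) : 0 < d ->
  exists y : V, nr (y - z) < d /\ forall l, y ord0 l != 0.
Proof.
move=> d0.
have [s [s0 sd hs]] : exists s, [/\ 0 < s, s <= d &
    forall (l : 'I_n) (t : R), 0 < t -> t < s -> z ord0 l + t%:C%C != 0].
  apply: fin_radius => //; first by move=> l s t st h x x0 xs; apply: h; lra.
  move=> l; have [z0|z0] := eqVneq (z ord0 l) 0.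
    exists 1 => // t t0 _; rewrite z0 add0r -nr_gt0 nr_real gtr0_norm //.
  exists (nr (z ord0 l)); first by rewrite nr_gt0.
  move=> t t0 tz; apply/eqP => /eqP; rewrite addr_eq0 => /eqP e.
  by move: tz; rewrite e nrN nr_real gtr0_norm // ltxx.
exists (\row_l (z ord0 l + (s / 2)%:C%C)); split; last by move=> l; rewrite mxE; apply: hs; lra.
apply: nr_lt_rV => // l; rewrite !mxE addrAC subrr add0r nr_real gtr0_norm; lra.
Qed.

Variable X : complexManifold R n.
Implicit Types (phi psi : chart R n X) (f : X -> C).

Lemma partial_change phi psi f x : atlas phi -> atlas psi -> cdom phi x -> cdom psi x ->
  differentiable (f \o cinv psi : V -> C) (cmap psi x) ->
  forall i, partial phi i f x = \sum_k jac phi psi x i k * partial psi k f x.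
Proof.
move=> aphi apsi hx hx' df i.
have dG : differentiable (cmap psi \o cinv phi) (cmap phi x) by apply: atlas_compatible.
have Gx : (cmap psi \o cinv phi) (cmap phi x) = cmap psi x by rewrite /= cmapK.
rewrite /partial.
have -> : 'D_(delta_mx ord0 i) (f \o cinv phi : V -> C) (cmap phi x) =
   'D_(delta_mx ord0 i) ((f \o cinv psi) \o (cmap psi \o cinv phi) : V -> C) (cmap phi x).
  apply: near_eq_derive.
  have cp : (cmap phi @` cdom phi) (cmap phi x) by exists x.
  have : nbhs (cinv phi (cmap phi x)) (cdom psi).
    by rewrite cmapK //; apply: open_nbhs_nbhs; split=> //; exact: cdom_open.
  move=> h; have h' : nbhs (cmap phi x) [set y | cdom psi (cinv phi y)] := cinv_continuous cp h.
  apply: filterS h' => y /= hy.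
  by rewrite cmapK.
rewrite derive_comp ?Gx //.
by apply: eq_bigr => k _; rewrite /jac mxE.
Qed.

Lemma delta0_change (sigma : bivfield X) phi psi f x : holo_bivfield sigma ->
  atlas phi -> atlas psi -> cdom phi x -> cdom psi x ->
  differentiable (f \o cinv psi : V -> C) (cmap psi x) ->
  delta0 sigma f psi x = delta0 sigma f phi x *m jac phi psi x.
Proof.
move=> [_ _ hs] aphi apsi hx hx' df.
have E : dfun f phi x = dfun f psi x *m (jac phi psi x)^T.
  apply/rowP => i; rewrite mxE (partial_change aphi apsi hx hx' df) mxE.
  by apply: eq_bigr => k _; rewrite [in RHS]mxE [(jac _ _ _)^T _ _]mxE mulrC.
rewrite /delta0 /sharp E (hs _ _ _ aphi apsi hx hx').
by rewrite -!mulmxA.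
Qed.

(** The transition law in both directions bounds each rank by the other, without inverting the
    Jacobian. *)
Lemma rank_chart (sigma : bivfield X) phi x k : holo_bivfield sigma -> atlas phi -> cdom phi x ->
  has_rank sigma x k -> \rank (sigma phi x) = k.
Proof.
move=> [_ _ hs] aphi hx [psi apsi [hx' <-]].
apply/eqP; rewrite eqn_leq; apply/andP; split.
  rewrite (hs _ _ _ apsi aphi hx' hx).
  by apply: leq_trans (mxrankM_maxl _ _) _; exact: mxrankM_maxr.
rewrite (hs _ _ _ aphi apsi hx hx').
by apply: leq_trans (mxrankM_maxl _ _) _; exact: mxrankM_maxr.
Qed.
End Charts.

(** * The Poisson structure and the connection in a chart *)

Section ChartPoisson.
Variables (R : realType) (n : nat).
Local Notation C := (cplx R).
Local Notation V := 'rV[C]_n.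
Variables (X : complexManifold R n) (sigma : bivfield X) (phi : chart R n X).
Hypotheses (hsigma : holo_poisson sigma) (aphi : atlas phi).

(** [cinv] is total; this condition makes it a genuine inverse on the ball. *)
Definition chart_ball (r : R) := forall z : V, nr z < r -> cdom phi (cinv phi z) /\ cmap phi (cinv phi z) = z.

(* Row i of [sigma_chart] is the vector field X_{z_i}; as (delta f)_i = - X_{z_i} f, the
   equation delta H = - H Theta of a gauge to 0 reads X_{z_i} H = H Theta_i. *)
Definition sigma_chart (i l : 'I_n) (z : V) : C := sigma phi (cinv phi z) i l.

Definition theta_chart (e : nat) (Theta : vfmatrix X e) (i : 'I_n) (c b : 'I_e) (z : V) : C :=
  Theta c b phi (cinv phi z) ord0 i.

Lemma hol_chart r (W : set X) (f : X -> C) : chart_ball r -> holo_on W f ->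
  (forall z, nr z < r -> W (cinv phi z)) -> hol r (f \o cinv phi).
Proof.
move=> hr hf hW z hz; have [h1 h2] := hr z hz.
by have := hf phi (cinv phi z) aphi (hW z hz) h1; rewrite h2.
Qed.

Lemma partial_chart r m (f : X -> C) z : chart_ball r -> nr z < r ->
  partial phi m f (cinv phi z) = pd m (f \o cinv phi) z.
Proof. by move=> hr hz; have [_ h2] := hr z hz; rewrite pd.unlock /partial h2. Qed.

Lemma hol_sigma_chart r i l : chart_ball r -> hol r (sigma_chart i l).
Proof.
move=> hr; have [[_ h _] _] := hsigma.
by apply: (hol_chart hr (h phi i l aphi)) => z /hr [].
Qed.

Lemma sigma_chart_skew r i l z : chart_ball r -> nr z < r ->
  sigma_chart i l z = - sigma_chart l i z.
Proof.
move=> hr hz; have [[h _ _] _] := hsigma; have [h1 _] := hr z hz.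
by have /matrixP /(_ l i) := h phi _ aphi h1; rewrite !mxE.
Qed.

Lemma pd_sigma_chart_skew r m i l z : chart_ball r -> nr z < r ->
  pd m (sigma_chart i l) z = - pd m (sigma_chart l i) z.
Proof.
move=> hr hz; rewrite -(pdN _ (hol_sigma_chart l i hr hz)).
by apply: (pd_local _ hz) => y hy; exact: (sigma_chart_skew i l hr hy).
Qed.

(** The identity [X_f, X_g] = X_{f, g} for f = z_i and g = z_j, in components: skew-symmetry turns
    the cyclic sum of the Schouten bracket into a commutator. *)
Lemma sigma_chart_jacobi r i j l z : chart_ball r -> nr z < r ->
  dir (sigma_chart i) (sigma_chart j l) z - dir (sigma_chart j) (sigma_chart i l) z =
  \sum_m pd m (sigma_chart i j) z * sigma_chart m l z.
Proof.
move=> hr hz; have [_ h] := hsigma; have [h1 _] := hr z hz.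
have := h phi _ i j l aphi h1; rewrite /schouten_self.
have two : (2%:R : C) != 0 by rewrite pnatr_eq0.
move=> /eqP; rewrite mulf_eq0 (negbTE two) /= => /eqP E.
apply/eqP; rewrite -subr_eq0; apply/eqP.
rewrite /dir -!sumrB; apply: (@oppr_inj C); rewrite oppr0 -[RHS]E -sumrN.
apply: eq_bigr => m _; rewrite !(partial_chart _ _ hr hz).
rewrite -[sigma phi (cinv phi z) m i]/(sigma_chart m i z) -[sigma phi (cinv phi z) m j]/(sigma_chart m j z).
rewrite -[sigma phi (cinv phi z) m l]/(sigma_chart m l z).
rewrite -[(fun y => sigma phi y j l) \o cinv phi]/(sigma_chart j l).
rewrite -[(fun y => sigma phi y l i) \o cinv phi]/(sigma_chart l i).
rewrite -[(fun y => sigma phi y i j) \o cinv phi]/(sigma_chart i j).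
rewrite (pd_sigma_chart_skew m l i hr hz) (sigma_chart_skew m i hr hz) (sigma_chart_skew m j hr hz).
ring.
Qed.

(* [delta1] satisfies delta(f v) = f delta(v) - delta(f) /\ v, so delta Theta + Theta /\ Theta = 0
   is indeed the zero-curvature equation of the operators X_{z_i} - . Theta_i. *)
Lemma theta_chart_flat e (Theta : vfmatrix X e) r i j c b z : chart_ball r -> nr z < r ->
  poisson_flat sigma (cdom phi) Theta ->
  dir (sigma_chart i) (theta_chart Theta j c b) z - dir (sigma_chart j) (theta_chart Theta i c b) z =
  \sum_m pd m (sigma_chart i j) z * theta_chart Theta m c b z
  - \sum_d (theta_chart Theta i c d z * theta_chart Theta j d b z
            - theta_chart Theta j c d z * theta_chart Theta i d b z).
Proof.
move=> hr hz hf; have [h1 _] := hr z hz.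
have /matrixP /(_ i j) := hf c b phi _ aphi h1 h1.
rewrite [LHS]mxE [RHS]mxE [X in X + _]mxE [X in - X + _]mxE summxE.
under [X in _ + X]eq_bigr do rewrite mxE.
rewrite -[X in _ + X]/(\sum_d (theta_chart Theta i c d z * theta_chart Theta j d b z
            - theta_chart Theta j c d z * theta_chart Theta i d b z)).
set Q := \sum_d _ => E.
apply/eqP; rewrite -subr_eq0; apply/eqP; rewrite -[RHS]E opprD opprK addrA.
congr (_ + _); rewrite /dir -!sumrB -sumrN; apply: eq_bigr => m _.
rewrite !(partial_chart _ _ hr hz).
rewrite -[sigma phi (cinv phi z) m j]/(sigma_chart m j z) -[sigma phi (cinv phi z) i m]/(sigma_chart i m z).
rewrite -[(fun y => sigma phi y i j) \o cinv phi]/(sigma_chart i j).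
rewrite -[(fun y => Theta c b phi y ord0 i) \o cinv phi]/(theta_chart Theta i c b).
rewrite -[(fun y => Theta c b phi y ord0 j) \o cinv phi]/(theta_chart Theta j c b).
rewrite -[(Theta c b phi (cinv phi z) ord0 m)]/(theta_chart Theta m c b z).
rewrite (sigma_chart_skew m j hr hz).
ring.
Qed.

Lemma chart_trivialization (e : nat) (Theta : vfmatrix X e) (r : R) (k : nat) (D : set X) :
  0 < r -> chart_ball r ->
  (forall a b, holo_vfield (cdom phi) (Theta a b)) ->
  poisson_flat sigma (cdom phi) Theta ->
  (forall z, nr z < r -> has_rank sigma (cinv phi z) k) ->
  (forall a b, exists eta, forall z, nr z < r -> ~ D (cinv phi z) ->
      Theta a b phi (cinv phi z) = sharp sigma eta phi (cinv phi z)) ->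
  (forall z : V, (forall l, z ord0 l != 0) -> nr z < r -> ~ D (cinv phi z)) ->
  exists (r' : R) (H : V -> 'M[C]_e), [/\ 0 < r', r' <= r,
    forall a b, hol r' (fun z => H z a b), forall z, nr z < r' -> H z \in unitmx &
    forall i a b z, nr z < r' ->
      dir (sigma_chart i) (fun x => H x a b) z = \sum_c H z a c * theta_chart Theta i c b z].
Proof.
move=> r0 hr hT hf hk heta hD.
apply: (@poisson_flat_section _ _ _ _ _ r k) => //.
- by move=> i l; exact: hol_sigma_chart.
- move=> i c b; have [h _] := hT c b.
  by apply: (hol_chart hr (h phi i aphi)) => z /hr [].
- by move=> i j l z; exact: sigma_chart_jacobi.
- by move=> i j c b z hz; exact: (@theta_chart_flat _ _ r).
- move=> z hz; have [h1 _] := hr z hz.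
  rewrite -(rank_chart hsigma.1 aphi h1 (hk z hz)); congr (\rank _).
  by apply/matrixP => i l; rewrite mxE.
move=> z d hz d0.
have dm : 0 < Num.min d (r - nr z) by rewrite lt_min d0 subr_gt0.
have [y [hy y0]] := perturb_nonzero z dm.
move: hy; rewrite lt_min => /andP[yd yr].
have hyr : nr y < r by have := nrD (y - z) z; rewrite subrK; lra.
exists y; split=> // c b; have [eta he] := heta c b.
(* [sharp] multiplies [sigma] from the left, whereas rows of [sigma] are contracted on the right;
   skew-symmetry accounts for the sign. *)
exists (fun m => - eta phi (cinv phi y) ord0 m) => i.
rewrite /theta_chart he //; last exact: hD.
rewrite /sharp mxE; apply: eq_bigr => m _.
by rewrite (sigma_chart_skew i m hr hyr) mulrNN mulrC.
Qed.

(** The equation for [H] is known in the chart [phi] only. It says delta H = - H Theta, and both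
    sides transform as vector fields, so the cancellation holds in every chart [psi]. *)
Lemma gauge_vanishes (e : nat) (Theta : vfmatrix X e) (H : V -> 'M[C]_e) (r : R) psi x a b :
  chart_ball r -> (forall a b, hol r (fun z => H z a b)) ->
  (forall a b, holo_vfield (cdom phi) (Theta a b)) ->
  (forall i a b z, nr z < r ->
      dir (sigma_chart i) (fun x => H x a b) z = \sum_c H z a c * theta_chart Theta i c b z) ->
  cdom phi x -> nr (cmap phi x) < r -> atlas psi -> cdom psi x ->
  gauge sigma (H \o cmap phi) Theta a b psi x = 0.
Proof.
move=> hr hH hT eqH hx xr apsi hx'.
have xE : cinv phi (cmap phi x) = x by rewrite cmapK.
have dH c d : differentiable ((fun y => H (cmap phi y) c d) \o cinv psi : V -> C) (cmap psi x).
  have dG : differentiable (cmap phi \o cinv psi) (cmap psi x) by apply: atlas_compatible.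
  have dF : differentiable (fun z => H z c d) ((cmap phi \o cinv psi) (cmap psi x)).
    by apply: hH; rewrite /= cmapK.
  exact: (differentiable_comp dG dF).
have phiE c d : delta0 sigma (fun y => H (cmap phi y) c d) phi x =
    - \sum_q H (cmap phi x) c q *: Theta q d phi x.
  apply/rowP => i; rewrite /delta0 /sharp mxE [RHS]mxE summxE.
  under [in RHS]eq_bigr do rewrite mxE.
  have := eqH i c d _ xr; rewrite /theta_chart xE => <-.
  rewrite /dir -sumrN; apply: eq_bigr => m _.
  rewrite mxE -{1 2}xE (partial_chart _ _ hr xr).
  rewrite (pd_local (g := fun z => H z c d) _ xr); last by move=> y /hr [_ /= ->].
  by rewrite -[sigma phi _ m i]/(sigma_chart m i _) (sigma_chart_skew m i hr xr) mulrN mulrC.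
have psiE c d : delta0 sigma (fun y => H (cmap phi y) c d) psi x =
    - \sum_q H (cmap phi x) c q *: Theta q d psi x.
  rewrite (delta0_change hsigma.1 aphi apsi hx hx' (dH c d)) phiE mulNmx mulmx_suml.
  congr (- _); apply: eq_bigr => q _; have [_ h] := hT q d.
  by rewrite (h phi psi x aphi apsi hx hx hx') scalemxAl.
rewrite /gauge; under eq_bigr do rewrite psiE scalerN scaler_sumr.
rewrite sumrN /= addrC; apply/eqP; rewrite subr_eq0; apply/eqP.
rewrite [RHS]exchange_big /=; apply: eq_bigr => c _; apply: eq_bigr => d _.
by rewrite scalerA mulrC.
Qed.
End ChartPoisson.

(** * The normal form near a point of the divisor *)

Theorem theorem5p10 (R : realType) (n : nat) (X : complexManifold R n)
  (sigma : bivfield X) (I : Type) (Di : I -> set X)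
  (hsigma : holo_poisson sigma)
  (hstanding : standing_hypotheses sigma Di)
  (p : X) (hpD : (\bigcup_i Di i) p) (hpo : locally_constant_rank sigma p)
  (phi : chart R n X) (r : nat) (hr : (r <= n)%N)
  (hphi : snc_chart (\bigcup_i Di i) r phi)
  (rho : 'I_n -> cplx R) (hrho : forall i, 0 < rho i)
  (hpoly : cmap phi @` cdom phi = cpolydisc rho)
  (hp : cdom phi p) (hp0 : cmap phi p = 0)
  (hUo : cdom phi `<=` locally_constant_rank sigma)
  (Xg : 'I_r -> vfield X)
  (hXg : forall i, is_log_sharp sigma (\bigcup_i Di i) (cdom phi)
           (dlog (zc phi (widen_ord hr i))) (Xg i))
  (e : nat) (E : holoBundle X e)
  (nabla : logPoissonConnection E sigma (\bigcup_i Di i))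
  (fr : 'I_e -> bsection E) (hfr : holo_frame (cdom phi) fr)
  (Theta : vfmatrix X e)
  (hTheta : connection_matrix nabla (cdom phi) fr Theta)
  (hflat : poisson_flat sigma (cdom phi) Theta)
  (A : 'I_r -> 'M[cplx R]_e)
  (hA : forall i j, A i *m A j = A j *m A i)
  (hpp : fixed_principal_part sigma (\bigcup_i Di i) phi hr Xg A Theta)
  (hnr : eff_nonresonant sigma (\bigcup_i Di i) phi hr Xg p A)
  (hplb : poincare_lower_bound sigma (\bigcup_i Di i) phi hr Xg p A) :
  exists (rho' : 'I_n -> cplx R) (U' : set X) (H : X -> 'M[cplx R]_e)
         (At : 'I_r -> 'M[cplx R]_e),
    [/\ forall i, 0 < rho' i <= rho i,
        U' = [set x | cdom phi x /\ cpolydisc rho' (cmap phi x)],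
        (forall a b, holo_on U' (fun x => H x a b)) /\
        (forall x, U' x -> H x \in unitmx),
        forall i j, At i *m At j = At j *m At i
      & forall a b, eq_vfield U' (gauge sigma H Theta a b)
          (fun psi x => \sum_i At i a b *: Xg i psi x)].
Proof.
set D := \bigcup_i Di i in hphi hXg nabla hTheta hpp hnr hplb *.
have [aphi _ hD] := hphi.
have hT a b : Flog sigma D (cdom phi) (Theta a b) by case: hTheta => h _; exact: h.
have cinv0 : cinv phi 0 = p by rewrite -hp0 cmapK.
have im0 : (cmap phi @` cdom phi) 0 by exists p.
have near_p (P : set X) : nbhs p P -> exists d : R, 0 < d /\ forall z, nr z < d -> P (cinv phi z).
  rewrite -cinv0 => /(cinv_continuous im0) /= /nr_nbhs [d [d0 hd]].
  by exists d; split=> // z hz; apply: hd; rewrite subr0.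
have [R0 [R00 _ hR0]] : exists s : R, [/\ 0 < s, s <= 1 & forall i, s%:C%C <= rho i].
  apply: (@fin_radius _ _ (fun i s => s%:C%C <= rho i)) => //.
    by move=> i s t st; apply: le_trans; rewrite lecR.
  move=> i; have := hrho i; case: (rho i) => x y; rewrite ltcE /= => /andP[/eqP -> x0].
  by exists x => //.
have cb0 : chart_ball phi R0.
  move=> z hz; have : (cmap phi @` cdom phi) z.
    rewrite hpoly => i; rewrite nrE; apply: lt_le_trans (hR0 i).
    by rewrite ltcR; apply: le_lt_trans (nr_coord _ _) hz.
  by move=> [x hx <-]; rewrite cmapK.
have [k hk] := hpo.
have [R1 [R10 hR1]] := near_p _ hk.
(* Membership in [Flog] is local: each entry has its own logarithmic form on its own neighbourhood
   of p, and [fin_radius] then provides one ball for all entries. *)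
have hcov a b : exists d : R, 0 < d /\ exists eta : covfield X, forall z, nr z < d -> ~ D (cinv phi z) ->
   cdom phi (cinv phi z) -> Theta a b phi (cinv phi z) = sharp sigma eta phi (cinv phi z).
  have [_ /(_ p hp) [W' [eta [oW Wp _ _ [_ hsh]]]]] := hT a b.
  have [d [d0 hd]] := near_p W' (open_nbhs_nbhs (conj oW Wp)).
  by exists d; split=> //; exists eta => z hz nD cz; apply: hsh => //; split=> //; exact: hd.
have [r0 [r00 r0R hr0]] : exists s : R, [/\ 0 < s, s <= Num.min R0 R1 & forall x : 'I_e * 'I_e,
   exists eta : covfield X, forall z, nr z < s -> ~ D (cinv phi z) ->
   cdom phi (cinv phi z) -> Theta x.1 x.2 phi (cinv phi z) = sharp sigma eta phi (cinv phi z)].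
  apply: fin_radius; first by rewrite lt_min R00.
    by move=> x s t st [eta he]; exists eta => z hz; apply: he; apply: lt_le_trans hz st.
  by move=> [a b]; have [d [d0 h]] := hcov a b; exists d.
move: r0R; rewrite le_min => /andP[r0R0 r0R1].
have cb : chart_ball phi r0 by move=> z hz; apply: cb0; apply: lt_le_trans hz r0R0.
have [r' [H [r'0 r'r hH uH eqH]]] : exists (r' : R) (H : 'rV[cplx R]_n -> 'M[cplx R]_e), [/\ 0 < r', r' <= r0,
    forall a b, hol r' (fun z => H z a b), forall z, nr z < r' -> H z \in unitmx &
    forall i a b z, nr z < r' ->
      dir (sigma_chart sigma phi i) (fun x => H x a b) z = \sum_c H z a c * theta_chart phi Theta i c b z].
  apply: (@chart_trivialization _ _ _ _ _ hsigma aphi e Theta r0 k D) => //.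
  - by move=> a b; have [] := hT a b.
  - by move=> z hz; apply: hR1; apply: lt_le_trans hz r0R1.
  - move=> a b; have [eta he] := hr0 (a, b); exists eta => z hz nD.
    by apply: he => //; have [] := cb z hz.
  move=> z z0 hz; have [cz mz] := cb z hz; rewrite hD // => /eqP.
  rewrite prodf_seq_eq0 => /hasP [l _ /andP[_]].
  by rewrite /zc mz (negbTE (z0 l)).
have cb' : chart_ball phi r' by move=> z hz; apply: cb; apply: lt_le_trans hz r'r.
(* In the supremum norm the ball of radius r' is the polydisc with equal radii. *)
exists (fun _ => r'%:C%C), [set x | cdom phi x /\ cpolydisc (fun _ => r'%:C%C) (cmap phi x)],
  (H \o cmap phi), (fun _ => 0).
have inU x : cpolydisc (fun _ => r'%:C%C) (cmap phi x) -> nr (cmap phi x) < r'.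
  by move=> hx; apply: nr_lt_rV => // l; have := hx l; rewrite nrE ltcR.
split=> //.
- move=> i; rewrite ltcR r'0 /=; apply: le_trans (hR0 i).
  by rewrite lecR; apply: le_trans r'r r0R0.
- split; last by move=> x [hx /inU]; apply: uH.
  move=> a b psi x apsi [hx /inU xr] hx'.
  have dG : differentiable (cmap phi \o cinv psi) (cmap psi x) by apply: atlas_compatible.
  have dF : differentiable (fun z => H z a b) ((cmap phi \o cinv psi) (cmap psi x)).
    by apply: hH; rewrite /= cmapK.
  exact: (differentiable_comp dG dF).
move=> a b psi x apsi [hx /inU xr] hx'.
rewrite (gauge_vanishes hsigma aphi a b cb' hH _ eqH hx xr apsi hx'); last first.
  by move=> c d; have [] := hT c d.
by rewrite big1 // => i _; rewrite mxE scale0r.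
Qed.
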